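(* Let $\mathfrak n\in\mathbb N$ be odd. Assume that $\omega(A_0)=p/q$, that $\omega'(A_0)\neq 0$, and that $t_0\in[0,2\pi)$ is a zero of order $\mathfrak n$ of the subharmonic Melnikov function $M$, i.e. $\frac{d^k M}{dt_0^k}(t_0)=0$ for all $0\le k\le \mathfrak n-1$ and $\frac{d^{\mathfrak n}M}{dt_0^{\mathfrak n}}(t_0)\neq 0$. Then for $\varepsilon$ small enough the system $$\dot\alpha=\omega(A)+\varepsilon F(\alpha,A,t),\qquad \dot A=\varepsilon G(\alpha,A,t)$$ has at least one subharmonic solution of order $q/p$. Such a solution admits a convergent power series in $|\varepsilon|^{1/\mathfrak n!}$, and hence a convergent Puiseux series in $|\varepsilon|$.
   Context: Setting: $W\subset\mathbb R$ is open, $\mathbb T=\mathbb R/2\pi\mathbb Z$, $\omega:W\to\mathbb R$ is real analytic, and $F,G$ are real-analytic real-valued functions of $(\alpha,A,t)\in\mathbb T\times W\times\mathbb R$, $2\pi$-periodic in $\alpha$ and in $t$; $\varepsilon$ is a real parameter. Fix $A_0\in W$ with $\omega(A_0)=p/q$, where $p,q$ are relatively prime integers, $q\ge1$, $p\ne0$. Put $\alpha_0(t)=\omega(A_0)t$ and $T=2\pi q$. The subharmonic Melnikov function is $$M(t_0)=\frac1T\int_0^T G(\alpha_0(t),A_0,t+t_0)\,dt .$$ A subharmonic solution of order $q/p$ (with initial phase $t_0$) is a solution $(\alpha(t),A(t))$ of $\dot\alpha=\omega(A)+\varepsilon F(\alpha,A,t+t_0)$, $\dot A=\varepsilon G(\alpha,A,t+t_0)$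 (the given system with time shifted by $t_0$), depending on $\varepsilon$, such that $\alpha(t)-\alpha_0(t)$ and $A(t)-A_0$ are $T$-periodic in $t$ and tend to $0$ as $\varepsilon\to0$. It admits a convergent power series in $|\varepsilon|^{1/\mathfrak n!}$ if, for each fixed sign of $\varepsilon$, $\alpha(t)-\alpha_0(t)$ and $A(t)-A_0$ are given for $|\varepsilon|$ small by convergent power series in $|\varepsilon|^{1/\mathfrak n!}$ with $T$-periodic coefficients (the coefficients may depend on the sign of $\varepsilon$). *)

(* Defs.v *)
From Stdlib Require Import Reals ZArith.
From Coquelicot Require Import Coquelicot.
Open Scope R_scope.

Definition analytic1_on (W : R -> Prop) (f : R -> R) : Prop :=
  forall x : R, W x ->
    exists (a : nat -> R) (r : R), 0 < r /\
      forall h : R, Rabs h < r -> is_pseries a h (f (x + h)).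

Definition cube_sum (u : nat -> nat -> nat -> R) (N : nat) : R :=
  sum_n (fun i => sum_n (fun j => sum_n (fun k => u i j k) N) N) N.

(* Unconditional summation of a triple family: since the cubes [0, N]^3 exhaust
   nat^3, the first clause is absolute summability, and under it the limit of
   the cube sums is the sum of the family in any order. *)
Definition has_sum3 (u : nat -> nat -> nat -> R) (s : R) : Prop :=
  (exists B : R, forall N : nat, cube_sum (fun i j k => Rabs (u i j k)) N <= B)
  /\ is_lim_seq (cube_sum u) s.

(* Joint real analyticity in (alpha, A, t) on R x W x R. *)
Definition analytic3_on (W : R -> Prop) (f : R -> R -> R -> R) : Prop :=
  forall x y z : R, W y ->
    exists (c : nat -> nat -> nat -> R) (r : R), 0 < r /\
      forall h k l : R, Rabs h < r -> Rabs k < r -> Rabs l < r ->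
        has_sum3 (fun i j m => c i j m * h ^ i * k ^ j * l ^ m)
                 (f (x + h) (y + k) (z + l)).

(* Functions on (R / 2 PI Z) x W x R are represented by their lifts to
   R x W x R. *)
Definition periodic_angle_time (W : R -> Prop) (f : R -> R -> R -> R) : Prop :=
  forall x y z : R, W y ->
    f (x + 2 * PI) y z = f x y z /\ f x y (z + 2 * PI) = f x y z.

Definition periodic (T : R) (f : R -> R) : Prop :=
  forall t : R, f (t + T) = f t.

Definition period (q : Z) : R := 2 * PI * IZR q.

Definition alpha0 (omega : R -> R) (A0 t : R) : R := omega A0 * t.

Definition melnikov (omega : R -> R) (G : R -> R -> R -> R) (A0 : R) (q : Z)
    (t0 : R) : R :=
  / period q *
    RInt (fun t => G (alpha0 omega A0 t) A0 (t + t0)) 0 (period q).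

Definition zero_of_order (n : nat) (f : R -> R) (x : R) : Prop :=
  (forall k : nat, (k < n)%nat -> Derive_n f k x = 0) /\ Derive_n f n x <> 0.

Definition solves (W : R -> Prop) (omega : R -> R) (F G : R -> R -> R -> R)
    (eps t0 : R) (al A : R -> R) : Prop :=
  forall t : R,
    W (A t) /\
    is_derive al t (omega (A t) + eps * F (al t) (A t) (t + t0)) /\
    is_derive A t (eps * G (al t) (A t) (t + t0)).

Definition tends_to_0_uniformly (f : R -> R -> R) : Prop :=
  forall eta : R, 0 < eta ->
    locally' 0 (fun eps => forall t : R, Rabs (f eps t) < eta).

Definition alpha_dev (omega : R -> R) (A0 : R) (al : R -> R -> R)
    (eps t : R) : R := al eps t - alpha0 omega A0 t.

Definition A_dev (A0 : R) (A : R -> R -> R) (eps t : R) : R := A eps t - A0.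

(* The family (al eps, A eps), |eps| < epsbar, is a subharmonic solution of
   order q / p with initial phase t0, where omega A0 = p / q; the angle is
   lifted to R, so al eps (t + T) = al eps t + 2 PI p. *)
Definition subharmonic_solution (W : R -> Prop) (omega : R -> R)
    (F G : R -> R -> R -> R) (A0 : R) (q : Z) (t0 epsbar : R)
    (al A : R -> R -> R) : Prop :=
  (forall eps : R, Rabs eps < epsbar ->
     solves W omega F G eps t0 (al eps) (A eps) /\
     periodic (period q) (alpha_dev omega A0 al eps) /\
     periodic (period q) (A_dev A0 A eps)) /\
  tends_to_0_uniformly (alpha_dev omega A0 al) /\
  tends_to_0_uniformly (A_dev A0 A).

(* For each sign s of eps, f eps t is the sum of a power series in
   |eps|^(1/N) with T-periodic coefficients, on a range of eps independent
   of t.  eps = 0 is excluded because Rpower 0 x = 1. *)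
Definition fractional_series (N : nat) (T : R) (f : R -> R -> R) : Prop :=
  forall s : R, s = 1 \/ s = -1 ->
    exists (a : nat -> R -> R) (rho : R), 0 < rho /\
      (forall k : nat, periodic T (a k)) /\
      forall eps t : R, 0 < s * eps < rho ->
        is_pseries (fun k => a k t) (Rpower (Rabs eps) (/ INR N)) (f eps t).

Definition puiseux_series (T : R) (f : R -> R -> R) : Prop :=
  exists N : nat, (1 <= N)%nat /\ fractional_series N T f.

(* Main.v *)
Require Import Defs.
From Stdlib Require Import Reals ZArith.
From mathcomp Require all_boot all_order all_algebra polyrcf Rstruct.

(* A solution family is sought as [alpha = alpha0 + a], [A = A0 + b] with [a], [b] convergent
   power series in the parameters whose coefficients are continuous [T]-periodic functions of
   time.  Such series form a Banach algebra, in which composition with an analytic function is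
   Lipschitz, so analyticity comes for free from solving in that algebra.
   Projecting the equation for [A] off its mean (Lyapunov-Schmidt), the twist condition makes
   the system a contraction for [a], [b], with parameters [eps] and the mean phase [c]; what
   remains is a scalar equation [B (eps, c) = 0] with [B (0, c) = M (t0 - c / omega A0)], of odd
   order [n] in [c].
   A real Puiseux branch [c = x (s)], [eps = +- s ^ n!], is built by Newton polygon induction on
   the odd order: a translation kills the coefficient of [c ^ (n-1)], so that the polynomial
   of the edge of slope [m / d] is not an [n]-th power; it has a real root of odd multiplicity
   [n' < n], and [n' d <= n] or [n' + d <= n], whence [d * n'!] divides [n!]. *)

(** * Real roots of odd multiplicity of edge polynomials *)

(** The series sought must have coefficients periodic in time and a radius independent of time. A
    Poincare map would yield initial values only and would call for analytic dependence of the flow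
    on its data; here time is a variable of the coefficient algebra and no flow is constructed. The
    obstacle in the contraction is that [w1 * b] in the equation for [a] carries no factor [eps], so
    it is not a small perturbation. Since [w1 <> 0], the mean of [b] can instead be chosen to cancel
    the mean of the right-hand side, and [b] is substituted into the equation for [a]. At [eps = 0]
    the reduced solution is [a = c], [b = 0]. Shifting time by [c / omega A0] turns this translate
    of the orbit into a change of phase, so that the order of the Melnikov function at [t0] is the
    order of [B (0, c)] at [c = 0]. Oddness keeps the branch real: a real polynomial of odd degree
    has a root of odd multiplicity, and the induction stays among odd orders. The two signs of [eps]
    are treated as two separate root problems. *)

Module EdgePolynomial.
Import all_boot all_order all_algebra polyrcf Rstruct.
Import Order.TTheory GRing.Theory Num.Theory.
Local Open Scope ring_scope.

Lemma dvdn_fact_fact m n : (m <= n)%N -> (m`! %| n`!)%N.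
Proof. by move=> /bin_fact <-; rewrite mulnCA dvdn_mulr. Qed.

(** If [d n' <= n], then [d * n'! = (d n') * (n' - 1)!] divides [(d n')!]; if [d + n' <= n], then
    [d] divides [d!] and [d! n'!] divides [(d + n')!]. This keeps the product of the ramification
    indices met along the induction a divisor of [n!]. *)
Lemma dvdn_fact_scaled (n n' d : nat) : (0 < d)%N -> (0 < n')%N ->
  (d * n' <= n)%N || (d + n' <= n)%N -> (d * n'`! %| n`!)%N.
Proof.
move=> d0 n0 /orP[H|H]; apply: dvdn_trans (dvdn_fact_fact _ _ H).
  case: n' n0 H => // m _ _; rewrite factS mulnA.
  have /prednK <- : (0 < d * m.+1)%N by rewrite muln_gt0 d0.
  rewrite factS dvdn_mul // dvdn_fact_fact // -ltnS prednK ?muln_gt0 ?d0 //.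
  by rewrite leq_pmull.
apply: (@dvdn_trans (d`! * n'`!)); first by rewrite dvdn_mul // dvdn_fact // d0 /=.
by rewrite -(bin_fact (leq_addr n' d)) addKn dvdn_mull.
Qed.

Section RealRoots.
Variable K : rcfType.

Lemma size_mul_XsubCX (q : {poly K}) x m : q != 0 ->
  size (q * ('X - x%:P) ^+ m) = (size q + m)%N.
Proof.
by move=> q0; rewrite size_Mmonic ?monic_exp ?monicXsubC // size_exp_XsubC addnS.
Qed.

Lemma mup_mul_XsubCX (q : {poly K}) x m : ~~ root q x -> mup x (q * ('X - x%:P) ^+ m) = m.
Proof. by move=> Hq; rewrite mupMr // mup_XsubCX eqxx. Qed.

(** An even [size] is an odd degree. If the root found has even multiplicity, dividing its whole
    power out leaves a cofactor of smaller odd degree, whose roots differ from [x] and keep their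
    multiplicity in [p]. *)
Lemma odd_mup_root (p : {poly K}) : p != 0 -> ~~ odd (size p) -> exists x, odd (mup x p).
Proof.
have [n] := ubnP (size p); elim: n p => // n IH p; rewrite ltnS => Hn p0 Hp.
have [x Hx] := odd_poly_root Hp.
have [m [q /=]] := multiplicity_XsubC p x; rewrite p0 /= => Hq Ep.
have q0 : q != 0 by apply: contraNneq p0 => q0; rewrite Ep q0 mul0r.
have [Hm|Hm] := boolP (odd m); first by exists x; rewrite Ep mup_mul_XsubCX.
have m0 : (0 < m)%N.
  by rewrite lt0n; apply: contraTneq Hx => m0; rewrite Ep m0 expr0 mulr1.
have Es : size p = (size q + m)%N by rewrite Ep size_mul_XsubCX.
have [||y Hy] := IH q _ q0; first by apply: leq_trans Hn; rewrite Es -addn1 leq_add2l.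
  by move: Hp; rewrite Es oddD (negbTE Hm) addbF.
exists y; rewrite Ep mupM ?expf_neq0 ?polyXsubC_eq0 // mup_XsubCX.
by case: eqP Hy => [<-|_]; rewrite ?(mupNroot Hq) ?addn0.
Qed.

Lemma coefPn_exp_XsubC (r : K) n : (0 < n)%N -> (('X - r%:P) ^+ n)`_n.-1 = - (r *+ n).
Proof.
move=> n0.
have E1 : \prod_(z <- nseq n r) ('X - z%:P) = ('X - r%:P) ^+ n.
  by elim: n {n0} => [|n IH]; rewrite ?big_nil //= big_cons IH exprS.
have E2 : \sum_(z <- nseq n r) z = r *+ n.
  by elim: n {n0 E1} => [|n IH]; rewrite ?big_nil //= big_cons IH mulrS.
rewrite -E1 -E2 -{2}(size_nseq n r) coefPn_prod_XsubC // size_nseq.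
by rewrite -lt0n.
Qed.

(** As [r != 0], it is a simple root of ['X^d - (r ^+ d)%:P]: the cofactor [h] takes the value
    [d r^(d-1)] there. So [r] has in [Q \Po 'X^d] the multiplicity that [r ^+ d] has in [Q]. *)
Lemma mup_comp_Xn (Q : {poly K}) (d : nat) r : (0 < d)%N -> r != 0 -> Q != 0 ->
  (d * mup r (Q \Po 'X^d) <= d * (size Q).-1)%N.
Proof.
move=> d0 r0 Q0; rewrite leq_mul2l; apply/orP; right.
have [m [q /=]] := multiplicity_XsubC Q (r ^+ d); rewrite Q0 /= => Hq EQ.
have q0 : q != 0 by apply: contraNneq Q0 => q0; rewrite EQ q0 mul0r.
have Es : size Q = (size q + m)%N by rewrite EQ size_mul_XsubCX.
pose h : {poly K} := \sum_(i < d) 'X ^+ (d.-1 - i) * (r%:P) ^+ i.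
have Eh : 'X^d - (r ^+ d)%:P = h * ('X - r%:P) by rewrite polyC_exp subrXX mulrC.
have hr : h.[r] = d%:R * r ^+ d.-1.
  rewrite horner_sum (eq_bigr (fun=> r ^+ d.-1)) ?sumr_const ?card_ord ?mulr_natl // => i _.
  rewrite hornerM !hornerE /= -exprD subnK // -ltnS prednK //.
have -> : Q \Po 'X^d = ((q \Po 'X^d) * h ^+ m) * ('X - r%:P) ^+ m.
  rewrite EQ comp_polyM rmorphXn /= comp_polyB comp_polyX comp_polyC Eh exprMn mulrA //.
rewrite mup_mul_XsubCX.
  by rewrite Es -subn1 -addnBAC ?leq_addl // lt0n size_poly_eq0.
rewrite rootM negb_or /root horner_comp !hornerE Hq /=.
by rewrite expf_neq0 // hr mulf_neq0 ?expf_neq0 // pnatr_eq0 -lt0n.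
Qed.

(** [e] lists the coefficients of an edge polynomial, [d] is the denominator of the slope, and [b]
    lists the coefficients after recentring at [r]. *)
Lemma edge_root (n d : nat) (e : nat -> K) :
  odd n -> (0 < d)%N -> e n != 0 -> e n.-1 = 0 ->
  (exists2 k, (k < n)%N & e k != 0) ->
  (forall k, (k <= n)%N -> e k != 0 -> (d %| n - k)%N) ->
  exists (r : K) (n' : nat) (b : nat -> K),
    [/\ odd n', (n' < n)%N, (d * n'`! %| n`!)%N, forall k, (k < n')%N -> b k = 0 & b n' != 0] /\
    (forall k, (n < k)%N -> b k = 0) /\
    forall y, \sum_(k < n.+1) e k * (r + y) ^+ k = \sum_(k < n.+1) b k * y ^+ k.
Proof.
move=> On d0 en0 en1 [k0 Hk0 ek0] Hd.
pose p : {poly K} := \poly_(k < n.+1) e k.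
have sp : size p = n.+1 by apply: size_poly_eq.
have p0 : p != 0 by rewrite -size_poly_eq0 sp.
have pc k : (k <= n)%N -> p`_k = e k by move=> Hk; rewrite coef_poly ltnS Hk.
have [|r Hr] := odd_mup_root p p0; first by rewrite sp /= On.
have [n' [q /=]] := multiplicity_XsubC p r; rewrite p0 /= => Hq Ep.
have q0 : q != 0 by apply: contraNneq p0 => q0; rewrite Ep q0 mul0r.
have Emu : mup r p = n' by rewrite Ep mup_mul_XsubCX.
rewrite Emu in Hr.
have Es : n.+1 = (size q + n')%N by rewrite -sp Ep size_mul_XsubCX.
have n'0 : (0 < n')%N by case: (n') Hr.
pose b k := (p \Po ('X + r%:P))`_k.
have Eb : p \Po ('X + r%:P) = (q \Po ('X + r%:P)) * 'X^n'.
  rewrite Ep comp_polyM rmorphXn /= comp_polyB comp_polyX comp_polyC addrK //.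
have sX : size ('X + r%:P) = 2 by rewrite size_XaddC.
have sb : size (p \Po ('X + r%:P)) = n.+1 by rewrite size_comp_poly2.
have bn' : b n' != 0.
  by rewrite /b Eb coefMXn ltnn subnn -horner_coef0 horner_comp !hornerE.
have lt_n' : (n' < n)%N.
  have le : (n' <= n)%N by rewrite -ltnS Es -addn1 addnC leq_add2r lt0n size_poly_eq0.
  (* If [n' = n], then [p] is a constant times [(X - r)^n]; the zero coefficient of degree [n - 1]
     forces [r = 0], and a monomial contradicts [e k0 != 0]. *)
  rewrite ltn_neqAle le andbT; apply/eqP => En.
  have /eqP : size q = 1 by apply/eqP; rewrite -(eqn_add2r n') -Es En add1n.
  rewrite size_poly_eq1 => /eqpP [[c1 c2] /= /andP[c10 c20] Ec].
  have {}Ec : q = (c2 / c1)%:P.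
    by rewrite -[q](scalerK c10) Ec -mul_polyC mulr1 scale_polyC mulrC.
  have c0 : c2 / c1 != 0 by rewrite mulf_neq0 ?invr_eq0.
  have n0 : (0 < n)%N by rewrite -En.
  have r0 : r = 0.
    have := pc n.-1 (leq_pred n); rewrite en1 Ep En Ec mul_polyC coefZ coefPn_exp_XsubC //.
    move/eqP; rewrite mulf_eq0 (negbTE c0) oppr_eq0 mulrn_eq0 eqn0Ngt n0 /=.
    by move/eqP.
  move: ek0; rewrite -pc ?(ltnW Hk0) // Ep r0 En Ec mul_polyC subr0 coefZ coefXn.
  by rewrite ltn_eqF // mulr0 eqxx.
exists r, n', b; split; last split.
- split => //; last by move=> k Hk; rewrite /b Eb coefMXn Hk.
  apply: dvdn_fact_scaled => //.
  (* For the root [0], [n'] is itself an exponent of [p], so [d] divides [n - n' > 0]. For a nonzero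
     root, [Q] collects every [d]-th coefficient, [p = X^(n mod d) * Q(X^d)], and [mup_comp_Xn]
     bounds the multiplicity by the degree of [Q], at most [n / d]. *)
  have [r0|r0] := eqVneq r 0.
    apply/orP; right.
    have bE k : b k = p`_k by rewrite /b r0 addr0 comp_polyXr.
    have := Hd n' (ltnW lt_n'); rewrite -pc ?(ltnW lt_n') // -bE => /(_ bn') Hdv.
    have := dvdn_leq _ Hdv; rewrite subn_gt0 => /(_ lt_n').
    by rewrite -(leq_add2r n') subnK // ltnW.
  apply/orP; left.
  pose Q : {poly K} := \poly_(j < (n %/ d).+1) e (n %% d + d * j)%N.
  have Hk k : p`_k != 0 -> (n %% d <= k)%N && (d %| k - n %% d)%N.
    have [kn|kn] := leqP k n; last by rewrite nth_default ?sp // eqxx.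
    rewrite pc // => /(Hd k kn); rewrite -eqn_mod_dvd // => /eqP ->.
    by rewrite leq_mod /= {1}(divn_eq k d) addnK dvdn_mull.
  have EQ : p = 'X^(n %% d) * (Q \Po 'X^d).
    apply/polyP => k; rewrite coefXnM coef_comp_poly_Xn //.
    case: ltnP => [ka|ka].
      by apply: contraTeq ka => /Hk /andP[]; rewrite leqNgt.
    case: ifP => [/dvdnP[j Ej]|Hdv]; last first.
      by apply: contraFeq Hdv => /Hk /andP[].
    have -> : k = (n %% d + d * j)%N by rewrite mulnC -Ej subnKC.
    rewrite addKn mulKn // !coef_poly !ltnS.
    by rewrite {2}(divn_eq n d) [(n %% d + _)%N]addnC leq_add2r mulnC leq_pmul2r.
  have Q0 : Q != 0 by apply: contraNneq p0 => Q0; rewrite EQ Q0 comp_poly0 mulr0.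
  have := mup_comp_Xn Q d r d0 r0 Q0.
  rewrite -(mupMr (q1 := 'X^(n %% d))); last by rewrite /root hornerXn expf_eq0 (negbTE r0) andbF.
  rewrite -EQ Emu => /leq_trans; apply.
  apply: leq_trans (leq_divM n d); rewrite mulnC leq_mul2r; apply/orP; right.
  by rewrite -subn1 leq_subLR add1n size_poly.
- by move=> k Hk; rewrite /b nth_default // sb.
- move=> y.
  have -> : \sum_(k < n.+1) e k * (r + y) ^+ k = p.[r + y] by rewrite horner_poly.
  have -> : p.[r + y] = (p \Po ('X + r%:P)).[y] by rewrite horner_comp !hornerE addrC.
  by rewrite -(@horner_coef_wide _ n.+1) ?sb.
Qed.
End RealRoots.

Lemma Nat_Odd_odd m : Nat.Odd m <-> odd m.
Proof.
split=> [[k ->]|Hm]; first by rewrite multE plusE addn1 /= mul2n odd_double.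
by exists m./2; rewrite multE plusE addn1 mul2n -{1}(odd_double_half m) Hm.
Qed.

Lemma dvdn_divide d m : Nat.divide d m <-> (d %| m)%N.
Proof.
split=> [[k ->]|/dvdnP[k ->]]; first by rewrite multE dvdn_mull.
by exists k; rewrite multE.
Qed.

(** Restated with the operations of the standard library, so that the MathComp structures stay
    inside this module. *)
Lemma real_edge_root (n d : nat) (e : nat -> R) :
  Nat.Odd n -> Peano.lt 0 d -> e n <> IZR 0 -> e (Nat.pred n) = IZR 0 ->
  (exists k, Peano.lt k n /\ e k <> IZR 0) ->
  (forall k, Peano.le k n -> e k <> IZR 0 -> Nat.divide d (Nat.sub n k)) ->
  exists (r : R) (n' : nat) (b : nat -> R),
    Nat.Odd n' /\ Peano.lt n' n /\
    Nat.divide (Nat.mul d (Factorial.fact n')) (Factorial.fact n) /\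
    (forall k, Peano.lt k n' -> b k = IZR 0) /\ b n' <> IZR 0 /\
    (forall k, Peano.lt n k -> b k = IZR 0) /\
    forall y, sum_f_R0 (fun k => Rmult (e k) (pow (Rplus r y) k)) n
            = sum_f_R0 (fun k => Rmult (b k) (pow y k)) n.
Proof.
move=> /Nat_Odd_odd On /ssrnat.ltP d0 /eqP en0 en1 [k0 [/ssrnat.ltP Hk0 /eqP ek0]] Hd.
have Hd' k : (k <= n)%N -> e k != 0 -> (d %| n - k)%N.
  by move=> /ssrnat.leP Hk /eqP ek; apply/dvdn_divide; apply: Hd.
have [|r [n' [b [[H1 H2 H3 H4 H5] [H6 H7]]]]] := edge_root _ n d e On d0 en0 en1 _ Hd'.
  by exists k0.
exists r, n', b; split; first by apply/Nat_Odd_odd.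
split; first by apply/ssrnat.ltP.
split; first by rewrite multE !factE; apply/dvdn_divide.
split; first by move=> k /ssrnat.ltP; apply: H4.
split; first by apply/eqP.
split; first by move=> k /ssrnat.ltP; apply: H6.
move=> y; rewrite !sum_f_R0E !big_mkord.
under eq_bigr => i _ do rewrite RpowE.
under [RHS]eq_bigr => i _ do rewrite RpowE.
exact: H7.
Qed.
End EdgePolynomial.

From Stdlib Require Import Lra Lia Psatz ClassicalEpsilon FunctionalExtensionality.
From Coquelicot Require Import Coquelicot.
From mathcomp Require Import ssreflect ssrfun ssrbool.
Open Scope R_scope.

(** * Absolutely convergent series *)

(** For nonnegative terms: convergence with sum at most [S], without naming the sum. Norms below are
    treated in the same way, as upper bounds. *)
Definition bounded_sums (a : nat -> R) (S : R) : Prop := forall n : nat, sum_n a n <= S.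

Lemma sum_nS (a : nat -> R) (n : nat) : sum_n a (S n) = sum_n a n + a (S n).
Proof. by rewrite sum_Sn. Qed.

Lemma sum_n_nonneg (a : nat -> R) (n : nat) : (forall k, 0 <= a k) -> 0 <= sum_n a n.
Proof.
move=> H; elim: n => [|n IH]; first by rewrite sum_O.
by rewrite sum_nS; move: (H (S n)); lra.
Qed.

Lemma sum_n_mono (a b : nat -> R) (n : nat) :
  (forall k, a k <= b k) -> sum_n a n <= sum_n b n.
Proof.
move=> H; elim: n => [|n IH]; first by rewrite !sum_O.
by rewrite !sum_nS; move: (H (S n)); lra.
Qed.

Lemma sum_n_add (a b : nat -> R) (n : nat) :
  sum_n (fun k => a k + b k) n = sum_n a n + sum_n b n.
Proof.
elim: n => [|n IH]; first by rewrite !sum_O.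
by rewrite !sum_nS IH; lra.
Qed.

Lemma sum_n_scale (c : R) (a : nat -> R) (n : nat) :
  sum_n (fun k => c * a k) n = c * sum_n a n.
Proof.
elim: n => [|n IH]; first by rewrite !sum_O.
by rewrite !sum_nS IH; lra.
Qed.

Lemma sum_n_le_add (a : nat -> R) (n m : nat) :
  (forall k, 0 <= a k) -> (n <= m)%nat -> sum_n a n <= sum_n a m.
Proof.
move=> H; elim => [|k _ IH]; first by lra.
by rewrite sum_nS; move: (H (S k)); lra.
Qed.

Lemma is_series_lim (a : nat -> R) (l : R) : is_series a l <-> is_lim_seq (sum_n a) l.
Proof. by []. Qed.

Lemma bounded_sums_series (a : nat -> R) (S : R) :
  (forall k, 0 <= a k) -> bounded_sums a S -> ex_series a /\ Series a <= S.
Proof.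
move=> H0 HS.
have [l Hl] : ex_finite_lim_seq (sum_n a).
  apply: (ex_finite_lim_seq_incr _ S) => n; last exact: HS.
  by rewrite sum_nS; move: (H0 (Datatypes.S n)); lra.
split; first by exists l.
rewrite (is_series_unique a l Hl).
exact: (is_lim_seq_le (sum_n a) (fun=> S) l S HS Hl (is_lim_seq_const S)).
Qed.

Lemma sum_n_le_Series (a : nat -> R) (n : nat) :
  (forall k, 0 <= a k) -> ex_series a -> sum_n a n <= Series a.
Proof.
move=> H0 /Series_correct H.
apply: (is_lim_seq_incr_compare (sum_n a) (Series a) H) => k.
by rewrite sum_nS; move: (H0 (Datatypes.S k)); lra.
Qed.

Lemma Series_nonneg (a : nat -> R) : (forall k, 0 <= a k) -> ex_series a -> 0 <= Series a.
Proof. by move=> H0 He; apply: Rle_trans (sum_n_le_Series a 0 H0 He); rewrite sum_O. Qed.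

Lemma ex_series_dominated (a m : nat -> R) (S : R) :
  (forall k, Rabs (a k) <= m k) -> bounded_sums m S ->
  ex_series a /\ Rabs (Series a) <= S.
Proof.
move=> Ha HS.
have m0 k : 0 <= m k by apply: Rle_trans (Rabs_pos _) (Ha k).
have [em Sm] := bounded_sums_series m S m0 HS.
have ea : ex_series (fun k => Rabs (a k)).
  by apply: (ex_series_le _ m) => // k; rewrite /norm /= /abs /= Rabs_Rabsolu.
split; first exact: ex_series_Rabs.
apply: Rle_trans (Series_Rabs _ ea) _.
apply: Rle_trans Sm; apply: Series_le => // k; split => //; exact: Rabs_pos.
Qed.

Lemma Series_sum_n (a : nat -> nat -> R) (n : nat) :
  (forall k, ex_series (a k)) ->
  is_series (fun j => sum_n (fun k => a k j) n) (sum_n (fun k => Series (a k)) n).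
Proof.
move=> H; elim: n => [|n IH].
  rewrite sum_O; apply: is_series_ext (Series_correct _ (H O)) => j.
  by rewrite sum_O.
rewrite sum_nS.
apply: is_series_ext (is_series_plus _ _ _ _ IH (Series_correct _ (H (S n)))) => j.
by rewrite sum_nS.
Qed.

Lemma nonneg_swap_aux (a : nat -> nat -> R) (S : R) :
  (forall j k, 0 <= a j k) -> (forall j, ex_series (a j)) ->
  bounded_sums (fun j => Series (a j)) S ->
  (forall k, ex_series (fun j => a j k)) /\
  bounded_sums (fun k => Series (fun j => a j k)) S.
Proof.
move=> a0 e1 HS.
have s0 j : 0 <= Series (a j) by apply: Series_nonneg.
have [es Ss] := bounded_sums_series _ S s0 HS.
have e2 k : ex_series (fun j => a j k).
  apply: (ex_series_le _ (fun j => Series (a j))) => // j.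
  rewrite /norm /= /abs /= Rabs_pos_eq //.
  apply: Rle_trans (sum_n_le_Series (a j) k (a0 j) (e1 j)).
  case: k => [|k]; first by rewrite sum_O; lra.
  by rewrite sum_nS; move: (sum_n_nonneg (a j) k (a0 j)); lra.
split => // n.
rewrite -(is_series_unique _ _ (Series_sum_n (fun k j => a j k) n e2)).
apply: Rle_trans Ss; apply: Series_le => // j; split.
  by apply: sum_n_nonneg => k.
exact: sum_n_le_Series.
Qed.

(** Tonelli: [nonneg_swap_aux] bounds one iterated sum by the other, and its use on the family and
    on the transposed family gives equality. *)
Lemma nonneg_swap (a : nat -> nat -> R) (S : R) :
  (forall j k, 0 <= a j k) -> (forall j, ex_series (a j)) ->
  bounded_sums (fun j => Series (a j)) S ->
  [/\ forall k, ex_series (fun j => a j k),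
      bounded_sums (fun k => Series (fun j => a j k)) S,
      is_series (fun k => Series (fun j => a j k)) (Series (fun j => Series (a j)))
    & ex_series (fun j => Series (a j))].
Proof.
move=> a0 e1 HS.
have [e2 HS2] := nonneg_swap_aux a S a0 e1 HS.
have p1 j : 0 <= Series (a j) by apply: Series_nonneg.
have p2 k : 0 <= Series (fun j => a j k) by apply: Series_nonneg.
have [x1 _] := bounded_sums_series _ S p1 HS.
have [x2 _] := bounded_sums_series _ S p2 HS2.
split => //.
have -> : Series (fun j => Series (a j)) = Series (fun k => Series (fun j => a j k)).
  apply: Rle_antisym.
    have [_ H] := nonneg_swap_aux (fun k j => a j k) _ (fun k j => a0 j k) e2
      (fun n => sum_n_le_Series _ n p2 x2).
    by have [] := bounded_sums_series _ _ p1 H.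
  have [_ H] := nonneg_swap_aux a _ a0 e1 (fun n => sum_n_le_Series _ n p1 x1).
  by have [] := bounded_sums_series _ _ p2 H.
exact: Series_correct.
Qed.

(* The signed case reduces to the nonnegative one through [a = |a| - (|a| - a)]. *)
Lemma Series_swap (a : nat -> nat -> R) (S : R) :
  (forall j, ex_series (fun k => Rabs (a j k))) ->
  bounded_sums (fun j => Series (fun k => Rabs (a j k))) S ->
  [/\ forall k, ex_series (fun j => Rabs (a j k)),
      bounded_sums (fun k => Series (fun j => Rabs (a j k))) S
    & is_series (fun k => Series (fun j => a j k)) (Series (fun j => Series (a j)))].
Proof.
move=> e1 HS.
have [A1 A2 A3 A4] := nonneg_swap (fun j k => Rabs (a j k)) S (fun j k => Rabs_pos _) e1 HS.
split => //.
have ea j : ex_series (a j) by apply: ex_series_Rabs.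
have ea' k : ex_series (fun j => a j k) by apply: ex_series_Rabs.
have b0 j k : 0 <= Rabs (a j k) - a j k by move: (Rle_abs (a j k)); lra.
have eb j : ex_series (fun k => Rabs (a j k) - a j k).
  exact: (@ex_series_minus _ R_NormedModule _ _ (e1 j) (ea j)).
have sb j : Series (fun k => Rabs (a j k) - a j k)
          = Series (fun k => Rabs (a j k)) - Series (a j) by apply: Series_minus.
have HSb : bounded_sums (fun j => Series (fun k => Rabs (a j k) - a j k)) (2 * S).
  move=> n; apply: Rle_trans (_ : sum_n (fun j => 2 * Series (fun k => Rabs (a j k))) n <= _).
    apply: sum_n_mono => j; rewrite sb.
    have := Series_Rabs _ (e1 j); have := Rle_abs (- Series (a j)).
    by rewrite Rabs_Ropp; lra.
  by rewrite sum_n_scale; move: (HS n); lra.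
have [B1 B2 B3 B4] := nonneg_swap _ _ b0 eb HSb.
have esa : ex_series (fun j => Series (a j)).
  apply: ex_series_ext (@ex_series_minus _ R_NormedModule _ _ A4 B4) => j /=.
  by rewrite sb /minus /plus /opp /=; lra.
have -> : Series (fun j => Series (a j))
   = minus (Series (fun j => Series (fun k => Rabs (a j k))))
           (Series (fun j => Series (fun k => Rabs (a j k) - a j k))).
  rewrite /minus /plus /opp /= -/(Rminus _ _) -(Series_minus _ _ A4 B4).
  by apply: Series_ext => j; rewrite sb; lra.
apply: is_series_ext (@is_series_minus _ R_NormedModule _ _ _ _ A3 B3) => k /=.
rewrite Series_minus //.
by rewrite /minus /plus /opp /=; lra.
Qed.

Lemma sum_n_congr (a b : nat -> R) (n : nat) :
  (forall k, a k = b k) -> sum_n a n = sum_n b n.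
Proof. by move=> H; apply: sum_n_ext. Qed.

Lemma choice {A B : Type} (P : A -> B -> Prop) :
  (forall x, exists y, P x y) -> exists f, forall x, P x (f x).
Proof.
move=> H; exists (fun x => proj1_sig (constructive_indefinite_description _ (H x))) => x.
exact: proj2_sig (constructive_indefinite_description _ (H x)).
Qed.

(** * Banach algebras of functions and of power series over them *)

(* [nrm A f M] reads: f belongs to the algebra and its norm is at most M.
   Completeness is [nrm_series]; values outside [dom] are irrelevant. *)
Record falg (X : Type) := Falg {
  dom : X -> Prop;
  nrm : (X -> R) -> R -> Prop;
  nrm_ext : forall f g M, (forall x, dom x -> f x = g x) -> nrm f M -> nrm g M;
  nrm_bound : forall f M x, nrm f M -> dom x -> Rabs (f x) <= M;
  nrm_ge0 : forall f M, nrm f M -> 0 <= M;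
  nrm_le : forall f M M', nrm f M -> M <= M' -> nrm f M';
  nrm_const : forall c, nrm (fun=> c) (Rabs c);
  nrm_add : forall f g M M', nrm f M -> nrm g M' -> nrm (fun x => f x + g x) (M + M');
  nrm_mul : forall f g M M', nrm f M -> nrm g M' -> nrm (fun x => f x * g x) (M * M');
  nrm_series : forall (f : nat -> X -> R) (m : nat -> R) S,
    (forall k, nrm (f k) (m k)) -> bounded_sums m S ->
    nrm (fun x => Series (fun k => f k x)) S }.

Arguments dom {X}. Arguments nrm {X}.
Arguments nrm_ext {X} A f [g M] : rename. Arguments nrm_bound {X} A [f M x] : rename.
Arguments nrm_ge0 {X} A [f M] : rename. Arguments nrm_le {X} A [f] M [M'] : rename.
Arguments nrm_const {X} A c : rename. Arguments nrm_add {X} A [f g M M'] : rename.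
Arguments nrm_mul {X} A [f g M M'] : rename. Arguments nrm_series {X} A [f m S] : rename.

Section FunctionAlgebra.
Context {X : Type} (A : falg X).

Lemma nrm_scal c f M : nrm A f M -> nrm A (fun x => c * f x) (Rabs c * M).
Proof. exact: nrm_mul (nrm_const A c). Qed.

Lemma nrm_opp f M : nrm A f M -> nrm A (fun x => - f x) M.
Proof.
move=> /(nrm_scal (-1)); rewrite Rabs_Ropp Rabs_R1 Rmult_1_l.
by apply: nrm_ext => x _; ring.
Qed.

Lemma nrm_sub f g M M' : nrm A f M -> nrm A g M' -> nrm A (fun x => f x - g x) (M + M').
Proof. by move=> Hf /nrm_opp; apply: nrm_add. Qed.

Lemma nrm_zero : nrm A (fun=> 0) 0.
Proof. by rewrite -{2}Rabs_R0; apply: nrm_const. Qed.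

Lemma nrm_pow f M k : nrm A f M -> nrm A (fun x => f x ^ k) (M ^ k).
Proof.
move=> H; elim: k => [|k IH] /=; last exact: nrm_mul.
by rewrite -{2}Rabs_R1; apply: nrm_const.
Qed.

Lemma nrm_sum_n (f : nat -> X -> R) (m : nat -> R) n :
  (forall k, nrm A (f k) (m k)) -> nrm A (fun x => sum_n (fun k => f k x) n) (sum_n m n).
Proof.
move=> H; elim: n => [|n IH].
  by rewrite sum_O; apply: nrm_ext (H O) => x _; rewrite sum_O.
rewrite sum_nS; apply: nrm_ext (nrm_add A IH (H (S n))) => x _.
by rewrite sum_nS.
Qed.

Lemma nrm_sum_f_R0 (f : nat -> X -> R) (m : nat -> R) n :
  (forall k, nrm A (f k) (m k)) ->
  nrm A (fun x => sum_f_R0 (fun k => f k x) n) (sum_f_R0 m n).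
Proof.
move=> H; rewrite -sum_n_Reals; apply: nrm_ext (nrm_sum_n f m n H) => x _.
by rewrite sum_n_Reals.
Qed.

Lemma nrm_is_series (f : nat -> X -> R) (m : nat -> R) S g :
  (forall k, nrm A (f k) (m k)) -> bounded_sums m S ->
  (forall x, dom A x -> is_series (fun k => f k x) (g x)) -> nrm A g S.
Proof.
move=> Hf HS Hg; apply: nrm_ext (nrm_series A Hf HS) => x Hx.
exact: is_series_unique (Hg x Hx).
Qed.

Lemma nrm_ex_series (f : nat -> X -> R) (m : nat -> R) S x :
  (forall k, nrm A (f k) (m k)) -> bounded_sums m S -> dom A x ->
  ex_series (fun k => Rabs (f k x)).
Proof.
move=> Hf HS Hx.
by apply: (proj1 (ex_series_dominated _ m S _ HS)) => k; rewrite Rabs_Rabsolu; apply: nrm_bound.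
Qed.

End FunctionAlgebra.

Lemma is_series_single (a : nat -> R) k0 : (forall k, k <> k0 -> a k = 0) -> is_series a (a k0).
Proof.
move=> H; change (is_lim_seq (sum_n a) (a k0)).
apply: (is_lim_seq_ext_loc (fun=> a k0) _ (a k0)); last exact: is_lim_seq_const.
exists k0 => n Hn; elim: n Hn => [|n IH] Hn.
  by rewrite sum_O; congr a; lia.
rewrite sum_nS; case: (Nat.eq_dec k0 (S n)) => E.
  rewrite -E; have -> : sum_n a n = 0; last by ring.
  have : forall k, (k <= n)%nat -> a k = 0 by move=> k Hk; apply: H; lia.
  elim: n {IH Hn E} => [|n IH] Hk; first by rewrite sum_O Hk //; lia.
  by rewrite sum_nS IH ?Hk; [lra | lia | move=> k ?; apply: Hk; lia].
by rewrite -IH ?(H (S n)); [lra | lia | lia].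
Qed.

Lemma is_series_delta (v : R) (u : nat -> R) k0 :
  is_series (fun k => (if Nat.eq_dec k k0 then v else 0) * u k) (v * u k0).
Proof.
have -> : v * u k0 = (if Nat.eq_dec k0 k0 then v else 0) * u k0 by case: Nat.eq_dec.
apply: (is_series_single (fun k => (if Nat.eq_dec k k0 then v else 0) * u k)) => k Hk.
by case: Nat.eq_dec => //=; lra.
Qed.

Section PowerSeriesAlgebra.
Context {X : Type} (A : falg X) (r : posreal).

Definition ps_dom (z : X * R) : Prop := dom A z.1 /\ Rabs z.2 <= r.

(** Weighted [l^1] norm of the coefficients: [m k] bounds the norm of [c k], and [M] bounds the sum
    of [m k * r ^ k]. Convergence is absolute up to the boundary, which is why [ps_dom] is a closed
    disc. *)
Definition ps_rep (F : X * R -> R) (M : R) (c : nat -> X -> R) (m : nat -> R) : Prop :=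
  [/\ forall k, nrm A (c k) (m k), bounded_sums (fun k => m k * r ^ k) M
    & forall z, ps_dom z -> is_series (fun k => c k z.1 * z.2 ^ k) (F z)].

Definition ps_nrm (F : X * R -> R) (M : R) : Prop := exists c m, ps_rep F M c m.

Let r0 : 0 < r := cond_pos r.

Lemma ps_term c m k z : nrm A c m -> ps_dom z -> Rabs (c z.1 * z.2 ^ k) <= m * r ^ k.
Proof.
move=> Hc [Hx Hy]; rewrite Rabs_mult -RPow_abs.
apply: Rmult_le_compat; try exact: Rabs_pos.
- by apply: pow_le; apply: Rabs_pos.
- exact: nrm_bound Hc Hx.
- by apply: pow_incr; split => //; apply: Rabs_pos.
Qed.

Lemma ps_ext F G M : (forall z, ps_dom z -> F z = G z) -> ps_nrm F M -> ps_nrm G M.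
Proof.
move=> H [c [m [H1 H2 H3]]]; exists c, m; split => // z Hz.
by rewrite -H //; apply: H3.
Qed.

Lemma ps_bound F M z : ps_nrm F M -> ps_dom z -> Rabs (F z) <= M.
Proof.
move=> [c [m [H1 H2 H3]]] Hz; rewrite -(is_series_unique _ _ (H3 z Hz)).
by apply: (proj2 (ex_series_dominated _ _ _ _ H2)) => k; apply: ps_term.
Qed.

Lemma ps_m_ge0 c m k : (forall k, nrm A (c k) (m k)) -> 0 <= m k * r ^ k.
Proof.
move=> H; apply: Rmult_le_pos; first exact: nrm_ge0 (H k).
by apply: pow_le; lra.
Qed.

Lemma ps_ge0 F M : ps_nrm F M -> 0 <= M.
Proof.
move=> [c [m [H1 H2 H3]]]; apply: Rle_trans (H2 O); rewrite sum_O.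
exact: ps_m_ge0 H1.
Qed.

Lemma ps_le F M M' : ps_nrm F M -> M <= M' -> ps_nrm F M'.
Proof.
move=> [c [m [H1 H2 H3]]] HM; exists c, m; split => // n.
exact: Rle_trans (H2 n) HM.
Qed.

Lemma ps_mono f m k0 : nrm A f m -> ps_nrm (fun z => f z.1 * z.2 ^ k0) (m * r ^ k0).
Proof.
move=> Hf.
exists (fun k x => if Nat.eq_dec k k0 then f x else 0), (fun k => if Nat.eq_dec k k0 then m else 0).
split.
- by move=> k; case: Nat.eq_dec => ? //; apply: nrm_zero.
- have H := is_series_delta m (fun k => r ^ k) k0 => n.
  rewrite -(is_series_unique _ _ H).
  apply: sum_n_le_Series; last by eexists; exact: H.
  move=> k; apply: Rmult_le_pos; last by apply: pow_le; lra.
  by case: Nat.eq_dec => //= _; [apply: nrm_ge0 Hf | lra].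
- move=> z Hz; apply: is_series_ext (is_series_delta (f z.1) (fun k => z.2 ^ k) k0) => k.
  by case: Nat.eq_dec.
Qed.

Lemma ps_const c : ps_nrm (fun=> c) (Rabs c).
Proof.
have H := ps_mono _ _ O (nrm_const A c).
rewrite -[Rabs c]Rmult_1_r; apply: ps_ext H => z _ /=; ring.
Qed.

Lemma ps_add F G M M' : ps_nrm F M -> ps_nrm G M' -> ps_nrm (fun z => F z + G z) (M + M').
Proof.
move=> [c [m [H1 H2 H3]]] [c' [m' [H1' H2' H3']]].
exists (fun k x => c k x + c' k x), (fun k => m k + m' k); split.
- by move=> k; apply: nrm_add.
- move=> n; rewrite (sum_n_congr _ (fun k => m k * r ^ k + m' k * r ^ k)); last by move=> k; ring.
  by rewrite sum_n_add; move: (H2 n) (H2' n); lra.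
- move=> z Hz; apply: is_series_ext (is_series_plus _ _ _ _ (H3 z Hz) (H3' z Hz)) => k.
  by rewrite /plus /=; ring.
Qed.

Lemma ps_abs_series c m F M z : ps_rep F M c m -> ps_dom z ->
  ex_series (fun k => Rabs (c k z.1 * z.2 ^ k)).
Proof.
move=> [H1 H2 H3] Hz.
apply: (proj1 (ex_series_dominated _ (fun k => m k * r ^ k) M _ H2)) => k.
by rewrite Rabs_Rabsolu; apply: ps_term.
Qed.

Lemma cauchy_pow (a b : nat -> R) (y : R) n :
  sum_f_R0 (fun k => (a k * y ^ k) * (b (n - k)%nat * y ^ (n - k))) n
  = sum_f_R0 (fun k => a k * b (n - k)%nat) n * y ^ n.
Proof.
rewrite [RHS]Rmult_comm scal_sum; apply: sum_eq => k Hk.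
have -> : y ^ n = y ^ k * y ^ (n - k) by rewrite -pow_add; congr (y ^ _); lia.
by ring.
Qed.

Lemma ps_mul F G M M' : ps_nrm F M -> ps_nrm G M' -> ps_nrm (fun z => F z * G z) (M * M').
Proof.
move=> [c [m Hc]] [c' [m' Hc']].
have [H1 H2 H3] := Hc; have [H1' H2' H3'] := Hc'.
exists (fun n x => sum_f_R0 (fun k => c k x * c' (n - k)%nat x) n),
  (fun n => sum_f_R0 (fun k => m k * m' (n - k)%nat) n); split.
- by move=> n; apply: nrm_sum_f_R0 => k; apply: nrm_mul.
- have p k := ps_m_ge0 c m k H1; have p' k := ps_m_ge0 c' m' k H1'.
  have [e s] := bounded_sums_series _ _ p H2.
  have [e' s'] := bounded_sums_series _ _ p' H2'.
  have H := is_series_mult_pos _ _ _ _ (Series_correct _ e) (Series_correct _ e') p p'.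
  have {}H := is_series_ext _ _ _ (cauchy_pow m m' r) H.
  move=> n; apply: Rle_trans (_ : Series (fun k => m k * r ^ k) * Series (fun k => m' k * r ^ k) <= _).
    rewrite -(is_series_unique _ _ H); apply: sum_n_le_Series; last by eexists; exact: H.
    move=> k; rewrite -cauchy_pow; apply: cond_pos_sum => j; exact: Rmult_le_pos.
  by apply: Rmult_le_compat => //; apply: Series_nonneg.
- move=> z Hz.
  have := is_series_mult _ _ _ _ (H3 z Hz) (H3' z Hz)
    (ps_abs_series _ _ _ _ _ Hc Hz) (ps_abs_series _ _ _ _ _ Hc' Hz).
  by apply: is_series_ext => n; exact: (cauchy_pow (fun k => c k z.1) (fun k => c' k z.1)).
Qed.

(** Completeness: the coefficients of the sum are the sums of the coefficients. Tonelli on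
    [mj j k * r ^ k] gives the norm bound, and [Series_swap] identifies the values. *)
Lemma ps_series (F : nat -> X * R -> R) (M : nat -> R) S :
  (forall j, ps_nrm (F j) (M j)) -> bounded_sums M S ->
  ps_nrm (fun z => Series (fun j => F j z)) S.
Proof.
move=> HF HS.
have [cj Hcj] := choice _ HF; have [mj Hj] := choice _ Hcj.
have p j k : 0 <= mj j k * r ^ k by have [H1 _ _] := Hj j; exact: (ps_m_ge0 (cj j) (mj j) k H1).
have e1 j : ex_series (fun k => mj j k * r ^ k) /\ Series (fun k => mj j k * r ^ k) <= M j.
  by have [_ H2 _] := Hj j; apply: bounded_sums_series (p j) H2.
have HB : bounded_sums (fun j => Series (fun k => mj j k * r ^ k)) S.
  by move=> n; apply: Rle_trans (HS n); apply: sum_n_mono => j; apply: (proj2 (e1 j)).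
have [e2 HB2 _ _] := nonneg_swap _ S p (fun j => proj1 (e1 j)) HB.
have rk k : r ^ k <> 0 by apply: pow_nonzero; lra.
have m0 j k : 0 <= mj j k by have [H1 _ _] := Hj j; exact: nrm_ge0 (H1 k).
have e3 k : ex_series (fun j => mj j k).
  have E j : / r ^ k * (mj j k * r ^ k) = mj j k by field.
  exact: ex_series_ext _ _ E (ex_series_scal_l (/ r ^ k) _ (e2 k)).
exists (fun k x => Series (fun j => cj j k x)), (fun k => Series (fun j => mj j k)); split.
- move=> k; apply: (nrm_series A (m := fun j => mj j k)).
    by move=> j; have [H1 _ _] := Hj j.
  by move=> n; apply: sum_n_le_Series.
- move=> n; rewrite (sum_n_congr _ (fun k => Series (fun j => mj j k * r ^ k))); first exact: HB2.
  by move=> k; rewrite Series_scal_r.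
- move=> z Hz.
  have T j k : Rabs (cj j k z.1 * z.2 ^ k) <= mj j k * r ^ k.
    by have [H1 _ _] := Hj j; apply: ps_term.
  have ea j : ex_series (fun k => Rabs (cj j k z.1 * z.2 ^ k)).
    exact: ps_abs_series (Hj j) Hz.
  have [|_ _ H] := Series_swap (fun j k => cj j k z.1 * z.2 ^ k) S ea.
    move=> n; apply: Rle_trans (HB n); apply: sum_n_mono => j.
    apply: Series_le; last by case: (e1 j).
    by move=> k; split; [exact: Rabs_pos | exact: T].
  have -> : Series (fun j => F j z) = Series (fun j => Series (fun k => cj j k z.1 * z.2 ^ k)).
    by apply: Series_ext => j; have [_ _ H3] := Hj j; rewrite (is_series_unique _ _ (H3 z Hz)).
  by apply: is_series_ext H => k; rewrite Series_scal_r.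
Qed.

(** Each use adjoins one parameter and yields an algebra of the same kind, so iteration gives
    several parameters: a point of [ps (ps (CT T) rho) rc] is [((t, eps), c)]. *)
Definition ps : falg (X * R) :=
  Falg (X * R) ps_dom ps_nrm ps_ext ps_bound ps_ge0 ps_le ps_const ps_add ps_mul ps_series.

Lemma ps_var : nrm ps (fun z => z.2) r.
Proof.
have := ps_mono (fun=> 1) 1 1; rewrite Rmult_1_l pow_1 => H.
apply: (nrm_ext ps (fun z => 1 * z.2 ^ 1)) => [z _|]; first by ring.
by apply: H; rewrite -{2}Rabs_R1; apply: nrm_const.
Qed.

Lemma ps_base f m : nrm A f m -> nrm ps (fun z => f z.1) m.
Proof.
move=> /(ps_mono _ _ O); rewrite /= Rmult_1_r.
by apply: (nrm_ext ps) => z _; ring.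
Qed.

Lemma ps_slice F M y : nrm ps F M -> Rabs y <= r -> nrm A (fun x => F (x, y)) M.
Proof.
move=> [c [m [H1 H2 H3]]] Hy.
apply: (nrm_is_series A (fun k x => c k x * y ^ k) (fun k => m k * r ^ k)) => //.
  move=> k; apply: (nrm_le A (m k * Rabs (y ^ k))).
    by apply: nrm_mul => //; apply: nrm_const.
  apply: Rmult_le_compat_l; first exact: nrm_ge0 (H1 k).
  by rewrite -RPow_abs; apply: pow_incr; split => //; apply: Rabs_pos.
by move=> x Hx; apply: (H3 (x, y)).
Qed.

End PowerSeriesAlgebra.

(** * Substitution and contraction in function algebras *)

Lemma Series_tail (a m : nat -> R) (S : R) n :
  (forall k, Rabs (a k) <= m k) -> bounded_sums m S ->
  Rabs (Series a - sum_n a n) <= Series m - sum_n m n.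
Proof.
move=> Ha HS.
have m0 k : 0 <= m k by apply: Rle_trans (Rabs_pos _) (Ha k).
have [em _] := bounded_sums_series m S m0 HS.
have [ea _] := ex_series_dominated a m S Ha HS.
rewrite (Series_incr_n a (Datatypes.S n)) //; last by lia.
rewrite (Series_incr_n m (Datatypes.S n)) //; last by lia.
rewrite -!sum_n_Reals /=.
set u := Series _; set v := Series _.
have -> : sum_n a n + u - sum_n a n = u by ring.
have -> : sum_n m n + v - sum_n m n = v by ring.
have em' : ex_series (fun k => m (Datatypes.S n + k)%nat).
  by apply: (proj1 (ex_series_incr_n m (Datatypes.S n))).
apply: (proj2 (ex_series_dominated _ _ _ (fun k => Ha _) _)) => j.
by apply: sum_n_le_Series.
Qed.

Lemma tail_lim (m : nat -> R) (S : R) : (forall k, 0 <= m k) -> bounded_sums m S ->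
  is_lim_seq (fun n => Series m - sum_n m n) 0.
Proof.
move=> m0 HS; have [em _] := bounded_sums_series m S m0 HS.
have := is_lim_seq_minus' _ _ _ _ (is_lim_seq_const (Series m)) (proj1 (is_series_lim _ _) (Series_correct m em)).
by rewrite Rminus_diag.
Qed.

(** * The ground algebras: scalars as functions on a point, and continuous periodic functions of
    time *)

Lemma U0_series (f : nat -> unit -> R) (m : nat -> R) S :
  (forall k, Rabs (f k tt) <= m k) -> bounded_sums m S ->
  Rabs (Series (fun k => f k tt)) <= S.
Proof. by move=> H HS; apply: (proj2 (ex_series_dominated _ m S H HS)). Qed.

Definition U0 : falg unit.
Proof.
apply: (Falg unit (fun=> True) (fun f M => Rabs (f tt) <= M)).
- by move=> f g M ->.
- by move=> f M [].
- by move=> f M; apply: Rle_trans (Rabs_pos _).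
- by move=> f M M'; apply: Rle_trans.
- by move=> c; lra.
- by move=> f g M M' H H'; apply: Rle_trans (Rabs_triang _ _) _; lra.
- by move=> f g M M' H H'; rewrite Rabs_mult; apply: Rmult_le_compat => //; apply: Rabs_pos.
- exact: U0_series.
Defined.

Definition CT_nrm (T : R) (f : R -> R) (M : R) : Prop :=
  [/\ forall t, continuous f t, forall t, f (t + T) = f t & forall t, Rabs (f t) <= M].

Lemma CT_series T (f : nat -> R -> R) (m : nat -> R) S :
  (forall k, CT_nrm T (f k) (m k)) -> bounded_sums m S ->
  CT_nrm T (fun t => Series (fun k => f k t)) S.
Proof.
move=> Hf HS.
have B t : forall k, Rabs (f k t) <= m k by move=> k; have [_ _] := Hf k.
split.
- move=> t; apply/continuity_pt_filterlim.
  apply: (CVU_continuity (fun n t => sum_n (fun k => f k t) n) _ t (mkposreal 1 Rlt_0_1));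
    last by rewrite /Boule /= Rminus_diag Rabs_R0; lra.
    move=> e He.
    have m0 k : 0 <= m k by apply: Rle_trans (Rabs_pos _) (B 0 k).
    have /is_lim_seq_spec/(_ (mkposreal e He)) [N HN] := tail_lim m S m0 HS.
    exists N => n y Hn _.
    apply: Rle_lt_trans (Series_tail _ m S n (B y) HS) _.
    by have := HN n Hn; rewrite /= Rminus_0_r => /(Rle_lt_trans _ _ _ (Rle_abs _)).
  move=> n y _; apply/continuity_pt_filterlim.
  elim: n => [|n IH].
    have [H _ _] := Hf O; apply: continuous_ext (H y) => x; by rewrite sum_O.
  have [H _ _] := Hf (Datatypes.S n).
  by apply: continuous_ext (continuous_plus _ _ _ IH (H y)) => x; rewrite sum_nS.
- by move=> t; apply: Series_ext => k; have [_ -> _] := Hf k.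
- by move=> t; apply: (proj2 (ex_series_dominated _ m S (B t) HS)).
Qed.

Definition CT (T : R) : falg R.
Proof.
apply: (Falg R (fun=> True) (CT_nrm T)).
- by move=> f g M H; have -> : f = g by apply: functional_extensionality => t; apply: H.
- by move=> f M x [].
- by move=> f M [_ _ /(_ 0)]; apply: Rle_trans (Rabs_pos _).
- by move=> f M M' [H1 H2 H3] H; split => // t; apply: Rle_trans (H3 t) H.
- by move=> c; split => // t; [exact: continuous_const | lra].
- move=> f g M M' [H1 H2 H3] [H1' H2' H3']; split => t.
  + exact: continuous_plus (H1 t) (H1' t).
  + by rewrite H2 H2'.
  + by apply: Rle_trans (Rabs_triang _ _) _; move: (H3 t) (H3' t); lra.
- move=> f g M M' [H1 H2 H3] [H1' H2' H3']; split => t.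
  + exact: continuous_mult (H1 t) (H1' t).
  + by rewrite H2 H2'.
  + by rewrite Rabs_mult; apply: Rmult_le_compat => //; apply: Rabs_pos.
- exact: CT_series.
Defined.

Section Morphisms.
Context {X Y : Type} (A : falg X) (B : falg Y).

(** Pullback along [phi] is a homomorphism of norm at most 1. Substitutions are assembled from such
    maps one variable at a time by [pb_ps], so that a composite never has to be re-expanded by
    hand. *)
Definition pb (phi : Y -> X) : Prop :=
  (forall y, dom B y -> dom A (phi y)) /\
  forall f M, nrm A f M -> nrm B (fun y => f (phi y)) M.

(* [f \o phi - f \o psi] has norm at most [L] times that of [f]. *)
Definition lip (phi psi : Y -> X) (L : R) : Prop :=
  [/\ pb phi, pb psi, 0 <= L
    & forall f M, nrm A f M -> nrm B (fun y => f (phi y) - f (psi y)) (M * L)].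

End Morphisms.

Lemma pb_ps {X Y} (A : falg X) (B : falg Y) (r : posreal) phi u :
  pb A B phi -> nrm B u r -> pb (ps A r) B (fun y => (phi y, u y)).
Proof.
move=> [D H] Hu; have D' y : dom B y -> ps_dom A r (phi y, u y).
  by move=> Hy; split; [exact: D | exact: nrm_bound Hu Hy].
split=> // F M [c [m [H1 H2 H3]]].
apply: (nrm_is_series B (fun k y => c k (phi y) * u y ^ k)) H2 _.
  by move=> k; apply: nrm_mul (nrm_pow _ _ _ _ Hu); apply: H.
by move=> y Hy; apply: (H3 (phi y, u y)); apply: D'.
Qed.

Lemma pb_comp {X Y Z} (A : falg X) (B : falg Y) (C : falg Z) phi psi :
  pb A B phi -> pb B C psi -> pb A C (fun z => phi (psi z)).
Proof.
move=> [D H] [D' H']; split; first by move=> z /D' /D.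
by move=> f M /H /H'.
Qed.

Lemma pb_fst {X} (A : falg X) r : pb A (ps A r) (fun z => z.1).
Proof. by split => [z []|f M] //; apply: ps_base. Qed.

Lemma pb_base {X Y} (A : falg X) (B : falg Y) r phi :
  pb A B phi -> pb (ps A r) (ps B r) (fun z => (phi z.1, z.2)).
Proof.
move=> H; apply: pb_ps; last exact: ps_var.
exact: pb_comp H (pb_fst B r).
Qed.

Lemma ps_shrink {X} (A : falg X) (r r' : posreal) F M :
  r' <= r -> nrm (ps A r) F M -> nrm (ps A r') F M.
Proof.
move=> Hr; have [_ H] : pb (ps A r) (ps A r') (fun z => (z.1, z.2)).
  apply: pb_ps; first exact: pb_fst.
  exact: (nrm_le _ r') (ps_var A r') Hr.
by move=> /H; apply: nrm_ext => -[].
Qed.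

(** The mean value bound is [k (r/2)^(k-1) D]; halving the radius absorbs the factor, since
    [k <= 2^(k-1)] for [k >= 1]. *)
Lemma nrm_pow_sub {X} (A : falg X) (r : posreal) u v D k :
  nrm A u (r / 2) -> nrm A v (r / 2) -> nrm A (fun x => u x - v x) D ->
  nrm A (fun x => u x ^ k - v x ^ k) (r ^ k / r * D).
Proof.
move=> Hu Hv HD; have r0 := cond_pos r; have D0 := nrm_ge0 _ HD.
have p0 n : 0 <= r ^ n by apply: pow_le; lra.
case: k => [|k].
  apply: (nrm_le _ 0); first by apply: nrm_ext (nrm_zero A) => x _ /=; ring.
  apply: Rmult_le_pos => //; apply: Rmult_le_pos => //.
  by apply: Rlt_le; apply: Rinv_0_lt_compat.
elim: k => [|k IH].
  apply: (nrm_le _ D); first by apply: nrm_ext HD => x _ /=; ring.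
  by rewrite pow_1; apply: Req_le; field; lra.
apply: (nrm_le _ (r / 2 * (r ^ S k / r * D) + D * (r / 2) ^ S k)).
  apply: nrm_ext (nrm_add A (nrm_mul A Hu IH) (nrm_mul A HD (nrm_pow A _ _ (S k) Hv))) => x _ /=.
  by ring.
have -> : r ^ S (S k) / r * D = D * r ^ S k by rewrite /=; field; lra.
have -> : r / 2 * (r ^ S k / r * D) = D * (r ^ S k / 2) by rewrite /=; field; lra.
rewrite -Rmult_plus_distr_l; apply: Rmult_le_compat_l => //.
have -> : (r / 2) ^ S k = r ^ S k * (/ 2) ^ S k by rewrite -Rpow_mult_distr.
have : (/ 2) ^ S k <= / 2.
  rewrite /= -{3}[/ 2]Rmult_1_r; apply: Rmult_le_compat_l; first lra.
  by rewrite -(pow1 k); apply: pow_incr; lra.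
by move: (p0 (S k)); nra.
Qed.

Lemma bounded_sums_scale (m : nat -> R) (S c : R) : 0 <= c ->
  bounded_sums m S -> bounded_sums (fun k => m k * c) (S * c).
Proof.
move=> Hc H n; rewrite (sum_n_congr _ (fun k => c * m k)); last by move=> k; ring.
by rewrite sum_n_scale Rmult_comm; apply: Rmult_le_compat_r.
Qed.

(** Each term splits into a change of the coefficient, costing [L], and a change of the power,
    costing [D / r] by [nrm_pow_sub]; both costs are independent of [k]. *)
Lemma lip_ps {X Y} (A : falg X) (B : falg Y) (r : posreal) phi psi u v L D :
  lip A B phi psi L -> nrm B u (r / 2) -> nrm B v (r / 2) -> nrm B (fun y => u y - v y) D ->
  lip (ps A r) B (fun y => (phi y, u y)) (fun y => (psi y, v y)) (L + D / r).
Proof.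
move=> [[D1 H1] [D2 H2] L0 HL] Hu Hv HD; have r0 := cond_pos r.
have r2 : r / 2 <= r by lra.
have Hu' := nrm_le _ _ Hu r2; have Hv' := nrm_le _ _ Hv r2.
have DD : 0 <= D / r.
  apply: Rmult_le_pos; first exact: nrm_ge0 HD.
  by apply: Rlt_le; apply: Rinv_0_lt_compat.
have P1 := pb_ps A B r phi u (conj D1 H1) Hu'.
have P2 := pb_ps A B r psi v (conj D2 H2) Hv'.
split => //; first lra.
move=> F M [c [m [C1 C2 C3]]].
apply: (nrm_is_series B (fun k y => c k (phi y) * u y ^ k - c k (psi y) * v y ^ k)
  (fun k => m k * r ^ k * (L + D / r))).
- move=> k; apply: (nrm_le _ (m k * L * r ^ k + m k * (r ^ k / r * D))).
    apply: nrm_ext (nrm_add B (nrm_mul B (HL _ _ (C1 k)) (nrm_pow B _ _ k Hu'))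
       (nrm_mul B (H2 _ _ (C1 k)) (nrm_pow_sub B r u v D k Hu Hv HD))) => y _ /=.
    by ring.
  by apply: Req_le; field; lra.
- by apply: bounded_sums_scale => //; lra.
- move=> y Hy.
  exact: (@is_series_minus _ R_NormedModule _ _ _ _ (C3 (phi y, u y) (proj1 P1 y Hy)) (C3 (psi y, v y) (proj1 P2 y Hy))).
Qed.

Lemma lip_refl {X Y} (A : falg X) (B : falg Y) phi : pb A B phi -> lip A B phi phi 0.
Proof.
move=> H; split => //; first lra; move=> f M _; rewrite Rmult_0_r.
by apply: nrm_ext (nrm_zero B) => y _; ring.
Qed.

Lemma ps_rep_0 {X} (A : falg X) r F M c m x : ps_rep A r F M c m -> dom A x -> c O x = F (x, 0).
Proof.
move=> [_ _ H] Hx.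
have {}H : is_series (fun k => c k x * 0 ^ k) (F (x, 0)).
  by apply: (H (x, 0)); split => //=; rewrite Rabs_R0; move: (cond_pos r); lra.
rewrite -(is_series_unique _ _ H).
have H1 : is_series (fun k => c k x * 0 ^ k) (c O x * 0 ^ O).
  apply: (is_series_single (fun k => c k x * 0 ^ k)) => -[|k] // _.
  by rewrite pow_i; [ring | lia].
by rewrite (is_series_unique _ _ H1) /=; ring.
Qed.

(** A form of the Schwarz lemma: shrinking the radius by [lam] multiplies the norm of a series of
    order at least [j] by [lam ^ j]. For [j = 2] the Lipschitz constant, of size norm over radius,
    becomes small as well. *)
Lemma ps_shrink_order {X} (A : falg X) (r r' : posreal) F M c m (lam : R) j :
  ps_rep A r F M c m -> (forall k x, (k < j)%nat -> dom A x -> c k x = 0) ->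
  0 <= lam <= 1 -> (r' : R) = lam * r -> nrm (ps A r') F (lam ^ j * M).
Proof.
move=> [H1 H2 H3] Hj Hl Hr; have r0 := cond_pos r.
have Hr' : r' <= r by rewrite Hr; nra.
apply: (nrm_is_series (ps A r') (fun k z => c k z.1 * z.2 ^ k) (fun k => m k * r ^ k * lam ^ j)).
- move=> k; case: (le_lt_dec j k) => Hk.
    apply: (nrm_le _ (m k * r' ^ k)); first exact: ps_mono.
    rewrite Hr Rpow_mult_distr Rmult_assoc; apply: Rmult_le_compat_l; first exact: nrm_ge0 (H1 k).
    rewrite Rmult_comm; apply: Rmult_le_compat_l; first by apply: pow_le; lra.
    have -> : k = (j + (k - j))%nat by lia.
    rewrite pow_add -{2}[lam ^ j]Rmult_1_r; apply: Rmult_le_compat_l; first by apply: pow_le; lra.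
    by rewrite -(pow1 (k - j)); apply: pow_incr; lra.
  apply: (nrm_le _ 0).
    by apply: nrm_ext (nrm_zero _) => z [Hz _]; rewrite Hj //; ring.
  apply: Rmult_le_pos; last by apply: pow_le; lra.
  exact: ps_m_ge0 H1.
- by rewrite Rmult_comm; apply: bounded_sums_scale => //; apply: pow_le; lra.
- move=> z [Hz1 Hz2]; apply: H3; split => //; lra.
Qed.

Section Contraction.
Context {X : Type} (A : falg X) (Phi : (X -> R) -> X -> R) (rho : R).
Hypothesis Phi0 : nrm A (Phi (fun=> 0)) (rho / 2).
Hypothesis PhiL : forall u v d, nrm A u rho -> nrm A v rho ->
  nrm A (fun x => u x - v x) d -> nrm A (fun x => Phi u x - Phi v x) (d / 2).

Let it (n : nat) : X -> R := Nat.iter n Phi (fun=> 0).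

Lemma sum_geom_half n : sum_n (fun k => (/ 2) ^ k) n = 2 - (/ 2) ^ n :> R.
Proof.
elim: n => [|n IH]; first by rewrite sum_O /=; ring.
by rewrite sum_nS IH /=; field.
Qed.

(** Completeness is available for series only, so the limit is the sum of the increments [f n], of
    norm at most [rho / 2 * (/ 2) ^ n]. [PhiL] holds on the ball of radius [rho] only, hence the
    joint induction on increments and iterates. *)
Lemma contraction_fixpoint : exists u, nrm A u rho /\ forall x, dom A x -> Phi u x = u x.
Proof.
have rho0 : 0 <= rho by move: (nrm_ge0 _ Phi0); lra.
pose f n x := it (S n) x - it n x.
pose m n := rho / 2 * (/ 2) ^ n.
have sm n : sum_n m n = rho - rho / 2 * (/ 2) ^ n :> R.
  by rewrite /m sum_n_scale sum_geom_half; field.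
have h0 n : 0 <= (/ 2) ^ n by apply: pow_le; lra.
have tel n x : it (S n) x = sum_n (fun k => f k x) n.
  elim: n => [|n IH]; first by rewrite sum_O /f /=; ring.
  by rewrite sum_nS -IH /f; ring.
have Hfi n : nrm A (f n) (m n) /\ nrm A (it n) rho.
  elim/(well_founded_ind lt_wf): n => -[|n] IH.
    split; last by apply: (nrm_le _ 0) rho0; exact: nrm_zero.
    rewrite /m /= Rmult_1_r; apply: nrm_ext Phi0 => x _; rewrite /f /=; ring.
  have Hi : nrm A (it (S n)) rho.
    apply: nrm_ext (fun x _ => esym (tel n x)) _.
    apply: (nrm_le _ (sum_n m n)); last by rewrite sm; move: (h0 n); nra.
    (* [nrm_sum_n] wants a bound for every [k] while the induction hypothesis stops at [n], so the
       later terms are replaced by [0]. *)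
    have H k : nrm A (fun x => if le_lt_dec k n then f k x else 0) (m k).
      case: (le_lt_dec k n) => Hk; first by apply: (proj1 (IH k _)); lia.
      by apply: (nrm_le _ 0); [exact: nrm_zero | rewrite /m; move: (h0 k); nra].
    apply: nrm_ext (nrm_sum_n A _ _ n H) => x _.
    by apply: sum_n_ext_loc => k Hk; case: le_lt_dec => //; lia.
  split => //.
  have [IH1 IH2] := IH n (Nat.lt_succ_diag_r n).
  have := PhiL _ _ _ Hi IH2 IH1.
  by rewrite /m /=; have -> : rho / 2 * (/ 2 * (/ 2) ^ n) = rho / 2 * (/ 2) ^ n / 2 by field.
have Hf n := proj1 (Hfi n); have Hi n := proj2 (Hfi n).
have HS : bounded_sums m rho by move=> n; rewrite sm; move: (h0 n); nra.
pose u x := Series (fun k => f k x).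
have Hu : nrm A u rho by apply: nrm_series Hf HS.
exists u; split => // x Hx.
have ex y : dom A y -> is_series (fun k => f k y) (u y).
  move=> Hy; apply: Series_correct; apply: ex_series_Rabs.
  exact: nrm_ex_series Hf HS Hy.
have Ht n : nrm A (fun y => u y - it (S n) y) (rho * (/ 2) ^ S n).
  apply: (nrm_is_series A (fun k => f (S n + k)%nat) (fun k => m (S n + k)%nat)) => //.
    move=> j; apply: Rle_trans (_ : rho * (/ 2) ^ S n * ((/ 2) * (2 - (/ 2) ^ j)) <= _).
      rewrite -sum_geom_half -!sum_n_scale; apply: Req_le; apply: sum_n_congr => k.
      by rewrite /m pow_add; field.
    rewrite -{2}[rho * _]Rmult_1_r; apply: Rmult_le_compat_l; last by move: (h0 j); lra.
    exact: Rmult_le_pos.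
  move=> y Hy.
  have e : ex_series (fun k => f k y) by exists (u y); apply: ex.
  have -> : u y - it (S n) y = Series (fun k => f (S n + k)%nat y).
    rewrite /u (Series_incr_n _ (S n)) //; last lia.
    by rewrite -sum_n_Reals -tel Nat.pred_succ; ring.
  by apply: Series_correct; apply: (proj1 (ex_series_incr_n (fun k => f k y) (S n))).
have key n : Rabs (Phi u x - u x) <= 2 * rho * (/ 2) ^ n.
  have H1 := nrm_bound A (PhiL _ _ _ Hu (Hi (S n)) (Ht n)) Hx.
  have H2 := nrm_bound A (Ht (S n)) Hx.
  have -> : Phi u x - u x = (Phi u x - Phi (it (S n)) x) + - (u x - it (S (S n)) x).
    by rewrite /=; ring.
  apply: Rle_trans (Rabs_triang _ _) _; rewrite Rabs_Ropp.
  apply: Rle_trans (Rplus_le_compat _ _ _ _ H1 H2) _ => /=.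
  by move: (h0 n); nra.
have L : is_lim_seq (fun n => 2 * rho * (/ 2) ^ n) (2 * rho * 0).
  apply: is_lim_seq_mult'; first exact: is_lim_seq_const.
  by apply: is_lim_seq_geom; rewrite Rabs_pos_eq; lra.
have := is_lim_seq_le _ _ _ _ key (is_lim_seq_const _) L.
rewrite /= Rmult_0_r => H.
have := Rabs_pos (Phi u x - u x) => H'.
have /Rabs_eq_0 : Rabs (Phi u x - u x) = 0 by lra.
by lra.
Qed.

End Contraction.

(** * Bounded linear operators; mean and primitive of periodic functions *)

Definition lin_op {X} (A : falg X) (L : (X -> R) -> X -> R) (kappa : R) : Prop :=
  [/\ 0 <= kappa, forall f M, nrm A f M -> nrm A (L f) (kappa * M)
    & forall f g M M' c x, nrm A f M -> nrm A g M' -> dom A x ->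
        L (fun x => f x + c * g x) x = L f x + c * L g x].

(** The parameter [z.2] is frozen; on power series this is the action of [L] on each coefficient. *)
Definition lift {X} (L : (X -> R) -> X -> R) (F : X * R -> R) (z : X * R) : R :=
  L (fun x => F (x, z.2)) z.1.

Section LinearOperators.
Context {X : Type} (A : falg X) (L : (X -> R) -> X -> R) (kappa : R).
Hypothesis HL : lin_op A L kappa.

Lemma lin_op_sub f g M M' x : nrm A f M -> nrm A g M' -> dom A x ->
  L (fun x => f x - g x) x = L f x - L g x.
Proof.
move=> Hf Hg Hx; have [_ _ Hl] := HL.
have -> : L f x - L g x = L f x + (-1) * L g x by ring.
rewrite -(Hl f g M M' (-1) x Hf Hg Hx); congr (L _ x).
by apply: functional_extensionality => y; ring.
Qed.

Lemma lin_op_0 x : dom A x -> L (fun=> 0) x = 0.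
Proof.
move=> Hx; have [_ HB _] := HL.
have := nrm_bound A (HB _ _ (nrm_zero A)) Hx; rewrite Rmult_0_r => H.
by apply: Rabs_eq_0; move: (Rabs_pos (L (fun=> 0) x)); lra.
Qed.

Lemma lin_op_sum (f : nat -> X -> R) m n (w : nat -> R) x :
  (forall k, nrm A (f k) (m k)) -> dom A x ->
  L (fun y => sum_n (fun k => f k y * w k) n) x = sum_n (fun k => L (f k) x * w k) n.
Proof.
move=> Hf Hx; have [_ _ Hl] := HL.
have Hfw k : nrm A (fun y => f k y * w k) (m k * Rabs (w k)).
  by apply: nrm_mul => //; apply: nrm_const.
elim: n => [|n IH].
  rewrite sum_O -[RHS]Rplus_0_l -{1}(lin_op_0 x Hx) Rmult_comm -(Hl _ _ _ _ (w O) x (nrm_zero A) (Hf O) Hx).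
  by congr (L _ x); apply: functional_extensionality => y; rewrite sum_O; ring.
rewrite sum_nS -IH Rmult_comm.
have H := nrm_sum_n A _ _ n Hfw.
rewrite -(Hl _ _ _ _ (w (S n)) x H (Hf (S n)) Hx).
by congr (L _ x); apply: functional_extensionality => y; rewrite sum_nS; ring.
Qed.

(** Boundedness lets [L] pass through the infinite sum: its value on a tail is at most [kappa] times
    the tail of [m k * r ^ k]. *)
Lemma lin_op_lift (r : posreal) : lin_op (ps A r) (lift L) kappa.
Proof.
have [K0 HB Hl] := HL; split => //; last first.
  move=> F G M M' c [x y] HF HG [Hx Hy]; rewrite /lift /=.
  exact: (Hl _ _ M M' c x (ps_slice A r F M y HF Hy) (ps_slice A r G M' y HG Hy) Hx).
move=> F M [c [m [H1 H2 H3]]].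
exists (fun k => L (c k)), (fun k => kappa * m k); split.
- by move=> k; apply: HB.
- move=> n; rewrite (sum_n_congr _ (fun k => kappa * (m k * r ^ k))); last by move=> k; ring.
  by rewrite sum_n_scale; apply: Rmult_le_compat_l.
- move=> [x y] [Hx Hy]; rewrite /lift /=; simpl in Hx, Hy.
  have m0 k : 0 <= m k * r ^ k := ps_m_ge0 A r c m k H1.
  have Hcy k : nrm A (fun x => c k x * y ^ k) (m k * r ^ k).
    apply: (nrm_le A (m k * Rabs (y ^ k))).
      by apply: nrm_mul => //; apply: nrm_const.
    apply: Rmult_le_compat_l; first exact: nrm_ge0 (H1 k).
    by rewrite -RPow_abs; apply: pow_incr; split => //; apply: Rabs_pos.
  have HF : nrm A (fun x => F (x, y)) M.
    by apply: ps_slice Hy; exists c, m.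
  have Ht n : nrm A (fun x => F (x, y) - sum_n (fun k => c k x * y ^ k) n)
      (Series (fun k => m k * r ^ k) - sum_n (fun k => m k * r ^ k) n).
    have [em _] := bounded_sums_series _ _ m0 H2.
    apply: (nrm_is_series A (fun k x => c (S n + k)%nat x * y ^ (S n + k)) (fun k => m (S n + k)%nat * r ^ (S n + k))).
    + by move=> k; apply: Hcy.
    + move=> j; rewrite (Series_incr_n _ (S n)) //; last lia.
      rewrite -sum_n_Reals Nat.pred_succ.
      set u := Series _.
      have -> : sum_n (fun k => m k * r ^ k) n + u - sum_n (fun k => m k * r ^ k) n = u by ring.
      apply: sum_n_le_Series; first by move=> k; apply: m0.
      exact: (proj1 (ex_series_incr_n (fun k => m k * r ^ k) (S n))).
    + move=> x' Hx'.
      have H3' := H3 (x', y) (conj Hx' Hy); simpl in H3'.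
      have e : ex_series (fun k => c k x' * y ^ k) by exists (F (x', y)).
      rewrite -(is_series_unique _ _ H3') (Series_incr_n _ (S n)) //; last lia.
      rewrite -sum_n_Reals Nat.pred_succ.
      set u := Series _.
      have -> : sum_n (fun k => c k x' * y ^ k) n + u - sum_n (fun k => c k x' * y ^ k) n = u by ring.
      apply: Series_correct.
      exact: (proj1 (ex_series_incr_n (fun k => c k x' * y ^ k) (S n))).
  change (is_lim_seq (sum_n (fun k => L (c k) x * y ^ k)) (L (fun x => F (x, y)) x)).
  apply/is_lim_seq_spec => e.
  have /is_lim_seq_spec/(_ e) [N HN] : is_lim_seq (fun n => kappa * (Series (fun k => m k * r ^ k) - sum_n (fun k => m k * r ^ k) n)) 0.
    rewrite -(Rmult_0_r kappa); apply: is_lim_seq_mult'; first exact: is_lim_seq_const.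
    exact: tail_lim m0 H2.
  exists N => n /HN; rewrite Rminus_0_r => He.
  apply: Rle_lt_trans He; apply: Rle_trans (Rle_abs _).
  rewrite -(lin_op_sum c m n (fun k => y ^ k) x H1 Hx) Rabs_minus_sym.
  rewrite -(lin_op_sub _ _ _ _ x HF (nrm_sum_n A _ _ n Hcy) Hx).
  exact: nrm_bound (HB _ _ (Ht n)) Hx.
Qed.

End LinearOperators.

Section PeriodicFunctions.
Variable T : R.
Hypothesis T0 : 0 < T.

Lemma periodic_IZR (f : R -> R) : (forall t, f (t + T) = f t) ->
  forall (k : Z) t, f (t + IZR k * T) = f t.
Proof.
move=> H.
have Hn (n : nat) t : f (t + INR n * T) = f t.
  elim: n t => [|n IH] t; first by congr f; rewrite /=; ring.
  by rewrite S_INR -(IH t) -(H (t + INR n * T)); congr f; ring.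
move=> k t; case: (Z_le_gt_dec 0 k) => Hk.
  by rewrite -(Z2Nat.id k) // -INR_IZR_INZ Hn.
have -> : IZR k = - INR (Z.to_nat (- k)).
  by rewrite INR_IZR_INZ Z2Nat.id; [rewrite opp_IZR; ring | lia].
by rewrite -(Hn (Z.to_nat (- k))); congr f; ring.
Qed.

Lemma reduce_mod (t : R) : exists k : Z, 0 <= t + IZR k * T <= T.
Proof.
exists (- Int_part (t / T))%Z; rewrite opp_IZR.
have [H1 H2] := base_Int_part (t / T).
have E : t = t / T * T by field; lra.
rewrite {1 3}E; split; nra.
Qed.

Lemma RInt_periodic (f : R -> R) a :
  (forall t, continuous f t) -> (forall t, f (t + T) = f t) ->
  RInt f a (a + T) = RInt f 0 T :> R.
Proof.
move=> Hc Hp.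
have ex u v : ex_RInt f u v by apply: ex_RInt_continuous => *; apply: Hc.
have E1 : RInt f a (a + T) = RInt f a 0 + RInt f 0 (a + T) by rewrite -(RInt_Chasles f a 0 (a + T)).
have E2 : RInt f 0 (a + T) = RInt f 0 T + RInt f T (a + T) by rewrite -(RInt_Chasles f 0 T (a + T)).
have E3 : RInt f T (a + T) = RInt f 0 a.
  have := RInt_comp_lin f 1 T 0 a (ex _ _).
  rewrite !Rmult_1_l Rplus_0_l => <-.
  by apply: RInt_ext => x _; rewrite /scal /= /mult /= !Rmult_1_l Hp.
have E4 : RInt f 0 a = - RInt f a 0 by rewrite -(opp_RInt_swap f a 0).
by rewrite E1 E2 E3 E4; ring.
Qed.

(** The dummy time argument makes the mean an operator from functions to functions, as [lin_op]
    requires. *)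
Definition mean (f : R -> R) (t : R) : R := / T * RInt f 0 T.
Definition prim (f : R -> R) (t : R) : R := RInt (fun s => f s - mean f s) 0 t.
(** The inverse of differentiation on functions of mean zero, preceded by the projection onto
    them. *)
Definition prim0 (f : R -> R) (t : R) : R := prim f t - mean (prim f) t.

Lemma CT_ex_RInt f M a b : nrm (CT T) f M -> ex_RInt f a b.
Proof. by move=> [H _ _]; apply: ex_RInt_continuous => *; apply: H. Qed.

Lemma RInt_abs_le f M a b : nrm (CT T) f M -> a <= b -> Rabs (RInt f a b) <= (b - a) * M.
Proof.
move=> Hf Hab; have [H _ HM] := Hf.
by apply: abs_RInt_le_const Hab (CT_ex_RInt f M a b Hf) _ => t _; apply: HM.
Qed.

Lemma mean_bound f M : nrm (CT T) f M -> nrm (CT T) (mean f) M.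
Proof.
move=> Hf; rewrite /mean; split => t //; first exact: continuous_const.
rewrite Rabs_mult Rabs_pos_eq; last by apply: Rlt_le; apply: Rinv_0_lt_compat.
have H := RInt_abs_le f M 0 T Hf (Rlt_le _ _ T0).
apply: Rle_trans (Rmult_le_compat_l _ _ _ _ H) _; first by apply: Rlt_le; apply: Rinv_0_lt_compat.
by apply: Req_le; field; lra.
Qed.

Lemma RInt_lin f g M M' c a b : nrm (CT T) f M -> nrm (CT T) g M' ->
  RInt (fun t => f t + c * g t) a b = RInt f a b + c * RInt g a b :> R.
Proof.
move=> Hf Hg; have e1 := CT_ex_RInt f M a b Hf; have e2 := CT_ex_RInt g M' a b Hg.
have -> : RInt (fun t => f t + c * g t) a b = plus (RInt f a b) (RInt (fun t => scal c (g t)) a b).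
  by rewrite -RInt_plus //; apply: ex_RInt_scal.
by rewrite RInt_scal.
Qed.

Lemma mean_lin f g M M' c t : nrm (CT T) f M -> nrm (CT T) g M' ->
  mean (fun t => f t + c * g t) t = mean f t + c * mean g t.
Proof. by move=> Hf Hg; rewrite /mean (RInt_lin f g M M') //; ring. Qed.

Lemma mean_op : lin_op (CT T) mean 1.
Proof.
split; first lra.
- by move=> f M Hf; rewrite Rmult_1_l; apply: mean_bound.
- by move=> f g M M' c t Hf Hg _; apply: (mean_lin f g M M').
Qed.

Lemma centered_nrm f M : nrm (CT T) f M -> nrm (CT T) (fun t => f t - mean f t) (2 * M).
Proof.
move=> Hf; apply: (nrm_le (CT T) (M + M)); last lra.
by apply: nrm_sub => //; apply: mean_bound.
Qed.

Lemma mean_const c t : mean (fun=> c) t = c.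
Proof. by rewrite /mean RInt_const /scal /= /mult /=; field; lra. Qed.

Lemma prim_derive f M t : nrm (CT T) f M -> is_derive (prim f) t (f t - mean f t).
Proof.
move=> Hf; have Hc := centered_nrm f M Hf.
apply: (is_derive_RInt (fun s => f s - mean f s) (prim f) 0 t).
  by exists posreal_one => y _; apply: RInt_correct; apply: CT_ex_RInt Hc.
by have [H _ _] := Hc; apply: H.
Qed.

Lemma prim_bound f M : nrm (CT T) f M -> nrm (CT T) (prim f) (2 * T * M).
Proof.
move=> Hf; have Hc := centered_nrm f M Hf; have M0 := nrm_ge0 _ Hf.
have Hp t : prim f (t + T) = prim f t.
  rewrite /prim -(RInt_Chasles _ 0 t (t + T)); try exact: CT_ex_RInt Hc.
  have [H1 H2 _] := Hc.
  rewrite RInt_periodic // /plus /=.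
  have -> : RInt (fun s => f s - mean f s) 0 T = 0 :> R; last by rewrite Rplus_0_r.
  have -> : (fun s => f s - mean f s) = (fun s => f s + (-1) * mean f s).
    by apply: functional_extensionality => s; ring.
  rewrite (RInt_lin f (mean f) M M) //; last exact: mean_bound.
  by rewrite /mean RInt_const /scal /= /mult /=; field; lra.
split => //.
  move=> t; apply: ex_derive_continuous; eexists; exact: prim_derive Hf.
(* The bound is uniform in [t] because periodicity brings the upper limit of integration back to
   [[0, T]]. *)
move=> t; have [k Hk] := reduce_mod t.
rewrite -(periodic_IZR (prim f) Hp k t).
apply: Rle_trans (RInt_abs_le _ (2 * M) 0 _ Hc (proj1 Hk)) _.
by nra.
Qed.

Lemma prim0_derive f M t : nrm (CT T) f M -> is_derive (prim0 f) t (f t - mean f t).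
Proof.
move=> Hf; have H := prim_derive f M t Hf.
have -> : f t - mean f t = minus (f t - mean f t) 0 by rewrite minus_zero_r.
by apply: is_derive_minus => //; apply: is_derive_const.
Qed.

Lemma prim_lin f g M M' c t : nrm (CT T) f M -> nrm (CT T) g M' ->
  prim (fun t => f t + c * g t) t = prim f t + c * prim g t.
Proof.
move=> Hf Hg; rewrite /prim.
rewrite -(RInt_lin _ _ _ _ c 0 t (centered_nrm f M Hf) (centered_nrm g M' Hg)).
congr (RInt _ 0 t); have E x : f x + c * g x - mean (fun t => f t + c * g t) x
   = f x - mean f x + c * (g x - mean g x) by rewrite (mean_lin f g M M') //; ring.
exact: functional_extensionality E.
Qed.

Lemma prim0_op : lin_op (CT T) prim0 (4 * T).
Proof.
split; first lra.
- move=> f M Hf; have H := prim_bound f M Hf.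
  apply: (nrm_le (CT T) (2 * T * M + 2 * T * M)); last lra.
  by apply: nrm_sub => //; apply: mean_bound.
- move=> f g M M' c t Hf Hg _; rewrite /prim0 (prim_lin f g M M') //.
  have -> : prim (fun t => f t + c * g t) = (fun t => prim f t + c * prim g t).
    by apply: functional_extensionality => s; apply: (prim_lin f g M M').
  by rewrite (mean_lin _ _ _ _ c t (prim_bound f M Hf) (prim_bound g M' Hg)); ring.
Qed.

Lemma mean_prim0 f M t : nrm (CT T) f M -> mean (prim0 f) t = 0.
Proof.
move=> Hf; have H := prim_bound f M Hf; rewrite /prim0.
have -> : (fun t => prim f t - mean (prim f) t) = (fun t => prim f t + (-1) * mean (prim f) t).
  by apply: functional_extensionality => s; ring.
rewrite (mean_lin _ _ _ _ (-1) t H (mean_bound _ _ H)).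
have -> : mean (mean (prim f)) t = mean (prim f) t by apply: mean_const.
ring.
Qed.

End PeriodicFunctions.

(** * Analytic implicit functions and Puiseux roots *)

Definition sums_to (a : nat -> R) (delta : R) (g : R -> R) : Prop :=
  forall x, Rabs x < delta -> is_series (fun k => a k * x ^ k) (g x).

Lemma sums_to_CV a delta g x : sums_to a delta g -> Rabs x < delta ->
  Rbar_lt (Rabs x) (CV_radius a).
Proof.
move=> H Hx; pose y := (Rabs x + delta) / 2.
have y0 : 0 <= y by rewrite /y; move: (Rabs_pos x); lra.
have Hy : Rabs y < delta by rewrite Rabs_pos_eq // /y; lra.
apply: (Rbar_lt_le_trans _ y); first by rewrite /= /y; lra.
apply: (proj1 (CV_radius_bounded a)).
have L : is_lim_seq (fun k => a k * y ^ k) 0 by apply: ex_series_lim_0; exists (g y); apply: H.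
have [M HM] := filterlim_bounded (fun k => a k * y ^ k) (ex_intro _ 0 L).
by exists M.
Qed.

Lemma sums_to_PSeries a delta g x : sums_to a delta g -> Rabs x < delta -> PSeries a x = g x.
Proof. by move=> H /H /is_series_unique. Qed.

Lemma locally_ball0 (delta : R) (P : R -> Prop) : 0 < delta ->
  (forall x, Rabs x < delta -> P x) -> locally 0 P.
Proof.
move=> d0 H; exists (mkposreal delta d0) => x; rewrite /ball /= /AbsRing_ball /= => Hx.
apply: H; move: Hx; rewrite /abs /minus /plus /opp /=.
by have -> : x + - 0 = x by ring.
Qed.

Lemma sums_to_unique a b delta g : 0 < delta -> sums_to a delta g -> sums_to b delta g ->
  forall k, a k = b k.
Proof.
move=> d0 Ha Hb k.
have d00 : Rabs 0 < delta by rewrite Rabs_R0.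
have Ca := sums_to_CV a delta g 0 Ha d00; have Cb := sums_to_CV b delta g 0 Hb d00.
rewrite Rabs_R0 in Ca Cb.
apply: PSeries_ext_recip Ca Cb _; apply: (locally_ball0 delta) => // x Hx.
by rewrite (sums_to_PSeries a delta g) // (sums_to_PSeries b delta g).
Qed.

Lemma sums_to_Derive_n a delta g k : 0 < delta -> sums_to a delta g ->
  Derive_n g k 0 = a k * INR (fact k).
Proof.
move=> d0 H; have d00 : Rabs 0 < delta by rewrite Rabs_R0.
have C := sums_to_CV a delta g 0 H d00; rewrite Rabs_R0 in C.
rewrite -Derive_n_coef //; apply: Derive_n_ext_loc.
by apply: (locally_ball0 delta) => // x Hx; rewrite (sums_to_PSeries a delta g).
Qed.

Lemma sums_to_weaken a delta delta' g : delta' <= delta -> sums_to a delta g -> sums_to a delta' g.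
Proof. by move=> Hd H x Hx; apply: H; lra. Qed.

(** Both sides are the [k]-th derivative of [g] at [xi]. It turns the vanishing of a derivative
    along a curve into the vanishing of a coefficient after translation. *)
Lemma sums_to_shift a b delta delta' g xi k : 0 < delta' -> Rabs xi < delta ->
  sums_to a delta g -> sums_to b delta' (fun x => g (xi + x)) ->
  b k * INR (fact k) = PSeries (PS_derive_n k a) xi.
Proof.
move=> d0 Hxi Ha Hb.
rewrite -(sums_to_Derive_n b delta' _ k d0 Hb) -Derive_n_PSeries; last exact: sums_to_CV Ha Hxi.
rewrite -[xi in RHS]Rplus_0_l -Derive_n_comp_trans.
apply: Derive_n_ext_loc; apply: (locally_ball0 (delta - Rabs xi)); first lra.
move=> x Hx; rewrite (sums_to_PSeries a delta g) // ?[xi + x]Rplus_comm //.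
by move: (Rabs_triang x xi); lra.
Qed.

Definition order_at_0 (n : nat) (g : R -> R) : Prop :=
  exists delta a, [/\ 0 < delta, sums_to a delta g, forall k, (k < n)%nat -> a k = 0 & a n <> 0].

Lemma pb_point {X} (A : falg X) x : dom A x -> pb A U0 (fun=> x).
Proof. by move=> Hx; split => // f M Hf; apply: nrm_bound Hf Hx. Qed.

Lemma pb_const {X} (A : falg X) : pb U0 A (fun=> tt).
Proof.
by split => // f M Hf; apply: (nrm_le A (Rabs (f tt))) Hf; apply: nrm_const.
Qed.

Lemma ps_rep_slice {X} (A : falg X) (r : posreal) F M c m x : ps_rep A r F M c m -> dom A x ->
  sums_to (fun k => c k x) r (fun y => F (x, y)).
Proof. by move=> [_ _ H] Hx y Hy; apply: (H (x, y)); split => //=; lra. Qed.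

Lemma ps_rep_nrm {X} (A : falg X) (r : posreal) F M c m : ps_rep A r F M c m -> nrm (ps A r) F M.
Proof. by move=> H; exists c, m. Qed.

Lemma ps_drop2 {X} (A : falg X) (r : posreal) F M c m : ps_rep A r F M c m ->
  exists c' m', ps_rep A r (fun z => F z - c O z.1 - c 1%nat z.1 * z.2) M c' m' /\
    forall k x, (k < 2)%nat -> c' k x = 0.
Proof.
move=> [H1 H2 H3].
exists (fun k => if le_lt_dec 2 k then c k else fun=> 0), (fun k => if le_lt_dec 2 k then m k else 0).
split; last by move=> k x Hk; case: le_lt_dec => //; lia.
split.
- by move=> k; case: (le_lt_dec 2 k) => Hk; [exact: H1 | exact: nrm_zero].
- move=> n; apply: Rle_trans (H2 n); apply: sum_n_mono => k.
  case: (le_lt_dec 2 k) => Hk; first by apply: Rle_refl.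
  by rewrite Rmult_0_l; apply: (ps_m_ge0 A r c).
- move=> z Hz.
  have := @is_series_minus _ R_NormedModule _ _ _ _
    (@is_series_minus _ R_NormedModule _ _ _ _ (H3 z Hz) (is_series_delta (c O z.1) (fun k => z.2 ^ k) O))
    (is_series_delta (c 1%nat z.1) (fun k => z.2 ^ k) 1).
  rewrite pow_1 pow_O Rmult_1_r; apply: is_series_ext => k.
  case: (Nat.eq_dec k 0) => k0; case: (Nat.eq_dec k 1) => k1; case: (le_lt_dec 2 k) => k2; try lia; rewrite /minus /plus /opp /=; try rewrite k0; try rewrite k1; ring.
Qed.

Lemma exists_small (C e : R) : 0 <= C -> 0 < e -> exists lam, 0 < lam <= 1 /\ lam * C <= e.
Proof.
move=> C0 e0; have D : 0 < C + e by lra.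
exists (e / (C + e)); split; last first.
  apply: (Rmult_le_reg_r (C + e)) => //.
  have -> : e / (C + e) * C * (C + e) = e * C by field; lra.
  nra.
split; first by apply: Rdiv_lt_0_compat.
by apply/Rle_div_l => //; lra.
Qed.

Definition scaled (lam : R) (H : 0 < lam) (r : posreal) : posreal :=
  mkposreal (lam * r) (Rmult_lt_0_compat _ _ H (cond_pos r)).

Lemma ps_vanish_shrink (rho : posreal) f M (lam : R) (H : 0 < lam) : lam <= 1 ->
  nrm (ps U0 rho) f M -> f (tt, 0) = 0 -> nrm (ps U0 (scaled lam H rho)) f (lam * M).
Proof.
move=> Hl [c [m Hc]] f0; apply: (nrm_le _ (lam ^ 1 * M)); last by rewrite pow_1; lra.
apply: (ps_shrink_order U0 rho (scaled lam H rho) f M c m lam 1 Hc) => //; last by lra.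
move=> k [] Hk _; have -> : k = O by lia.
by rewrite (ps_rep_0 _ _ _ _ _ _ tt Hc).
Qed.

(** Fixed point of [x = - (c0 + (c1 - e) x + F2 (x)) / e], where [c0], [c1] are the first
    coefficients in the last variable, [e] is [c1] at the origin and [F2] is the remainder of order
    two. First the radius in [x] is shrunk to tame [F2], then the radius in the parameter to tame
    [c0] and [c1 - e], which vanish at the origin. *)
Lemma implicit_series (rho r : posreal) F M eta :
  nrm (ps (ps U0 rho) r) F M -> F ((tt, 0), 0) = 0 ->
  (exists delta a, [/\ 0 < delta, sums_to a delta (fun x => F ((tt, 0), x)) & a 1%nat <> 0]) ->
  0 < eta ->
  exists (rho' : posreal) xi, [/\ rho' <= rho, nrm (ps U0 rho') xi eta, xi (tt, 0) = 0
    & forall s, Rabs s <= rho' -> Rabs (xi (tt, s)) <= r /\ F ((tt, s), xi (tt, s)) = 0].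
Proof.
move=> [c [m Hc]] F0 [delta [a [d0 Ha a1]]] eta0.
have r0 := cond_pos r; have rho0 := cond_pos rho.
have D0 : dom (ps U0 rho) (tt, 0) by split => //=; rewrite Rabs_R0; lra.
have Hs := ps_rep_slice _ _ _ _ _ _ _ Hc D0.
have c1 : c 1%nat (tt, 0) <> 0.
  have dm : 0 < Rmin delta r by apply: Rmin_pos.
  by rewrite -(sums_to_unique _ _ _ _ dm (sums_to_weaken _ _ _ _ (Rmin_l _ _) Ha)
     (sums_to_weaken _ _ _ _ (Rmin_r _ _) Hs) 1%nat).
have c0 : c O (tt, 0) = 0 by rewrite (ps_rep_0 _ _ _ _ _ _ _ Hc).
set e := c 1%nat (tt, 0) in c1.
have e0 : 0 < Rabs e by apply: Rabs_pos_lt.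
have [c' [m' [Hc' Hc'0]]] := ps_drop2 _ _ _ _ _ _ Hc.
set F2 := (fun z => _) in Hc'.
have [Hcm _ _] := Hc.
have M0 : 0 <= M by apply: nrm_ge0 (ps_rep_nrm _ _ _ _ _ _ Hc).
(* On radius [lam * r], [F2] has norm [lam ^ 2 * M], hence Lipschitz constant [lam * (M / r)]. *)
have [lam [Hl Hl']] : exists lam, 0 < lam <= 1 /\ lam * (M / r) <= Rabs e / 4.
  by apply: exists_small; [apply: Rdiv_le_0_compat | lra].
pose U := scaled lam (proj1 Hl) r.
have U0' := cond_pos U.
have HF2 : nrm (ps (ps U0 rho) U) F2 (lam ^ 2 * M).
  apply: (ps_shrink_order _ r U F2 M c' m' lam 2 Hc') => //; last by lra.
  by move=> k x Hk _; apply: Hc'0.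
pose R0 := Rmin (U / 2) eta.
have R00 : 0 < R0 by apply: Rmin_pos => //; lra.
have RU : R0 <= U / 2 by apply: Rmin_l.
(* After division by [e], [c1 - e] contributes [1/4] to the Lipschitz constant, as does [F2], and
   [c0] makes [Phi 0] at most [R0 / 2]. *)
have [mu [Hm Hm']] : exists mu, 0 < mu <= 1 /\ mu * (m 1%nat + Rabs e + m O) <= Rmin (Rabs e / 4) (Rabs e * R0 / 2).
  apply: exists_small; first by move: (nrm_ge0 _ (Hcm O)) (nrm_ge0 _ (Hcm 1%nat)); lra.
  by apply: Rmin_pos; nra.
have mm0 := nrm_ge0 _ (Hcm O); have mm1 := nrm_ge0 _ (Hcm 1%nat).
have Hm1 : mu * (m 1%nat + Rabs e) <= Rabs e / 4.
  by have := Rmin_l (Rabs e / 4) (Rabs e * R0 / 2); nra.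
have Hm0 : mu * m O <= Rabs e * R0 / 2.
  by have := Rmin_r (Rabs e / 4) (Rabs e * R0 / 2); nra.
pose rho' := scaled mu (proj1 Hm) rho.
have rr : rho' <= rho by rewrite /=; nra.
pose B := ps U0 rho'.
have Hc0 : nrm B (c O) (Rabs e * R0 / 2).
  apply: (nrm_le B (mu * m O)) => //.
  by apply: ps_vanish_shrink => //; lra.
have Hc1 : nrm B (fun z => c 1%nat z - e) (Rabs e / 4).
  apply: (nrm_le B (mu * (m 1%nat + Rabs e))) => //.
  apply: ps_vanish_shrink; first lra; last by rewrite /e; ring.
  by apply: nrm_sub => //; apply: nrm_const.
have He1 : nrm B (fun=> - / e) (/ Rabs e).
  by have := nrm_const B (- / e); rewrite Rabs_Ropp Rabs_inv.
pose Phi (u : unit * R -> R) z := - / e * (c O z + (c 1%nat z - e) * u z + F2 (z, u z)).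
have Pid : pb (ps U0 rho) B (fun z => z).
  split; first by move=> z [_ Hz]; split => //; lra.
  by move=> f Mf; apply: ps_shrink.
have HL u v d : nrm B u R0 -> nrm B v R0 -> nrm B (fun z => u z - v z) d ->
    nrm B (fun z => F2 (z, u z) - F2 (z, v z)) (Rabs e / 4 * d).
  move=> Hu Hv Hd.
  have [_ _ _ /(_ _ _ HF2)] := lip_ps _ _ U _ _ u v _ d (lip_refl _ _ _ Pid)
    (nrm_le _ _ Hu RU) (nrm_le _ _ Hv RU) Hd.
  move=> H; apply: nrm_le H _.
  have -> : lam ^ 2 * M * (0 + d / U) = lam * (M / r) * d by rewrite /=; field; lra.
  by apply: Rmult_le_compat_r => //; apply: nrm_ge0 Hd.
have F20 z : dom B z -> F2 (z, 0) = 0.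
  move=> Hz; rewrite /F2 /= Rmult_0_r (ps_rep_0 _ _ _ _ _ _ _ Hc); first by ring.
  exact: (proj1 Pid).
have [xi [Hxi Exi]] : exists u, nrm B u R0 /\ forall x, dom B x -> Phi u x = u x.
  apply: contraction_fixpoint.
    apply: (nrm_le _ (/ Rabs e * (Rabs e * R0 / 2))).
      apply: nrm_ext (nrm_mul _ He1 Hc0) => z Hz.
      by rewrite /Phi F20 //; ring.
    by apply: Req_le; field; lra.
  move=> u v d Hu Hv Hd.
  apply: (nrm_le _ (/ Rabs e * (Rabs e / 4 * d + Rabs e / 4 * d))).
    apply: nrm_ext (nrm_mul _ He1 (nrm_add _ (nrm_mul _ Hc1 Hd) (HL u v d Hu Hv Hd))) => z Hz.
    by rewrite /Phi; ring.
  by apply: Req_le; field; lra.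
exists rho', xi; split => //.
- by apply: nrm_le Hxi _; apply: Rmin_r.
(* At the origin the fixed point equation reads [x0 = - F2 (x0) / e], whence
   [Rabs x0 <= Rabs x0 / 4]. *)
- have DB : dom B (tt, 0) by split => //=; rewrite Rabs_R0; nra.
  have := Exi _ DB; rewrite /Phi c0 -/e Rminus_diag Rmult_0_l !Rplus_0_l.
  set x0 := xi (tt, 0) => E.
  have X0 : Rabs x0 <= U / 2 by apply: Rle_trans RU; apply: nrm_bound Hxi DB.
  have N1 : nrm U0 (fun=> 0) (U / 2) by rewrite /= Rabs_R0; apply: Rlt_le; apply: Rdiv_lt_0_compat; [exact: U0' | lra].
  have N2 : nrm U0 (fun=> x0 - 0) (Rabs x0) by rewrite /= Rminus_0_r; apply: Rle_refl.
  have [_ _ _ H] := lip_ps (ps U0 rho) U0 U (fun=> (tt, 0)) (fun=> (tt, 0))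
    (fun=> x0) (fun=> 0) 0 (Rabs x0) (lip_refl _ _ _ (pb_point _ _ D0)) X0 N1 N2.
  have {}H := H _ _ HF2.
  have /= {}H := H; rewrite F20 // Rminus_0_r in H.
  have {}H : Rabs (F2 (tt, 0, x0)) <= Rabs e / 4 * Rabs x0.
    apply: Rle_trans H _.
    have -> : lam * (lam * 1) * M * (0 + Rabs x0 / (lam * r)) = lam * (M / r) * Rabs x0 by field; lra.
    by apply: Rmult_le_compat_r => //; apply: Rabs_pos.
  have E2 : Rabs x0 = / Rabs e * Rabs (F2 (tt, 0, x0)) by rewrite -{1}E Rabs_mult Rabs_Ropp Rabs_inv.
  have : Rabs x0 <= / Rabs e * (Rabs e / 4 * Rabs x0).
    by rewrite {1}E2; apply: Rmult_le_compat_l => //; apply: Rlt_le; apply: Rinv_0_lt_compat.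
  have -> : / Rabs e * (Rabs e / 4 * Rabs x0) = Rabs x0 / 4 by field; lra.
  by move=> ?; apply: Rabs_eq_0; move: (Rabs_pos x0); lra.
- move=> s Hs'; have DB : dom B (tt, s) by [].
  split.
    apply: Rle_trans (nrm_bound B Hxi DB) _; apply: Rle_trans RU _.
    by rewrite /=; nra.
  have := Exi _ DB; rewrite /Phi /F2 /= => E.
  have {}E : c O (tt, s) + (c 1%nat (tt, s) - e) * xi (tt, s) +
   (F (tt, s, xi (tt, s)) - c O (tt, s) - c 1%nat (tt, s) * xi (tt, s)) = - e * xi (tt, s).
    by rewrite -{4}E; field.
  lra.
Qed.

Lemma bounded_sums_shift (a : nat -> R) S N : (forall k, 0 <= a k) ->
  bounded_sums a S -> bounded_sums (fun k => a (k + N)%nat) S.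
Proof.
move=> a0; elim: N a a0 => [|N IH] a a0 H.
  by move=> n; rewrite (sum_n_congr _ a) // => k; rewrite Nat.add_0_r.
have E n : sum_n (fun k => a (k + Datatypes.S N)%nat) n = sum_n (fun k => a (Datatypes.S (k + N))) n.
  by apply: sum_n_congr => k; rewrite Nat.add_succ_r.
move=> n; rewrite E; apply: (IH (fun k => a (Datatypes.S k))) => // {}n.
apply: Rle_trans (H (Datatypes.S n)).
have -> : sum_n a (Datatypes.S n) = a O + sum_n (fun k => a (Datatypes.S k)) n :> R.
  elim: n => [|n IHn]; first by rewrite sum_nS !sum_O.
  by rewrite sum_nS IHn [in RHS]sum_nS; ring.
by move: (a0 O); lra.
Qed.

Lemma fact_add_bound k N : (fact (k + N) <= fact N * (2 ^ N) ^ k * fact k)%nat.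
Proof.
elim: N => [|N IH]; first by rewrite Nat.add_0_r /= Nat.pow_1_l; lia.
rewrite Nat.add_succ_r /fact -/fact.
have H : (k + 1 <= 2 ^ k)%nat by elim: k {IH} => [|k IHk] /=; lia.
have E : ((2 ^ S N) ^ k = 2 ^ k * (2 ^ N) ^ k)%nat by rewrite -Nat.pow_mul_l.
rewrite E.
apply: Nat.le_trans (_ : S (k + N) * (fact N * (2 ^ N) ^ k * fact k) <= _)%nat.
  exact: Nat.mul_le_mono_l.
have -> : (S N * fact N * (2 ^ k * (2 ^ N) ^ k) * fact k = (S N * 2 ^ k) * (fact N * (2 ^ N) ^ k * fact k))%nat by ring.
apply: Nat.mul_le_mono_r; nia.
Qed.

(** By [fact_add_bound] the factor [(k + N)! / k!] is at most [N! * (2 ^ N) ^ k], which the smaller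
    radius [r / 2 ^ N] absorbs. *)
Lemma ps_derive_n {X} (A : falg X) (r : posreal) F M c m N : ps_rep A r F M c m ->
  exists (r' : posreal) M', r' <= r /\
    nrm (ps A r') (fun z => PSeries (PS_derive_n N (fun k => c k z.1)) z.2) M'.
Proof.
move=> [H1 H2 _]; have r0 := cond_pos r.
have t0 : 1 <= 2 ^ N by apply: pow_R1_Rle; lra.
have tr : 0 < r / 2 ^ N by apply: Rdiv_lt_0_compat; lra.
pose r' := mkposreal (r / 2 ^ N) tr.
exists r', (INR (fact N) / r ^ N * M); split; first by apply/Rle_div_l; [lra | nra].
apply: (nrm_series (ps A r') (f := fun k z => PS_derive_n N (fun k => c k z.1) k * z.2 ^ k)
   (m := fun k => INR (fact (k + N)) / INR (fact k) * m (k + N)%nat * r' ^ k)).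
  move=> k; apply: (ps_mono A r' (fun x => PS_derive_n N (fun k => c k x) k)).
  have := nrm_scal A (INR (fact (k + N)) / INR (fact k)) _ _ (H1 (k + N)%nat).
  rewrite Rabs_pos_eq //; apply: Rdiv_le_0_compat; first exact: pos_INR.
  exact: INR_fact_lt_0.
have p k : 0 <= m k * r ^ k by apply: (ps_m_ge0 A r c).
have rN : 0 < r ^ N by apply: pow_lt.
have := bounded_sums_scale _ _ (INR (fact N) / r ^ N) _ (bounded_sums_shift _ M N p H2).
rewrite Rmult_comm => H n; apply: Rle_trans (H _ n); last first.
  by apply: Rdiv_le_0_compat => //; apply: pos_INR.
apply: sum_n_mono => k.
have f0 := INR_fact_lt_0 k.
have B : INR (fact (k + N)) / INR (fact k) <= INR (fact N) * (2 ^ N) ^ k.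
  apply/Rle_div_l => //.
  have := le_INR _ _ (fact_add_bound k N); rewrite !mult_INR !pow_INR.
  by rewrite (_ : INR 2 = 2) //=; ring.
have m0 := nrm_ge0 A (H1 (k + N)%nat).
have q0 : 0 <= r' ^ k by apply: pow_le; rewrite /=; lra.
apply: Rle_trans (_ : INR (fact N) * (2 ^ N) ^ k * m (k + N)%nat * r' ^ k <= _).
  by apply: Rmult_le_compat_r => //; apply: Rmult_le_compat_r.
apply: Req_le; rewrite /= pow_add.
have -> : r ^ k = (2 ^ N) ^ k * (r / 2 ^ N) ^ k.
  by rewrite -Rpow_mult_distr; congr (_ ^ k); field; lra.
by field; lra.
Qed.

(** * The Newton polygon and the induction on the order *)

Lemma nat_minimum (P : nat -> Prop) : (exists n, P n) ->
  exists n, P n /\ forall k, P k -> (n <= k)%nat.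
Proof.
move=> [n]; elim/(well_founded_ind lt_wf): n => n IH Pn.
case: (classic (exists k, (k < n)%nat /\ P k)) => [[k [Hk Pk]]|H]; first exact: IH k Hk Pk.
exists n; split => // k Pk; have [//|Hk] : (n <= k)%nat \/ (k < n)%nat by lia.
by case: H; exists k.
Qed.

Lemma divide_fact a n : (1 <= a <= n)%nat -> exists q, (q * a = fact n)%nat.
Proof.
elim: n => [|n IH] Ha; first lia.
have [E|Hn] : (a = S n)%nat \/ (a <= n)%nat by lia.
  by exists (fact n); rewrite E Nat.mul_comm.
have [|q Hq] := IH; first lia.
by exists (S n * q)%nat; rewrite -Nat.mul_assoc Hq.
Qed.

(** [P k j] stands for a nonzero coefficient of [x ^ k * eps ^ j]. The slope [m / d] is the least
    [j / (n - k)] in lowest terms; a point on the edge satisfies [d j = m (n - k)], and Gauss's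
    lemma gives [d | n - k]. *)
Lemma newton_slope (n : nat) (P : nat -> nat -> Prop) :
  (exists k j, (k < n)%nat /\ P k j) -> (forall k j, (k < n)%nat -> P k j -> (1 <= j)%nat) ->
  exists m d k0 j0, [/\ (1 <= m)%nat, (1 <= d)%nat,
      [/\ (k0 < n)%nat, P k0 j0 & (d * j0 + m * k0 = m * n)%nat],
      forall k j, (k < n)%nat -> P k j -> (m * n <= d * j + m * k)%nat
    & forall k j, (k <= n)%nat -> (d * j + m * k = m * n)%nat -> Nat.divide d (n - k)].
Proof.
move=> [k1 [j1 [Hk1 Hj1]]] H1.
(* Scaling by [n!] makes all the ratios [j / (n - k)] natural numbers, so that well-ordering yields
   a minimum. *)
have [|v [[k0 [j0 [q0 [Hk0 P0 Eq0 Ev]]]] Hv]] := nat_minimum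
  (fun v => exists k j q, [/\ (k < n)%nat, P k j, (q * (n - k) = fact n)%nat & v = (j * q)%nat]).
  have [|q Hq] := divide_fact (n - k1) n; first lia.
  by exists (j1 * q)%nat, k1, j1, q.
have j00 := H1 _ _ Hk0 P0.
have Hmin k j : (k < n)%nat -> P k j -> (j0 * (n - k) <= j * (n - k0))%nat.
  move=> Hk Pk; have [|q Hq] := divide_fact (n - k) n; first lia.
  have Hle : (v <= j * q)%nat by apply: Hv; exists k, j, q.
  have F0 := lt_O_fact n; subst v.
  have q1 : (0 < q)%nat by move: Hq F0; case: (q) => //=; lia.
  have q2 : (0 < q0)%nat by move: Eq0 F0; case: (q0) => //=; lia.
  move: {Hv} Hle Hq Eq0; set a := (n - k)%nat; set a0 := (n - k0)%nat => Hle Hq Eq0.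
  have : (j0 * a * (q * q0) <= j * a0 * (q * q0))%nat.
    have -> : (j0 * a * (q * q0) = j0 * q0 * (q * a))%nat by ring.
    have -> : (j * a0 * (q * q0) = j * q * (q0 * a0))%nat by ring.
    by rewrite Hq Eq0; apply: Nat.mul_le_mono_r.
  by move=> H; apply: (proj2 (Nat.mul_le_mono_pos_r _ _ (q * q0) _)); [nia | exact: H].
pose g := Nat.gcd j0 (n - k0).
have g0 : (0 < g)%nat.
  have : g <> 0%nat by move=> /Nat.gcd_eq_0_l; lia.
  lia.
have [m Em] := Nat.gcd_divide_l j0 (n - k0); have [d Ed] := Nat.gcd_divide_r j0 (n - k0).
rewrite -/g in Em Ed.
have Egcd : Nat.gcd d m = 1%nat.
  have : (Nat.gcd (m * g) (d * g) = g)%nat by rewrite -Em -Ed.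
  rewrite Nat.gcd_mul_mono_r Nat.gcd_comm; nia.
exists m, d, k0, j0; split.
- by case: m Em {Egcd} => [|m]; lia.
- by case: d Ed {Egcd} => [|d]; lia.
- split => //; nia.
- move=> k j Hk Pk; have := Hmin k j Hk Pk.
  have E1 : (j0 * (n - k) = m * (n - k) * g)%nat by rewrite {1}Em; ring.
  have E2 : (j * (n - k0) = d * j * g)%nat by rewrite Ed; ring.
  rewrite E1 E2 => /(proj2 (Nat.mul_le_mono_pos_r _ _ g g0)).
  have -> : (m * n = m * (n - k) + m * k)%nat by rewrite -Nat.mul_add_distr_l; congr (_ * _)%nat; lia.
  lia.
- move=> k j Hk E; apply: (Nat.gauss d m); last exact: Egcd.
  exists j; rewrite Nat.mul_sub_distr_l; lia.
Qed.

Lemma is_series_finite (a : nat -> R) n : (forall k, (n < k)%nat -> a k = 0) ->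
  is_series a (sum_f_R0 a n).
Proof.
move=> H; change (is_lim_seq (sum_n a) (sum_f_R0 a n)).
apply: (is_lim_seq_ext_loc (fun=> sum_f_R0 a n)); last exact: is_lim_seq_const.
exists n => N HN; elim: N HN => [|N IH] HN.
  have -> : n = O by lia.
  by rewrite sum_O.
have [->|Hn] : n = S N \/ (n <= N)%nat by lia.
  by rewrite sum_n_Reals.
by rewrite sum_nS -IH // H; [rewrite Rplus_0_r | lia].
Qed.

Lemma exists_radius (l : list R) : (forall x, List.In x l -> 0 < x) ->
  exists tau : posreal, forall x, List.In x l -> tau <= x.
Proof.
elim: l => [|a l IH] H; first by exists (mkposreal 1 Rlt_0_1).
have [|tau Ht] := IH; first by move=> x Hx; apply: H; right.
have p : 0 < Rmin a tau by apply: Rmin_pos; [apply: H; left | exact: cond_pos].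
exists (mkposreal _ p) => x /= [<-|Hx]; first exact: Rmin_l.
by apply: Rle_trans (Rmin_r _ _) (Ht x Hx).
Qed.

Lemma pow_le_base (x : R) k : 0 <= x <= 1 -> (1 <= k)%nat -> x ^ k <= x.
Proof.
move=> Hx; case: k => [|k] Hk; first lia.
rewrite /= -{3}[x]Rmult_1_r; apply: Rmult_le_compat_l; first lra.
by rewrite -(pow1 k); apply: pow_incr.
Qed.

(** The substitution [eps = s ^ d], [x = s ^ mu * (r0 + y)] makes every term divisible by
    [s ^ (mu * n)]. The quotient [g] restricts at [s = 0] to the edge polynomial recentred at its
    root [r0], so its order in [y] is the multiplicity [n' < n]. *)
Lemma newton_step (rho r : posreal) f M c m n :
  Nat.Odd n -> ps_rep (ps U0 rho) r f M c m ->
  (forall s, Rabs s <= rho -> c (Nat.pred n) (tt, s) = 0) ->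
  (forall k, (k < n)%nat -> c k (tt, 0) = 0) -> c n (tt, 0) <> 0 ->
  (exists s, Rabs s <= rho /\ c O (tt, s) <> 0) ->
  exists (d mu n' L : nat) (r0 : R) (tau : posreal) g M',
    [/\ (1 <= d)%nat, (1 <= mu)%nat, Nat.Odd n', (n' < n)%nat & (d * fact n' * L = fact n)%nat] /\
    [/\ nrm (ps (ps U0 tau) posreal_one) g M', order_at_0 n' (fun y => g ((tt, 0), y)),
        tau <= 1, tau * (Rabs r0 + 1) <= r
      & forall s y, Rabs s <= tau -> Rabs y <= 1 ->
          f ((tt, s ^ d), s ^ mu * (r0 + y)) = s ^ (mu * n) * g ((tt, s), y)].
Proof.
move=> On [H1 H2 H3] Hpred Hlow Hn [s0 [Hs0 cs0]].
have n1 : (1 <= n)%nat by case: On => k ->; lia.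
have rh0 := cond_pos rho; have r0' := cond_pos r.
have [al Hal'] := choice _ H1; have [mm Hal] := choice _ Hal'.
pose a k j := al k j tt.
have Ha k s : Rabs s <= rho -> is_series (fun j => a k j * s ^ j) (c k (tt, s)).
  by move=> Hs; have [_ _ H] := Hal k; apply: (H (tt, s)).
have Hmm k j : Rabs (a k j) <= mm k j by have [H _ _] := Hal k; apply: H.
have a_st k : sums_to (a k) rho (fun s => c k (tt, s)).
  by move=> s Hs; apply: Ha; lra.
have azero k : (forall s, Rabs s <= rho -> c k (tt, s) = 0) -> forall j, a k j = 0.
  move=> H; apply: (sums_to_unique (a k) (fun=> 0) rho _ rh0 (a_st k)) => s Hs.
  rewrite H; last lra.
  have := is_series_finite (fun k => 0 * s ^ k) 0 (fun k _ => Rmult_0_l _).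
  by rewrite /= Rmult_0_l.
have a0 k : a k O = c k (tt, 0) by rewrite /a (ps_rep_0 _ _ _ _ _ _ tt (Hal k)).
have [||mu [d [k0 [j0 [mu1 d1 [Hk0 ak0 E0] Hge Hdiv]]]]] := newton_slope n (fun k j => a k j <> 0).
- have [//|H] := classic (exists k j, (k < n)%nat /\ a k j <> 0).
  case: cs0; rewrite -(is_series_unique _ _ (Ha O s0 Hs0)).
  have -> : (fun j => a O j * s0 ^ j) = (fun=> 0 * 0); last by rewrite Series_scal_l Rmult_0_l.
  apply: functional_extensionality => j.
  have -> : a O j = 0; last ring.
  by apply: NNPP => aj; apply: H; exists O, j; split => //; lia.
- by move=> k [|j] Hk Hj; [case: Hj; rewrite a0 Hlow | lia].
have d_0 : (d <> 0)%nat by lia.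
(* The subtraction is truncated; it is exact wherever [a k j <> 0] ([exE]), and elsewhere the
   coefficient is [0]. *)
pose ex k j := (d * j + mu * k - mu * n)%nat.
have exE k j : a k j <> 0 -> (ex k j + mu * n = d * j + mu * k)%nat.
  move=> Hj; rewrite /ex; have [Hk|Hk] : (k < n)%nat \/ (n <= k)%nat by lia.
    by have := Hge k j Hk Hj; lia.
  nia.
(* The sum of the terms of degree [mu * n], i.e. the coefficients on the Newton edge:
   [0 ^ ex k j] is [1] there and [0] above it. *)
pose e k := Series (fun j => a k j * 0 ^ ex k j).
have e_single k j : (forall i, i <> j -> a k i <> 0 -> (0 < ex k i)%nat) -> ex k j = O ->
   is_series (fun i => a k i * 0 ^ ex k i) (a k j).
  move=> H Hj; have -> : a k j = a k j * 0 ^ ex k j by rewrite Hj /=; ring.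
  apply: (is_series_single (fun i => a k i * 0 ^ ex k i)) => i Hi.
  have [->|ai] := Req_dec (a k i) 0; first ring.
  by rewrite pow_i; [ring | exact: H].
have e_zero k : (forall j, a k j <> 0 -> (0 < ex k j)%nat) -> is_series (fun i => a k i * 0 ^ ex k i) 0.
  move=> H; have -> : (fun i => a k i * 0 ^ ex k i) = (fun i => 0 * 0 ^ i).
    apply: functional_extensionality => i.
    have [->|ai] := Req_dec (a k i) 0; first ring.
    by rewrite pow_i; [ring | exact: H].
  by have := is_series_finite (fun k => 0 * 0 ^ k) 0 (fun k _ => Rmult_0_l _); rewrite /= Rmult_0_l.
have e_ex k : ex_series (fun i => a k i * 0 ^ ex k i).
  have [[j [aj Ej]]|H] := classic (exists j, a k j <> 0 /\ ex k j = O).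
    exists (a k j); apply: e_single => // i Hi ai.
    have := exE k i ai; have := exE k j aj; rewrite Ej => E1 E2.
    by apply/Nat.neq_0_lt_0 => E3; apply: Hi; rewrite E3 in E2; nia.
  exists 0; apply: e_zero => j aj; apply/Nat.neq_0_lt_0 => Ej; apply: H; by exists j.
have e_big k : (n < k)%nat -> e k = 0.
  by move=> Hk; apply: is_series_unique; apply: e_zero => j aj; rewrite /ex; nia.
have [|||||r0 [n' [b [On' [Hn' [[L EL] [b0 [bn [bbig Eb]]]]]]]]] := EdgePolynomial.real_edge_root n d e On.
- lia.
- have -> : e n = a n O; last by rewrite a0.
  by apply: is_series_unique; apply: e_single; rewrite /ex; nia.
- by apply: is_series_unique; apply: e_zero => j; rewrite azero.
- exists k0; split => //; have -> : e k0 = a k0 j0; last by [].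
  apply: is_series_unique; apply: e_single; last by rewrite /ex; lia.
  by move=> i Hi ai; have := exE k0 i ai; rewrite /ex; nia.
- move=> k Hk ek; have [[j [aj Ej]]|H] := classic (exists j, a k j <> 0 /\ ex k j = O).
    by apply: (Hdiv k j) => //; have := exE k j aj; lia.
  case: ek; apply: is_series_unique; apply: e_zero => j aj; apply/Nat.neq_0_lt_0 => Ej.
  by apply: H; exists j.
have R0 : 0 < Rabs r0 + 1 by move: (Rabs_pos r0); lra.
(* With [tau <= 1], the other two constraints keep [s ^ d] within [rho] and [s ^ mu * (r0 + y)]
   within [r] when [Rabs y <= 1]. *)
have [|tau Htau] := exists_radius (cons 1 (cons (rho : R) (cons (r / (Rabs r0 + 1)) nil))).
  by move=> x /= [<-|[<-|[<-|//]]] //; [lra | apply: Rdiv_lt_0_compat].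
have t1 : tau <= 1 by apply: Htau; left.
have trho : tau <= rho by apply: Htau; right; left.
have tr : tau * (Rabs r0 + 1) <= r.
  by apply/Rle_div_r => //; apply: Htau; right; right; left.
have t0 := cond_pos tau.
have td : tau ^ d <= rho by apply: Rle_trans trho; apply: pow_le_base; [lra | lia].
have tm : tau ^ mu <= tau by apply: pow_le_base; [lra | lia].
pose g (z : (unit * R) * R) := Series (fun k => Series (fun j => a k j * z.1.2 ^ ex k j) * (r0 + z.2) ^ k).
pose A2 := ps (ps U0 tau) posreal_one.
have Hy : nrm A2 (fun z => r0 + z.2) (Rabs r0 + 1).
  apply: nrm_add; first exact: nrm_const.
  exact: (ps_var (ps U0 tau) posreal_one).
have Hs : nrm A2 (fun z => z.1.2) tau.
  exact: (ps_base (ps U0 tau) posreal_one _ _ (ps_var U0 tau)).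
have tmn : 0 < tau ^ (mu * n) by apply: pow_lt.
(* The exponent factors [tau ^ ex k j] as [(tau ^ d) ^ j * tau ^ (mu * k) / tau ^ (mu * n)] for
   nonzero terms, and [tau ^ d <= rho]: dividing by [s ^ (mu * n)] costs only a constant in the
   norm. *)
have bnd k j : Rabs (a k j) * tau ^ ex k j <= mm k j * rho ^ j * (tau ^ (mu * k) / tau ^ (mu * n)).
  have m0 : 0 <= mm k j by apply: Rle_trans (Rabs_pos _) (Hmm k j).
  have tk : 0 < tau ^ (mu * k) by apply: pow_lt.
  have tkn : 0 <= tau ^ (mu * k) / tau ^ (mu * n) by apply: Rlt_le; apply: Rdiv_lt_0_compat.
  have [->|aj] := Req_dec (a k j) 0.
    rewrite Rabs_R0 Rmult_0_l; apply: Rmult_le_pos => //; apply: Rmult_le_pos => //.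
    by apply: pow_le; lra.
  have -> : tau ^ ex k j = (tau ^ d) ^ j * (tau ^ (mu * k) / tau ^ (mu * n)).
    have E : tau ^ ex k j * tau ^ (mu * n) = tau ^ (d * j) * tau ^ (mu * k).
      by rewrite -!pow_add exE.
    rewrite -pow_mult; apply: (Rmult_eq_reg_r (tau ^ (mu * n))); last lra.
    by rewrite E; field; lra.
  rewrite -Rmult_assoc; apply: Rmult_le_compat_r => //.
  apply: Rmult_le_compat => //; [exact: Rabs_pos | by apply: pow_le; apply: pow_le; lra |].
  by apply: pow_incr; split => //; apply: pow_le; lra.
have Hin k : nrm A2 (fun z => Series (fun j => a k j * z.1.2 ^ ex k j)) (m k * (tau ^ (mu * k) / tau ^ (mu * n))).
  apply: (nrm_series A2 (m := fun j => mm k j * rho ^ j * (tau ^ (mu * k) / tau ^ (mu * n)))).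
    move=> j; apply: nrm_le (bnd k j); apply: nrm_mul; first exact: nrm_const.
    exact: nrm_pow.
  apply: bounded_sums_scale; first by apply: Rlt_le; apply: Rdiv_lt_0_compat; apply: pow_lt.
  by have [_ H _] := Hal k.
have Hg : nrm A2 g (M * / tau ^ (mu * n)).
  apply: (nrm_series A2 (m := fun k => m k * r ^ k * / tau ^ (mu * n))); last first.
    by apply: bounded_sums_scale => //; apply: Rlt_le; apply: Rinv_0_lt_compat.
  move=> k; apply: (nrm_le A2 (m k * (tau ^ (mu * k) / tau ^ (mu * n)) * (Rabs r0 + 1) ^ k)).
    by apply: nrm_mul => //; apply: nrm_pow.
  have m0 : 0 <= m k := nrm_ge0 _ (H1 k).
  have -> : m k * (tau ^ (mu * k) / tau ^ (mu * n)) * (Rabs r0 + 1) ^ k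
       = m k * (tau ^ mu * (Rabs r0 + 1)) ^ k * / tau ^ (mu * n).
    by rewrite Rpow_mult_distr pow_mult; field; lra.
  apply: Rmult_le_compat_r; first by apply: Rlt_le; apply: Rinv_0_lt_compat.
  apply: Rmult_le_compat_l => //; apply: pow_incr; split.
    by apply: Rmult_le_pos; [apply: pow_le; lra | lra].
  by apply: Rle_trans tr; apply: Rmult_le_compat_r; lra.
have n'1 : (1 <= n')%nat by case: On' => ? ->; lia.
exists d, mu, n', L, r0, tau, g, (M * / tau ^ (mu * n)); split.
  by split => //; rewrite EL; ring.
split => //.
- exists 1, b; split => //; first lra.
  move=> y Hy'.
  have -> : g ((tt, 0), y) = sum_f_R0 (fun k => b k * y ^ k) n.
    rewrite -Eb /g /=; apply: is_series_unique.
    apply: (is_series_ext (fun k => e k * (r0 + y) ^ k)) => //.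
    by apply: is_series_finite => k Hk; rewrite e_big //; ring.
  by apply: is_series_finite => k Hk; rewrite bbig //; ring.
- move=> s y Hs' Hy'.
  have Hsd : Rabs (s ^ d) <= rho.
    rewrite -RPow_abs; apply: Rle_trans td; apply: pow_incr; split => //; exact: Rabs_pos.
  have Hx : Rabs (s ^ mu * (r0 + y)) <= r.
    rewrite Rabs_mult -RPow_abs.
    apply: Rle_trans tr; apply: Rmult_le_compat; try exact: Rabs_pos.
    + by apply: pow_le; apply: Rabs_pos.
    + by apply: Rle_trans tm; apply: pow_incr; split => //; exact: Rabs_pos.
    + by apply: Rle_trans (Rabs_triang _ _) _; lra.
  have Dz : ps_dom (ps U0 rho) r ((tt, s ^ d), s ^ mu * (r0 + y)) by [].
  rewrite -(is_series_unique _ _ (H3 _ Dz)) /g /= -Series_scal_l.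
  apply: Series_ext => k.
  rewrite -(is_series_unique _ _ (Ha k _ Hsd)) -Rmult_assoc -Series_scal_l.
  rewrite Rpow_mult_distr -Rmult_assoc; congr (_ * _).
  rewrite -Series_scal_r; apply: Series_ext => j.
  have [->|aj] := Req_dec (a k j) 0; first ring.
  rewrite -!pow_mult [RHS]Rmult_comm !Rmult_assoc; congr (_ * _).
  by rewrite -!pow_add exE.
Qed.

Lemma pb_power (rho tau : posreal) k : tau ^ k <= rho ->
  pb (ps U0 rho) (ps U0 tau) (fun z => (tt, z.2 ^ k)).
Proof.
move=> H; apply: pb_ps; first exact: pb_const.
by apply: nrm_le H; apply: nrm_pow; apply: ps_var.
Qed.

Lemma fact_ge1 n : (1 <= fact n)%nat.
Proof. exact: lt_O_fact. Qed.

(** No base case is required: for [n = 1] the translation [xi] is already a root curve, since then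
    [N = 0] and [ctN] says that the constant coefficient vanishes. *)
Lemma puiseux_root n : Nat.Odd n -> forall (rho r : posreal) f M,
  nrm (ps (ps U0 rho) r) f M -> order_at_0 n (fun x => f ((tt, 0), x)) ->
  exists (tau : posreal) x, [/\ nrm (ps U0 tau) x r, x (tt, 0) = 0
    & forall s, Rabs s <= tau ->
        Rabs (s ^ fact n) <= rho /\ f ((tt, s ^ fact n), x (tt, s)) = 0].
Proof.
elim/(well_founded_ind lt_wf): n => n IH On rho r f M Hf [delta [e [d0 He elow en]]].
have rho0 := cond_pos rho; have r0 := cond_pos r.
have n1 : (1 <= n)%nat by case: On => k ->; lia.
pose N := Nat.pred n; have EN : n = S N by rewrite /N; lia.
have [c [m Hc]] := Hf.
have D0 : dom (ps U0 rho) (tt, 0) by split => //=; rewrite Rabs_R0; lra.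
have Hs0 := ps_rep_slice _ _ _ _ _ _ _ Hc D0.
have dm : 0 < Rmin delta r by apply: Rmin_pos.
have ce k : c k (tt, 0) = e k.
  by rewrite (sums_to_unique _ _ _ _ dm (sums_to_weaken _ _ _ _ (Rmin_r _ _) Hs0)
     (sums_to_weaken _ _ _ _ (Rmin_l _ _) He) k).
have [r' [M' [rr' Hh]]] := ps_derive_n _ _ _ _ _ _ N Hc.
(* [h] is the derivative of order [n - 1] in the last variable; it has a simple zero at the origin,
   and recentring at its root curve [xi] kills the coefficient of degree [n - 1] for every [s]. The
   bound [r / 2] on [xi] leaves [r / 2] for the new variable. *)
set h := (fun z => _) in Hh.
pose hc k := PS_derive_n N (fun k => c k (tt, 0)) k.
have [|||rho1 [xi [rr1 Hxi xi0 Exi]]] := implicit_series rho r' h M' (r / 2) Hh.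
- rewrite /h /= PSeries_0 /PS_derive_n ce elow ?Rmult_0_r //; lia.
- exists r, hc; split => //.
    move=> x Hx; apply: Series_correct; apply: ex_series_Rabs; apply: CV_disk_inside.
    by rewrite CV_radius_derive_n; apply: sums_to_CV Hs0 Hx.
  rewrite /hc /PS_derive_n ce (_ : 1 + N = n)%nat; last by lia.
  apply: Rmult_integral_contrapositive_currified => //.
  by apply: Rgt_not_eq; apply: Rdiv_lt_0_compat; apply: INR_fact_lt_0.
- lra.
have r1 := cond_pos rho1.
have r20 : 0 < r / 2 by lra.
pose r2 := mkposreal (r / 2) r20.
pose ft (z : (unit * R) * R) := f ((tt, z.1.2), xi z.1 + z.2).
have Hft : nrm (ps (ps U0 rho1) r2) ft M.
  have [_ H] : pb (ps (ps U0 rho) r) (ps (ps U0 rho1) r2) (fun z => ((tt, z.1.2), xi z.1 + z.2)).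
    apply: pb_ps.
      apply: (pb_comp _ (ps U0 rho1) _ (fun z => (tt, z.2)) (fun z => z.1)); last exact: pb_fst.
      apply: pb_ps; first exact: pb_const.
      by apply: nrm_le rr1; apply: ps_var.
    apply: (nrm_le _ (r / 2 + r / 2)); last lra.
    apply: nrm_add; first exact: (ps_base (ps U0 rho1) r2).
    exact: (ps_var (ps U0 rho1) r2).
  exact: H.
have [ct [mt Hct]] := Hft.
have D1 s : Rabs s <= rho1 -> dom (ps U0 rho1) (tt, s) by [].
have D1' s : Rabs s <= rho1 -> dom (ps U0 rho) (tt, s) by move=> ?; split => //=; lra.
have xib s : Rabs s <= rho1 -> Rabs (xi (tt, s)) <= r / 2.
  by move=> Hs; apply: nrm_bound Hxi (D1 s Hs).
have ctN s : Rabs s <= rho1 -> ct N (tt, s) = 0.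
  move=> Hs.
  have H1 := ps_rep_slice _ _ _ _ _ _ _ Hct (D1 s Hs).
  have H2 := ps_rep_slice _ _ _ _ _ _ _ Hc (D1' s Hs).
  have Hx : Rabs (xi (tt, s)) < r by move: (xib s Hs); lra.
  have := sums_to_shift _ _ _ _ _ _ N r20 Hx H2 H1.
  have [_] := Exi s Hs; rewrite /h /= => -> /Rmult_integral [//|].
  by have := INR_fact_lt_0 N; lra.
have cte k : ct k (tt, 0) = e k.
  have z0 : Rabs 0 <= rho1 by rewrite Rabs_R0; lra.
  have H1 := ps_rep_slice _ _ _ _ _ _ _ Hct (D1 0 z0).
  have dm2 : 0 < Rmin delta r2 by apply: Rmin_pos.
  apply: (sums_to_unique (fun k => ct k (tt, 0)) e _ (fun x => f ((tt, 0), x)) dm2 _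
    (sums_to_weaken _ _ _ _ (Rmin_l _ _) He) k).
  have := sums_to_weaken _ _ _ _ (Rmin_r delta _) H1.
  by move=> H x Hx; have := H x Hx; rewrite /ft /= xi0 Rplus_0_l.
(* Either the translated function vanishes identically at [0], and [xi] is the root, or some lower
   coefficient is nonzero and the Newton polygon has an edge. *)
have [HA|HB] := classic (forall s, Rabs s <= rho1 -> ct O (tt, s) = 0).
  have [|tau Htau] := exists_radius (cons 1 (cons (rho1 : R) nil)).
    by move=> x /= [<-|[<-|//]] //; lra.
  have t0 := cond_pos tau.
  have t1 : tau <= 1 by apply: Htau; left.
  have trho : tau <= rho1 by apply: Htau; right; left.
  have tn : tau ^ fact n <= rho1.
    by apply: Rle_trans trho; apply: pow_le_base; [lra | exact: fact_ge1].
  exists tau, (fun z => xi (tt, z.2 ^ fact n)); split.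
  - have [_ H] := pb_power rho1 tau (fact n) tn.
    by apply: (nrm_le _ (r / 2)); [exact: H | lra].
  - by rewrite /= pow_i //; exact: fact_ge1.
  - move=> s Hs.
    have Hsn : Rabs (s ^ fact n) <= rho1.
      by rewrite -RPow_abs; apply: Rle_trans tn; apply: pow_incr; split => //; exact: Rabs_pos.
    split; first lra.
    have := HA _ Hsn; rewrite (ps_rep_0 _ _ _ _ _ _ _ Hct); last exact: D1.
    by rewrite /ft /= Rplus_0_r.
have [s1 [Hs1 cs1]] : exists s, Rabs s <= rho1 /\ ct O (tt, s) <> 0.
  apply: NNPP => H; apply: HB => s Hs; apply: NNPP => Hcs; apply: H; by exists s.
have [||||d [mu [n' [L [y0 [tau [g [Mg [[d1 mu1 On' Hn' EL] [Hg Hord t1 tr Eg]]]]]]]]]] :=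
  newton_step rho1 r2 ft M ct mt n On Hct.
- exact: ctN.
- by move=> k Hk; rewrite cte elow.
- by rewrite cte.
- by exists s1.
have [tau' [x [Hx x0 Ex]]] := IH n' Hn' On' tau posreal_one g Mg Hg Hord.
have t'0 := cond_pos tau'; have t0 := cond_pos tau.
have [|nu Hnu] := exists_radius (cons (tau : R) (cons (tau' : R) (cons (rho1 : R) nil))).
  by move=> z /= [<-|[<-|[<-|//]]].
have nu0 := cond_pos nu.
have nut : nu <= tau by apply: Hnu; left.
have nut' : nu <= tau' by apply: Hnu; right; left.
have nur : nu <= rho1 by apply: Hnu; right; right; left.
have L1 : (1 <= L)%nat by case: L EL => [|L] EL; [have := fact_ge1 n; lia | lia].
have f1 := fact_ge1 n'.
have nuk k : (1 <= k)%nat -> nu ^ k <= nu by move=> Hk; apply: pow_le_base Hk; lra.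
have sk s k : (1 <= k)%nat -> Rabs s <= nu -> Rabs (s ^ k) <= nu.
  move=> Hk Hs; rewrite -RPow_abs; apply: Rle_trans (nuk k Hk).
  by apply: pow_incr; split => //; exact: Rabs_pos.
(* The inner root has parameter [s ^ L] and solves [g] at [(s ^ L) ^ n'! = s ^ K]; as [d * K = n!],
   the outer parameter is [s ^ n!]. *)
pose K := (L * fact n')%nat.
have K1 : (1 <= K)%nat by rewrite /K; nia.
exists nu, (fun z => xi (tt, z.2 ^ fact n) + (z.2 ^ K) ^ mu * (y0 + x (tt, z.2 ^ L))); split.
- apply: (nrm_le _ (r / 2 + tau * (Rabs y0 + 1))); last by move: tr; rewrite /=; lra.
  apply: nrm_add.
    have [_ H] := pb_power rho1 nu (fact n) (Rle_trans _ _ _ (nuk _ (fact_ge1 n)) nur).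
    exact: H.
  apply: nrm_mul.
    apply: (nrm_le _ ((nu ^ K) ^ mu)); first by apply: nrm_pow; apply: nrm_pow; apply: ps_var.
    by rewrite -pow_mult; apply: Rle_trans nut; apply: nuk; nia.
  apply: nrm_add; first exact: nrm_const.
  have [_ H] := pb_power tau' nu L (Rle_trans _ _ _ (nuk _ L1) nut').
  exact: H.
- have f0 := fact_ge1 n; rewrite /= (pow_i (fact n)) // (pow_i K) // (pow_i mu) // xi0.
  by ring.
- move=> s Hs.
  have S1 := sk s _ (fact_ge1 n) Hs; have S2 := sk s _ K1 Hs; have S3 := sk s _ L1 Hs.
  split; first lra.
  have [E1 E2] := Ex (s ^ L) (Rle_trans _ _ _ S3 nut').
  have X1 : Rabs (x (tt, s ^ L)) <= 1.
    by apply: nrm_bound Hx _; split => //=; lra.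
  have := Eg (s ^ K) (x (tt, s ^ L)) (Rle_trans _ _ _ S2 nut) X1.
  have EK : s ^ K = (s ^ L) ^ fact n' by rewrite -pow_mult.
  have E3 : g (tt, s ^ K, x (tt, s ^ L)) = 0 by rewrite EK.
  rewrite E3 Rmult_0_r /ft /=.
  have -> : (s ^ K) ^ d = s ^ fact n by rewrite -pow_mult; congr (s ^ _); rewrite /K -EL; ring.
  by [].
Qed.

(** * Taylor expansion along the unperturbed periodic orbit *)

Lemma is_lim_seq_sum_n (u : nat -> nat -> R) (l : nat -> R) n :
  (forall i, is_lim_seq (u i) (l i)) ->
  is_lim_seq (fun K => sum_n (fun i => u i K) n) (sum_n l n).
Proof.
move=> H; elim: n => [|n IH].
  by rewrite sum_O; apply: is_lim_seq_ext (H O) => K; rewrite sum_O.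
rewrite sum_nS; apply: is_lim_seq_ext (is_lim_seq_plus' _ _ _ _ IH (H (S n))) => K.
by rewrite sum_nS.
Qed.

Lemma term_le_sum_n (a : nat -> R) k n : (forall k, 0 <= a k) -> (k <= n)%nat -> a k <= sum_n a n.
Proof.
move=> a0 Hk; apply: Rle_trans (sum_n_le_add a k n a0 Hk).
case: k {Hk} => [|k]; first by rewrite sum_O; lra.
by rewrite sum_nS; move: (sum_n_nonneg a k a0); lra.
Qed.

Definition box (v : nat -> nat -> nat -> R) (I J K : nat) : R :=
  sum_n (fun i => sum_n (fun j => sum_n (fun m => v i j m) K) J) I.

Lemma box_mono v I J K I' J' K' : (forall i j m, 0 <= v i j m) ->
  (I <= I')%nat -> (J <= J')%nat -> (K <= K')%nat -> box v I J K <= box v I' J' K'.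
Proof.
move=> v0 HI HJ HK.
have p1 i j : 0 <= sum_n (fun m => v i j m) K' by apply: sum_n_nonneg.
have p2 i : 0 <= sum_n (fun j => sum_n (fun m => v i j m) K') J' by apply: sum_n_nonneg.
apply: Rle_trans (sum_n_le_add _ I I' p2 HI); apply: sum_n_mono => i.
apply: Rle_trans (sum_n_le_add _ J J' (p1 i) HJ); apply: sum_n_mono => j.
exact: sum_n_le_add.
Qed.

(** Each box lies in a cube, so the limit [C] of the cube sums bounds all boxes, and the three sides
    can go to infinity one after the other. Conversely each cube sum is below the iterated
    series. *)
Lemma cube_sum_nonneg v B : (forall i j m, 0 <= v i j m) -> (forall N, cube_sum v N <= B) ->
  [/\ forall i j, ex_series (v i j), forall i, ex_series (fun j => Series (v i j)),
      bounded_sums (fun i => Series (fun j => Series (v i j))) B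
    & is_lim_seq (cube_sum v) (Series (fun i => Series (fun j => Series (v i j))))].
Proof.
move=> v0 HB.
have [C HC] : ex_finite_lim_seq (cube_sum v).
  by apply: (ex_finite_lim_seq_incr _ B) => // n; apply: (box_mono v n n n (S n) (S n) (S n)) => //; lia.
have cC n : cube_sum v n <= C.
  by apply: (is_lim_seq_incr_compare _ C HC) => k; apply: (box_mono v k k k (S k) (S k) (S k)) => //; lia.
have CB : C <= B := is_lim_seq_le _ _ _ _ HB HC (is_lim_seq_const B).
have bC I J K : box v I J K <= C.
  by apply: Rle_trans (cC (I + J + K)%nat); apply: (box_mono v I J K (I + J + K) (I + J + K) (I + J + K)) => //; lia.
have e1 i j : ex_series (v i j).
  apply: (proj1 (bounded_sums_series _ C (v0 i j) _)) => n.
  apply: Rle_trans (bC i j n).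
  apply: Rle_trans (term_le_sum_n (fun j => sum_n (v i j) n) j j _ (Nat.le_refl j)) _.
    by move=> k; apply: sum_n_nonneg.
  apply: (term_le_sum_n (fun i => sum_n (fun j => sum_n (v i j) n) j) i i _ (Nat.le_refl i)) => k.
  by apply: sum_n_nonneg => l; apply: sum_n_nonneg.
have L1 I J : is_lim_seq (box v I J) (sum_n (fun i => sum_n (fun j => Series (v i j)) J) I).
  apply: is_lim_seq_sum_n => i; apply: is_lim_seq_sum_n => j.
  exact: Series_correct (e1 i j).
have B1 I J : sum_n (fun i => sum_n (fun j => Series (v i j)) J) I <= C.
  exact: is_lim_seq_le _ _ _ _ (bC I J) (L1 I J) (is_lim_seq_const C).
have s1 i j : 0 <= Series (v i j) by apply: Series_nonneg.
have e2 i : ex_series (fun j => Series (v i j)).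
  apply: (proj1 (bounded_sums_series _ C (s1 i) _)) => n; apply: Rle_trans (B1 i n).
  apply: (term_le_sum_n (fun i => sum_n (fun j => Series (v i j)) n) i i _ (Nat.le_refl i)) => k.
  exact: sum_n_nonneg.
have B2 I : sum_n (fun i => Series (fun j => Series (v i j))) I <= C.
  have L2 : is_lim_seq (fun J => sum_n (fun i => sum_n (fun j => Series (v i j)) J) I)
      (sum_n (fun i => Series (fun j => Series (v i j))) I).
    by apply: is_lim_seq_sum_n => i; apply: Series_correct (e2 i).
  exact: is_lim_seq_le _ _ _ _ (B1 I) L2 (is_lim_seq_const C).
have s2 i : 0 <= Series (fun j => Series (v i j)) by apply: Series_nonneg.
have [e3 S3] := bounded_sums_series _ _ s2 B2.
split => //; first by move=> n; move: (B2 n); lra.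
have -> // : Series (fun i => Series (fun j => Series (v i j))) = C.
apply: Rle_antisym => //.
suff cT n : cube_sum v n <= Series (fun i => Series (fun j => Series (v i j))).
  exact: is_lim_seq_le _ _ _ _ cT HC (is_lim_seq_const _).
apply: Rle_trans (sum_n_le_Series _ n s2 e3); apply: sum_n_mono => i.
apply: Rle_trans (sum_n_le_Series _ n (s1 i) (e2 i)); apply: sum_n_mono => j.
exact: sum_n_le_Series.
Qed.

(** Iterated series are the form that [nrm_series] accepts; the signed case follows from
    [u = |u| - (|u| - u)]. *)
Lemma has_sum3_nested u s : has_sum3 u s -> exists B,
  [/\ forall i j, ex_series (fun m => Rabs (u i j m)),
      forall i, ex_series (fun j => Series (fun m => Rabs (u i j m))),
      bounded_sums (fun i => Series (fun j => Series (fun m => Rabs (u i j m)))) B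
    & s = Series (fun i => Series (fun j => Series (u i j)))].
Proof.
move=> [[B HB] Hs]; exists B.
have [A1 A2 A3 A4] := cube_sum_nonneg (fun i j m => Rabs (u i j m)) B (fun i j m => Rabs_pos _) HB.
split => //.
pose w i j m := Rabs (u i j m) - u i j m.
have w0 i j m : 0 <= w i j m by rewrite /w; move: (Rle_abs (u i j m)); lra.
have Ew n : cube_sum w n = cube_sum (fun i j m => Rabs (u i j m)) n - cube_sum u n.
  suff : cube_sum (fun i j m => Rabs (u i j m)) n = cube_sum w n + cube_sum u n by lra.
  rewrite /cube_sum -sum_n_add; apply: sum_n_congr => i.
  rewrite -sum_n_add; apply: sum_n_congr => j.
  by rewrite -sum_n_add; apply: sum_n_congr => m; rewrite /w; ring.
have HBw n : cube_sum w n <= 2 * B.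
  apply: Rle_trans (_ : 2 * cube_sum (fun i j m => Rabs (u i j m)) n <= _); last by move: (HB n); lra.
  rewrite /cube_sum -sum_n_scale; apply: sum_n_mono => i.
  rewrite -sum_n_scale; apply: sum_n_mono => j.
  rewrite -sum_n_scale; apply: sum_n_mono => m.
  by rewrite /w; move: (Rle_abs (- u i j m)); rewrite Rabs_Ropp; lra.
have [B1 B2 B3 B4] := cube_sum_nonneg w (2 * B) w0 HBw.
have L := is_lim_seq_minus' _ _ _ _ A4 B4.
have Es : Series (fun i => Series (fun j => Series (fun m => Rabs (u i j m))))
        - Series (fun i => Series (fun j => Series (w i j))) = s.
  have := is_lim_seq_unique _ _ L; have -> := is_lim_seq_unique _ s (is_lim_seq_ext _ _ _ _ Hs).
    by move=> [].
  by move=> n; rewrite Ew; ring.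
have p1 i : 0 <= Series (fun j => Series (fun m => Rabs (u i j m))).
  apply: Series_nonneg => // j; apply: Series_nonneg => // m; exact: Rabs_pos.
have p2 i : 0 <= Series (fun j => Series (w i j)).
  by apply: Series_nonneg => // j; apply: Series_nonneg.
have [x1 _] := bounded_sums_series _ _ p1 A3.
have [x2 _] := bounded_sums_series _ _ p2 B3.
rewrite -Es -(Series_minus _ _ x1 x2); apply: Series_ext => i.
rewrite -(Series_minus _ _ (A2 i) (B2 i)); apply: Series_ext => j.
rewrite -(Series_minus _ _ (A1 i j) (B1 i j)); apply: Series_ext => m.
by rewrite /w; ring.
Qed.

Definition expansion (phi : R -> R -> R) (r M : R) (c : nat -> nat -> R) : Prop :=
  [/\ 0 < r, forall i j, Rabs (c i j) <= M * (/ r) ^ i * (/ r) ^ j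
    & forall h k, Rabs h < r -> Rabs k < r ->
        is_series (fun i => Series (fun j => c i j * k ^ j) * h ^ i) (phi h k)].

Lemma geometric_dominated (c : nat -> R) M r k : 0 < r -> Rabs k < r ->
  (forall j, Rabs (c j) <= M * (/ r) ^ j) -> ex_series (fun j => c j * k ^ j).
Proof.
move=> r0 Hk H; apply: (ex_series_le _ (fun j => M * (Rabs k / r) ^ j)).
  move=> j; rewrite /norm /= /abs /= Rabs_mult -RPow_abs.
  apply: Rle_trans (Rmult_le_compat_r _ _ _ _ (H j)) _.
    by apply: pow_le; apply: Rabs_pos.
  by rewrite /Rdiv Rpow_mult_distr; apply: Req_le; ring.
apply: (ex_series_scal_l M (fun j => (Rabs k / r) ^ j)); apply: ex_series_geom.
rewrite Rabs_pos_eq.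
  by apply/Rlt_div_l => //; lra.
by apply: Rdiv_le_0_compat => //; apply: Rabs_pos.
Qed.

Lemma expansion_inner phi r M c i k : expansion phi r M c -> Rabs k < r ->
  ex_series (fun j => c i j * k ^ j).
Proof.
move=> [r0 H _] Hk; apply: (geometric_dominated (c i) (M * (/ r) ^ i) r k r0 Hk) => j.
exact: H.
Qed.

Lemma expansion_unique phi phi' delta r M c r' M' c' : 0 < delta ->
  (forall h k, Rabs h < delta -> Rabs k < delta -> phi h k = phi' h k) ->
  expansion phi r M c -> expansion phi' r' M' c' -> forall i j, c i j = c' i j.
Proof.
move=> d0 E H H' i j.
have [r0 _ Hs] := H; have [r0' _ Hs'] := H'.
pose e := Rmin delta (Rmin r r').
have e0 : 0 < e by do 2 apply: Rmin_pos => //.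
have e1 : e <= delta by apply: Rmin_l.
have e2 : e <= r by apply: Rle_trans (Rmin_r _ _) (Rmin_l _ _).
have e3 : e <= r' by apply: Rle_trans (Rmin_r _ _) (Rmin_r _ _).
have inner k : Rabs k < e -> forall i, Series (fun j => c i j * k ^ j) = Series (fun j => c' i j * k ^ j).
  move=> Hk; apply: (sums_to_unique _ _ e (fun h => phi h k) e0) => h Hh.
    by apply: Hs; lra.
  by rewrite E; [apply: Hs'; lra | lra | lra].
apply: (sums_to_unique (c i) (c' i) e (fun k => Series (fun j => c i j * k ^ j)) e0) => k Hk.
  by apply: Series_correct; apply: expansion_inner H _; lra.
by rewrite inner //; apply: Series_correct; apply: expansion_inner H' _; lra.
Qed.

Lemma ps_continuous (r : posreal) f M l : nrm (ps U0 r) f M -> Rabs l < r ->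
  continuous (fun x => f (tt, x)) l.
Proof.
move=> [c [m Hc]] Hl.
have H : sums_to (fun k => c k tt) r (fun x => f (tt, x)) by apply: ps_rep_slice Hc _.
apply/continuity_pt_filterlim.
apply: (continuity_pt_ext_loc (PSeries (fun k => c k tt))).
  have d0 : 0 < r - Rabs l by lra.
  exists (mkposreal _ d0) => y Hy; apply: sums_to_PSeries H _.
  move: Hy; rewrite /ball /= /AbsRing_ball /abs /minus /plus /opp /= => Hy.
  have := Rabs_triang (y + - l) l.
  have -> : y + - l + l = y :> R by ring.
  lra.
by apply: PSeries_continuity; apply: sums_to_CV H Hl.
Qed.

Section FlowExpansion.
Variables (W : R -> Prop) (f : R -> R -> R -> R) (w A0 t0 T : R).
Hypothesis hW : open W.
Hypothesis hf : analytic3_on W f.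
Hypothesis hA0 : W A0.
Hypothesis T0 : 0 < T.
Hypothesis hper : forall x y z, W y -> f (x + w * T) y (z + T) = f x y z.

Let phi t h k := f (w * t + h) (A0 + k) (t + t0).

(** The displacement [t - t1] is carried as one more series variable, innermost: the coefficients in
    [h] and [k] are then power series in it, hence continuous in time, with common [r] and [M] near
    [t1]. *)
Lemma local_expansion t1 : exists (delta r M : R) (d : nat -> nat -> R -> R),
  [/\ 0 < delta, forall i j, continuous (fun t => d i j (t - t1)) t1
    & forall t, Rabs (t - t1) < delta -> expansion (phi t) r M (fun i j => d i j (t - t1))].
Proof.
have [c [q2 [q20 Hc]]] := hf (w * t1) A0 (t1 + t0) hA0.
pose q := q2 / 2; have q0 : 0 < q by rewrite /q; lra.
have qq : Rabs q < q2 by rewrite Rabs_pos_eq /q; lra.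
have [B [B1 B2 B3 _]] := has_sum3_nested _ _ (Hc q q q qq qq qq).
have w1 : 0 < Rabs w + 1 by move: (Rabs_pos w); lra.
have dp : 0 < q / 2 / (Rabs w + 1) by apply: Rdiv_lt_0_compat; lra.
have rp : 0 < q / 2 by lra.
(* The angle moves by [w * (t - t1) + h], so the radii must satisfy [Rabs w * de + r <= q]; [q] is
   half the given radius, so that closed discs of radius [q] are allowed. *)
pose de := mkposreal _ dp; pose r := mkposreal _ rp.
have deq : Rabs w * de + r <= q.
  have : (Rabs w + 1) * de = q / 2 by rewrite /de /=; field; lra.
  by move: (cond_pos de); rewrite /=; lra.
have de1 : de <= q.
  have : (Rabs w + 1) * de = q / 2 by rewrite /de /=; field; lra.
  by move: (cond_pos de) (Rabs_pos w) => H1 H2 H3; nra.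
pose A1 := ps U0 de; pose A2 := ps A1 r; pose A3 := ps A2 r.
pose l (z : ((unit * R) * R) * R) := z.1.1.2.
pose u (z : ((unit * R) * R) * R) := w * z.1.1.2 + z.2.
have Hl : nrm A3 l q.
  by apply: (nrm_le _ de) => //; apply: (ps_base A2 r (fun z => z.1.2)); apply: (ps_base A1 r (fun z => z.2)); apply: ps_var.
have Hk : nrm A3 (fun z => z.1.2) q.
  by apply: (nrm_le _ r); [apply: (ps_base A2 r (fun z => z.2)); apply: ps_var | rewrite /=; lra].
have Hu : nrm A3 u q.
  apply: nrm_le deq; apply: nrm_add; last exact: ps_var.
  by apply: nrm_scal; apply: (ps_base A2 r (fun z => z.1.2)); apply: (ps_base A1 r (fun z => z.2)); apply: ps_var.
pose Ff z := f (w * t1 + u z) (A0 + z.1.2) (t1 + t0 + l z).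
have small v z : nrm A3 v q -> dom A3 z -> Rabs (v z) < q2.
  by move=> Hv Hz; apply: Rle_lt_trans (nrm_bound A3 Hv Hz) _; rewrite /q; lra.
have HF : nrm A3 Ff B.
  apply: (nrm_ext A3 (fun z => Series (fun i => Series (fun j => Series (fun m => c i j m * u z ^ i * z.1.2 ^ j * l z ^ m))))).
    move=> z Hz.
    have [_ [_ _ _ E]] := has_sum3_nested _ _ (Hc _ _ _ (small _ z Hu Hz) (small _ z Hk Hz) (small _ z Hl Hz)).
    by rewrite /Ff E.
  apply: nrm_series B3 => i.
  apply: (nrm_series A3 (m := fun j => Series (fun m => Rabs (c i j m * q ^ i * q ^ j * q ^ m)))); last first.
    by move=> n; apply: sum_n_le_Series => // j; apply: Series_nonneg => // m; exact: Rabs_pos.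
  move=> j.
  apply: (nrm_series A3 (m := fun m => Rabs (c i j m * q ^ i * q ^ j * q ^ m))); last first.
    by move=> n; apply: sum_n_le_Series => // m; exact: Rabs_pos.
  move=> m.
  have -> : Rabs (c i j m * q ^ i * q ^ j * q ^ m) = Rabs (c i j m) * q ^ i * q ^ j * q ^ m.
    rewrite !Rabs_mult (Rabs_pos_eq (q ^ i)) ?(Rabs_pos_eq (q ^ j)) ?(Rabs_pos_eq (q ^ m)) //;
      by apply: pow_le; lra.
  by do ! apply: nrm_mul; [exact: nrm_const | exact: nrm_pow | exact: nrm_pow | exact: nrm_pow].
have [ci [mi Hci]] := HF; have [Ci1 Ci2 Ci3] := Hci.
have [cij Hcij'] := choice _ Ci1; have [mij Hcij] := choice _ Hcij'.
have r0 := cond_pos r.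
have bnd i j s : Rabs s <= de -> Rabs (cij i j (tt, s)) <= B * (/ r) ^ i * (/ r) ^ j.
  move=> Hs; have [C1 C2 _] := Hcij i.
  apply: Rle_trans (nrm_bound A1 (C1 j) (_ : dom A1 (tt, s))) _; first by [].
  have E1 : mij i j * r ^ j <= mi i.
    apply: Rle_trans (C2 j).
    apply: (term_le_sum_n (fun j => mij i j * r ^ j) j j _ (Nat.le_refl j)) => k.
    exact: (ps_m_ge0 A1 r (cij i)).
  have E2 : mi i * r ^ i <= B.
    apply: Rle_trans (Ci2 i).
    apply: (term_le_sum_n (fun i => mi i * r ^ i) i i _ (Nat.le_refl i)) => k.
    exact: (ps_m_ge0 A2 r ci).
  have pi : 0 < r ^ i by apply: pow_lt.
  have pj : 0 < r ^ j by apply: pow_lt.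
  rewrite !pow_inv.
  apply: (Rmult_le_reg_r (r ^ j)) => //; apply: Rle_trans E1 _.
  apply: (Rmult_le_reg_r (r ^ i)) => //; apply: Rle_trans E2 _.
  by apply: Req_le; field; lra.
exists de, r, B, (fun i j s => cij i j (tt, s)); split.
- exact: cond_pos.
- move=> i j; have [C1 _ _] := Hcij i.
  apply: (continuous_comp (fun t => t - t1) (fun s => cij i j (tt, s))).
    apply: continuous_minus; [exact: continuous_id | exact: continuous_const].
  rewrite Rminus_diag; apply: ps_continuous (C1 j) _.
  by rewrite Rabs_R0; exact: cond_pos.
- move=> t Ht; split => //; first by move=> i j; apply: bnd; lra.
  move=> h k Hh Hk'.
  have D2 : ps_dom A1 r ((tt, t - t1), k) by split; [split; [| exact: Rlt_le Ht] | exact: Rlt_le Hk'].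
  have D3 : ps_dom A2 r (((tt, t - t1), k), h) by split => //; exact: Rlt_le Hh.
  have := Ci3 _ D3; rewrite /Ff /u /l /phi /=.
  have -> : w * t1 + (w * (t - t1) + h) = w * t + h by ring.
  have -> : t1 + t0 + (t - t1) = t + t0 by ring.
  apply: is_series_ext => i; have [_ _ C3] := Hcij i.
  by rewrite -(is_series_unique _ _ (C3 _ D2)).
Qed.

Lemma W_radius : exists dW : posreal, forall k, Rabs k < dW -> W (A0 + k).
Proof.
have [d Hd] := hW A0 hA0; exists d => k Hk; apply: Hd.
rewrite /ball /= /AbsRing_ball /abs /minus /plus /opp /=.
by have -> : A0 + k + - A0 = k by ring.
Qed.

Lemma phi_shift (dW : posreal) : (forall k, Rabs k < dW -> W (A0 + k)) ->
  forall (n : Z) t h k, Rabs k < dW -> phi (t + IZR n * T) h k = phi t h k.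
Proof.
move=> HW n t h k Hk.
apply: (periodic_IZR T (fun t => phi t h k)) => s; rewrite /phi.
have -> : w * (s + T) + h = w * s + h + w * T by ring.
have -> : s + T + t0 = s + t0 + T by ring.
by apply: hper; apply: HW.
Qed.

(** The coefficients [C t] are chosen separately at each time. Their uniqueness makes them
    continuous, by comparison with the local expansions, and periodic; compactness of [[0, T]] gives
    a radius valid for all times. *)
Theorem flow_expansion : exists (r : posreal) M,
  nrm (ps (ps (CT T) r) r) (fun z => f (w * z.1.1 + z.2) (A0 + z.1.2) (z.1.1 + t0)) M.
Proof.
have [dW HW] := W_radius.
have ex t : exists c, exists r M, expansion (phi t) r M c.
  have [de [r [M [d [d0 _ H]]]]] := local_expansion t.
  exists (fun i j => d i j (t - t)), r, M; apply: H.
  by rewrite Rminus_diag Rabs_R0.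
have [C HC] := choice _ ex.
have uniq t r M c : expansion (phi t) r M c -> forall i j, C t i j = c i j.
  move=> H; have [r' [M' H']] := HC t.
  exact: (expansion_unique _ _ 1 _ _ _ _ _ _ Rlt_0_1 (fun h k _ _ => erefl) H' H).
have Cper t i j : C (t + T) i j = C t i j.
  have [r [M H]] := HC t; have [r' [M' H']] := HC (t + T).
  apply: (expansion_unique _ _ dW _ _ _ _ _ _ (cond_pos dW) _ H' H) => h k _ Hk.
  by rewrite -(phi_shift dW HW 1 t h k Hk) Rmult_1_l.
have Ccont i j t : continuous (fun t => C t i j) t.
  have [de [r [M [d [d0 Hd H]]]]] := local_expansion t.
  apply: (continuous_ext_loc _ (fun s => d i j (s - t))); last exact: Hd.
  exists (mkposreal de d0) => s; rewrite /ball /= /AbsRing_ball /abs /minus /plus /opp /= => Hs.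
  by rewrite (uniq s r M (fun i j => d i j (s - t))) //; apply: H.
(* [compactness_value_1d] makes a single positive number uniform, so [de] encodes the size of the
   neighbourhood, a lower bound on [r] and, through [/ de], an upper bound on [M]. *)
have loc t : exists de : posreal, forall s, Rabs (s - t) < de ->
    exists r M, [/\ de <= r, M <= / de & expansion (phi s) r M (C s)].
  have [de [r [M [d [d0 _ H]]]]] := local_expansion t.
  have r0 : 0 < r by have [] := H t; rewrite // Rminus_diag Rabs_R0.
  have m0 : 0 < / (Rabs M + 1) by apply: Rinv_0_lt_compat; move: (Rabs_pos M); lra.
  have p : 0 < Rmin de (Rmin r (/ (Rabs M + 1))) by do 2 apply: Rmin_pos => //.
  exists (mkposreal _ p) => s /= Hs; exists r, M.
  have Hs' : Rabs (s - t) < de by apply: Rlt_le_trans Hs (Rmin_l _ _).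
  split.
  - by apply: Rle_trans (Rmin_r _ _) (Rmin_l _ _).
  - apply: Rle_trans (_ : Rabs M + 1 <= _); first by move: (Rle_abs M); lra.
    rewrite -{1}[Rabs M + 1]Rinv_inv; apply: Rinv_le_contravar => //.
    by apply: Rle_trans (Rmin_r _ _) (Rmin_r _ _).
  - have -> : C s = (fun i j => d i j (s - t)); last exact: H.
    apply: functional_extensionality => i; apply: functional_extensionality => j.
    exact: (uniq s r M (fun i j => d i j (s - t)) (H s Hs') i j).
have [delta Hdelta] := choice _ loc.
have [d Hd] := compactness_value_1d 0 T delta.
have d0 := cond_pos d.
have onK s : 0 <= s <= T -> (forall i j, Rabs (C s i j) <= / d * (/ d) ^ i * (/ d) ^ j) /\
    forall h k, Rabs h < d -> Rabs k < d ->
        is_series (fun i => Series (fun j => C s i j * k ^ j) * h ^ i) (phi s h k).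
  move=> /Hd /NNPP [t [_ [Hst Hdt]]].
  have [r [M [Hr HM [r0 H1 H2]]]] := Hdelta t s Hst.
  have dr : d <= r by lra.
  split; last by move=> h k Hh Hk; apply: H2; lra.
  move=> i j; apply: Rle_trans (H1 i j) _.
  have Ir : 0 <= / r <= / d by split; [apply: Rlt_le; apply: Rinv_0_lt_compat | apply: Rinv_le_contravar].
  have Md : M <= / d by apply: Rle_trans HM _; apply: Rinv_le_contravar.
  have Id : 0 < / d by apply: Rinv_0_lt_compat.
  have pi : 0 <= (/ r) ^ i <= (/ d) ^ i by split; [apply: pow_le | apply: pow_incr]; lra.
  have pj : 0 <= (/ r) ^ j <= (/ d) ^ j by split; [apply: pow_le | apply: pow_incr]; lra.
  apply: Rle_trans (_ : / d * (/ r) ^ i * (/ r) ^ j <= _).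
    by apply: Rmult_le_compat_r; [lra | apply: Rmult_le_compat_r; lra].
  apply: Rmult_le_compat; try lra; first by apply: Rmult_le_pos; lra.
  by apply: Rmult_le_compat_l; lra.
have CperZ n t : C (t + IZR n * T) = C t.
  apply: functional_extensionality => i; apply: functional_extensionality => j.
  by rewrite (periodic_IZR T (fun t => C t i j)).
have Cb s i j : Rabs (C s i j) <= / d * (/ d) ^ i * (/ d) ^ j.
  have [n Hn] := reduce_mod T T0 s; have [H _] := onK _ Hn.
  by rewrite -(CperZ n s); apply: H.
(* At radius at most [d / 2] the coefficient bounds sum as geometric series of ratio [/ 2], twice,
   which gives the norm [4 * / d]. *)
have p : 0 < Rmin d dW / 2 by apply: Rdiv_lt_0_compat; [apply: Rmin_pos => //; exact: cond_pos | lra].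
pose r := mkposreal _ p.
have rd : r <= d / 2 by rewrite /r /=; move: (Rmin_l d dW); lra.
have rW : r < dW by rewrite /r /=; move: (Rmin_r d dW) (cond_pos dW); lra.
have rp := cond_pos r.
have Cs s h k : Rabs h <= r -> Rabs k <= r ->
   is_series (fun i => Series (fun j => C s i j * k ^ j) * h ^ i) (phi s h k).
  move=> Hh Hk; have [n Hn] := reduce_mod T T0 s; have [_ H] := onK _ Hn.
  by rewrite -(CperZ n s) -(phi_shift dW HW n s h k); [apply: H; lra | lra].
have Id : 0 < / d by apply: Rinv_0_lt_compat.
have geo i : (/ d) ^ i * r ^ i <= (/ 2) ^ i.
  rewrite -Rpow_mult_distr; apply: pow_incr; split; first by apply: Rmult_le_pos; lra.
  apply: (Rmult_le_reg_l d) => //; rewrite -Rmult_assoc Rinv_r; lra.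
have half n : sum_n (fun k => (/ 2) ^ k) n <= 2.
  have h0 : 0 <= (/ 2) ^ n by apply: pow_le; lra.
  by rewrite sum_geom_half; lra.
exists r, (4 * / d).
exists (fun i z => Series (fun j => C z.1 i j * z.2 ^ j)), (fun i => / d * (/ d) ^ i * 2); split.
- move=> i.
  exists (fun j t => C t i j), (fun j => / d * (/ d) ^ i * (/ d) ^ j); split.
  + by move=> j; split.
  + move=> n; apply: Rle_trans (_ : sum_n (fun j => (/ d * (/ d) ^ i) * (/ 2) ^ j) n <= _).
      apply: sum_n_mono => j; rewrite Rmult_assoc; apply: Rmult_le_compat_l; last exact: geo.
      by apply: Rmult_le_pos; [lra | apply: pow_le; lra].
    rewrite sum_n_scale; apply: Rmult_le_compat_l; last exact: half.
    by apply: Rmult_le_pos; [lra | apply: pow_le; lra].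
  + move=> [t k] [_ Hk]; have {}Hk : Rabs k <= r := Hk; apply: Series_correct.
    apply: (geometric_dominated (C t i) (/ d * (/ d) ^ i) d) => //.
    by apply: Rle_lt_trans Hk _; lra.
- move=> n; apply: Rle_trans (_ : sum_n (fun j => (2 * / d) * (/ 2) ^ j) n <= _).
    apply: sum_n_mono => i.
    have -> : / d * (/ d) ^ i * 2 * r ^ i = 2 * / d * ((/ d) ^ i * r ^ i) by ring.
    apply: Rmult_le_compat_l; last exact: geo.
    by apply: Rmult_le_pos; [lra | exact: Rlt_le].
  rewrite sum_n_scale; apply: Rle_trans (Rmult_le_compat_l _ _ _ _ (half n)) _.
    by apply: Rmult_le_pos; [lra | exact: Rlt_le].
  lra.
- move=> [[t k] h] [[_ /= Hk] /= Hh]; exact: Cs.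
Qed.

End FlowExpansion.

(** * Lyapunov-Schmidt reduction *)

Section ProductAlgebra.
Context {X : Type} (A : falg X).

(** Pairs under the maximum norm, coded as one function with a boolean tag, so that
    [contraction_fixpoint] applies to a system: below, [true] is [a] and [false] is [b]. *)
Definition prod2 : falg (X * bool).
Proof.
apply: (Falg (X * bool) (fun z => dom A z.1)
  (fun f M => nrm A (fun x => f (x, true)) M /\ nrm A (fun x => f (x, false)) M)).
- move=> f g M H [H1 H2]; split.
    by apply: nrm_ext H1 => x Hx; apply: H.
  by apply: nrm_ext H2 => x Hx; apply: H.
- by move=> f M [x []] [H1 H2] Hx; [apply: nrm_bound H1 Hx | apply: nrm_bound H2 Hx].
- by move=> f M [H1 _]; apply: nrm_ge0 H1.
- by move=> f M M' [H1 H2] H; split; [apply: nrm_le H1 H | apply: nrm_le H2 H].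
- by move=> c; split; apply: nrm_const.
- by move=> f g M M' [H1 H2] [H1' H2']; split; apply: nrm_add.
- by move=> f g M M' [H1 H2] [H1' H2']; split; apply: nrm_mul.
- move=> f m S H HS; split.
    by apply: nrm_series HS => k; case: (H k).
  by apply: nrm_series HS => k; case: (H k).
Defined.
End ProductAlgebra.

Lemma omega_expansion (W : R -> Prop) omega A0 : analytic1_on W omega -> W A0 ->
  exists (r : posreal) M c m,
    ps_rep U0 r (fun z => omega (A0 + z.2) - omega A0 - Derive omega A0 * z.2) M c m /\
    forall k x, (k < 2)%nat -> c k x = 0.
Proof.
move=> H HA; have [a [r0 [r0p Ha]]] := H A0 HA.
have rp : 0 < r0 / 2 by lra.
pose r := mkposreal _ rp.
have st : sums_to a r0 (fun h => omega (A0 + h)).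
  by move=> x Hx; apply: (proj1 (is_pseries_R _ _ _)); apply: Ha.
have Hr : Rabs r < r0 by rewrite Rabs_pos_eq /=; lra.
have ea : ex_series (fun k => Rabs (a k) * r ^ k).
  apply: ex_series_ext (CV_disk_inside a r (sums_to_CV _ _ _ _ st Hr)) => k.
  by rewrite Rabs_mult (Rabs_pos_eq (r ^ k)) //; apply: pow_le; rewrite /=; lra.
have Hrep : ps_rep U0 r (fun z => omega (A0 + z.2)) (Series (fun k => Rabs (a k) * r ^ k))
    (fun k _ => a k) (fun k => Rabs (a k)).
  split.
  - by move=> k; apply: Rle_refl.
  - move=> n; apply: sum_n_le_Series ea => k.
    by apply: Rmult_le_pos; [exact: Rabs_pos | apply: pow_le; rewrite /=; lra].
  - by move=> [[] h] [_ Hh]; apply: st; apply: Rle_lt_trans Hh _; rewrite /=; lra.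
have [c' [m' [[H1 H2 H3] Hc]]] := ps_drop2 _ _ _ _ _ _ Hrep.
have a0 : a O = omega A0.
  by rewrite (ps_rep_0 U0 r _ _ _ _ tt Hrep) /= ?Rplus_0_r.
have a1 : a 1%nat = Derive omega A0.
  have := sums_to_Derive_n a r0 _ 1 r0p st; rewrite /= Rmult_1_r => <-.
  have := Derive_n_comp_trans omega 1 0 A0; rewrite /= Rplus_0_l => E.
  transitivity (Derive (fun x => omega x) A0); last by apply: Derive_ext.
  by rewrite -E; apply: Derive_ext => x; rewrite Rplus_comm.
exists r, (Series (fun k => Rabs (a k) * r ^ k)), c', m'; split => //.
split => // z Hz; have := H3 z Hz.
by rewrite a0 a1.
Qed.

Section LyapunovSchmidt.
Variables (T w1 M M2 : R) (r : posreal) (Ft Gt : (R * R) * R -> R) (O2 : unit * R -> R).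
Variables (oc : nat -> unit -> R) (om : nat -> R).
Hypothesis T0 : 0 < T.
Hypothesis w10 : w1 <> 0.
Hypothesis HF : nrm (ps (ps (CT T) r) r) Ft M.
Hypothesis HG : nrm (ps (ps (CT T) r) r) Gt M.
Hypothesis HO : ps_rep U0 r O2 M2 oc om.
Hypothesis HO0 : forall k x, (k < 2)%nat -> oc k x = 0.

(** The parameter [c] is the mean of [a], and the equation for [b] holds up to [e] times a mean,
    whose zeros are sought afterwards. The terms in [Ft] and [Gt] contract because [e] is small, the
    term [O2] because its order is two and [b] is small. *)
Lemma lyapunov_schmidt : exists (rho rc : posreal) (a b : (R * R) * R -> R),
  [/\ nrm (ps (ps (CT T) rho) rc) a r, nrm (ps (ps (CT T) rho) rc) b r,
      nrm (ps (ps U0 rho) rc)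
        (fun z => mean T (fun t => Gt ((t, b ((t, z.1.2), z.2)), a ((t, z.1.2), z.2))) 0) M
    & forall e c, Rabs e <= rho -> Rabs c <= rc ->
      let al t := a ((t, e), c) in let be t := b ((t, e), c) in
      [/\ forall t, is_derive al t (w1 * be t + O2 (tt, be t) + e * Ft ((t, be t), al t)),
          forall t, is_derive be t
            (e * (Gt ((t, be t), al t) - mean T (fun t => Gt ((t, be t), al t)) t))
        & e = 0 -> forall t, al t = c /\ be t = 0]].
Proof.
have r0 := cond_pos r.
have M0 : 0 <= M := nrm_ge0 _ HF.
have M20 : 0 <= M2 := nrm_ge0 _ (ps_rep_nrm _ _ _ _ _ _ HO).
have w1a : 0 < Rabs w1 by apply: Rabs_pos_lt.
have w1i : 0 < / Rabs w1 by apply: Rinv_0_lt_compat.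
pose kap := 4 * T; have kap0 : 0 < kap by rewrite /kap; lra.
(* [O2] has no factor [eps]: its Lipschitz constant [LO] on radius [lam * r] must itself be small
   against the norms of [K] and [/ w1 * P]. *)
have [lam [Hl Hl']] : exists lam, 0 < lam <= 1 /\ lam * (M2 / r * (kap + / Rabs w1)) <= / 4.
  apply: exists_small; last lra.
  by apply: Rmult_le_pos; [apply: Rdiv_le_0_compat | lra].
pose U := scaled lam (proj1 Hl) r.
have Up := cond_pos U.
have HO2 : nrm (ps U0 U) O2 (lam ^ 2 * M2).
  apply: (ps_shrink_order U0 r U O2 M2 oc om lam 2 HO) => //; last by lra.
  by move=> k x Hk _; apply: HO0.
pose R0 := U / 2; have R00 : 0 < R0 by rewrite /R0; lra.
have R0r : R0 <= r / 2 by rewrite /R0 /=; nra.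
(* Substituting [b] and [a] costs [1 / r] each. *)
pose LF := M * (2 / r).
have LF0 : 0 <= LF by apply: Rmult_le_pos => //; apply: Rlt_le; apply: Rdiv_lt_0_compat; lra.
pose LO := lam * M2 / r.
have LO0 : 0 <= LO by apply: Rdiv_le_0_compat => //; apply: Rmult_le_pos; lra.
have LOk : LO * (kap + / Rabs w1) <= / 4.
  by apply: Rle_trans Hl'; apply: Req_le; rewrite /LO; field; lra.
(* Dominates every coefficient of [eps] in the size and Lipschitz estimates of [Phia] and [Phib]. *)
pose C := (M + LF) * (kap + / Rabs w1 + kap * (Rabs w1 * kap + 1)).
have C0 : 0 <= C.
  apply: Rmult_le_pos; first lra.
  have : 0 < kap * (Rabs w1 * kap + 1) by apply: Rmult_lt_0_compat => //; nra.
  lra.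
have [rh [Hrh Hrh']] : exists rh, 0 < rh <= 1 /\ rh * C <= Rmin (/ 4) (R0 / 4).
  by apply: exists_small => //; apply: Rmin_pos; lra.
pose rho := mkposreal rh (proj1 Hrh).
(* [Phi 0] must have norm at most [R0 / 2]: half of this is left to [c], half to the terms with
   [eps]. *)
have rcp : 0 < R0 / 4 by lra.
pose rc := mkposreal _ rcp.
have rC4 : rh * C <= / 4 by move: (Rmin_l (/ 4) (R0 / 4)); lra.
have rCR : rh * C <= R0 / 4 by move: (Rmin_r (/ 4) (R0 / 4)); lra.
pose A := ps (ps (CT T) rho) rc.
pose P := lift (lift (mean T)); pose K := lift (lift (prim0 T)).
have LP : lin_op A P 1 by do 2 apply: lin_op_lift; exact: mean_op.
have LK : lin_op A K kap by do 2 apply: lin_op_lift; exact: prim0_op.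
have [_ HP _] := LP; have [_ HK _] := LK.
pose eps (z : (R * R) * R) := z.1.2.
have Heps : nrm A eps rh by apply: (ps_base _ rc (fun z => z.2)); apply: (ps_var (CT T) rho).
have Hcc : nrm A (fun z => z.2) (R0 / 4) by apply: (ps_var _ rc).
have Pbt : pb (CT T) A (fun z => z.1.1).
  exact: pb_comp (pb_fst (CT T) rho) (pb_fst (ps (CT T) rho) rc).
pose sub (H : (R * R) * R -> R) (u : ((R * R) * R) * bool -> R) z := H ((z.1.1, u (z, false)), u (z, true)).
pose sO (u : ((R * R) * R) * bool -> R) (z : (R * R) * R) := O2 (tt, u (z, false)).
(* [b = eps K G - (1/w1) mean (O2 + eps F)] makes the mean of [w1 b + O2 + eps F] vanish,
   so that [a' = w1 b + O2 + eps F]; only [b' = eps G] is lost, up to [eps] times the mean of [G]. *)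
pose Phib u z := eps z * K (sub Gt u) z - / w1 * P (fun z => sO u z + eps z * sub Ft u z) z.
pose Phia u z := z.2 + K (fun z => w1 * (eps z * K (sub Gt u) z) + (sO u z + eps z * sub Ft u z)) z.
pose Phi u (y : ((R * R) * R) * bool) := if y.2 then Phia u y.1 else Phib u y.1.
have nsub H u : nrm (ps (ps (CT T) r) r) H M -> nrm (prod2 A) u R0 -> nrm A (sub H u) M.
  move=> HH [u1 u2].
  have [_ Q] : pb (ps (ps (CT T) r) r) A (fun z => ((z.1.1, u (z, false)), u (z, true))).
    apply: pb_ps; last by apply: nrm_le u1 _; lra.
    by apply: pb_ps => //; apply: nrm_le u2 _; lra.
  exact: Q.
have nO u : nrm (prod2 A) u R0 -> nrm A (sO u) (lam ^ 2 * M2).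
  move=> [_ u2]; have [_ Q] : pb (ps U0 U) A (fun z => (tt, u (z, false))).
    by apply: pb_ps; [exact: pb_const | apply: nrm_le u2 _; rewrite /R0; lra].
  exact: Q.
have lsub H u v d : nrm (ps (ps (CT T) r) r) H M -> nrm (prod2 A) u R0 -> nrm (prod2 A) v R0 ->
    nrm (prod2 A) (fun y => u y - v y) d -> nrm A (fun z => sub H u z - sub H v z) (LF * d).
  move=> HH [u1 u2] [v1 v2] [d1 d2].
  have q1 := lip_ps _ _ r _ _ _ _ _ _ (lip_refl _ _ _ Pbt) (nrm_le _ _ u2 R0r) (nrm_le _ _ v2 R0r) d2.
  have [_ _ _ q2] := lip_ps _ _ r _ _ _ _ _ _ q1 (nrm_le _ _ u1 R0r) (nrm_le _ _ v1 R0r) d1.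
  apply: nrm_le (q2 _ _ HH) _; apply: Req_le; rewrite /LF; field; lra.
have lO u v d : nrm (prod2 A) u R0 -> nrm (prod2 A) v R0 ->
    nrm (prod2 A) (fun y => u y - v y) d -> nrm A (fun z => sO u z - sO v z) (LO * d).
  move=> [u1 u2] [v1 v2] [d1 d2].
  have [_ _ _ q] := lip_ps _ _ U _ _ _ _ _ _ (lip_refl _ _ _ (pb_const A)) u2 v2 d2.
  apply: nrm_le (q _ _ HO2) _; apply: Req_le; rewrite /LO /=; field; lra.
have O20 : O2 (tt, 0) = 0 by rewrite -(ps_rep_0 _ _ _ _ _ _ tt HO) // HO0 //; lia.
have nk H u : nrm (ps (ps (CT T) r) r) H M -> nrm (prod2 A) u R0 -> nrm A (K (sub H u)) (kap * M).
  by move=> HH Hu; apply: HK; apply: nsub.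
have zero0 : nrm (prod2 A) (fun=> 0) R0.
  by split; apply: (nrm_le A 0); try exact: nrm_zero; lra.
have [u [Hu Eu]] : exists u, nrm (prod2 A) u R0 /\ forall y, dom (prod2 A) y -> Phi u y = u y.
  apply: contraction_fixpoint.
    have n1 : nrm A (fun z => sO (fun=> 0) z + eps z * sub Ft (fun=> 0) z) (0 + rh * M).
      apply: nrm_add; first by apply: nrm_ext (nrm_zero A) => z _; rewrite /sO O20.
      by apply: nrm_mul => //; apply: nsub.
    have n2 : nrm A (fun z => eps z * K (sub Gt (fun=> 0)) z) (rh * (kap * M)).
      by apply: nrm_mul => //; apply: nk.
    split; rewrite /Phi /=.
      apply: (nrm_le A (R0 / 4 + kap * (Rabs w1 * (rh * (kap * M)) + (0 + rh * M)))).
        apply: nrm_add => //; apply: HK; apply: nrm_add => //; exact: nrm_scal.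
      have E : kap * (Rabs w1 * (rh * (kap * M)) + (0 + rh * M)) = rh * (M * (kap * (Rabs w1 * kap + 1))) by ring.
      have : M * (kap * (Rabs w1 * kap + 1)) <= C.
        have q1 : 0 < kap * (Rabs w1 * kap + 1) by apply: Rmult_lt_0_compat => //; nra.
        by apply: Rmult_le_compat; lra.
      by move=> H; rewrite E; have [Hrh0 _] := Hrh; nra.
    apply: (nrm_le A (rh * (kap * M) + Rabs (/ w1) * (1 * (0 + rh * M)))).
      by apply: nrm_sub => //; apply: nrm_scal; apply: HP.
    rewrite Rabs_inv.
    have -> : rh * (kap * M) + / Rabs w1 * (1 * (0 + rh * M)) = rh * (M * (kap + / Rabs w1)) by ring.
    have : M * (kap + / Rabs w1) <= C.
      have q1 : 0 < kap * (Rabs w1 * kap + 1) by apply: Rmult_lt_0_compat => //; nra.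
      by apply: Rmult_le_compat; lra.
    by move=> H; have [Hrh0 _] := Hrh; nra.
  move=> u v d Hu Hv Hd.
  have d0 : 0 <= d := nrm_ge0 _ Hd.
  have mF x Hx := nrm_mul A Heps (nsub Ft x HF Hx).
  have m1 x Hx := nrm_add A (nO x Hx) (mF x Hx).
  have m2 x Hx := nrm_mul A Heps (nk Gt x HG Hx).
  have m3 x Hx := nrm_add A (nrm_scal A w1 _ _ (m2 x Hx)) (m1 x Hx).
  have dG : nrm A (fun z => eps z * K (sub Gt u) z - eps z * K (sub Gt v) z) (rh * (kap * (LF * d))).
    apply: nrm_ext (nrm_mul A Heps (HK _ _ (lsub Gt u v d HG Hu Hv Hd))) => z Hz.
    by rewrite (lin_op_sub A K kap LK _ _ _ _ z (nsub Gt u HG Hu) (nsub Gt v HG Hv) Hz); ring.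
  have dF : nrm A (fun z => (sO u z + eps z * sub Ft u z) - (sO v z + eps z * sub Ft v z)) (LO * d + rh * (LF * d)).
    apply: nrm_ext (nrm_add A (lO u v d Hu Hv Hd) (nrm_mul A Heps (lsub Ft u v d HF Hu Hv Hd))) => z _.
    by ring.
  have CB1 : rh * (kap * LF) + / Rabs w1 * (rh * LF) <= / 4.
    have -> : rh * (kap * LF) + / Rabs w1 * (rh * LF) = rh * (LF * (kap + / Rabs w1)) by ring.
    have H : LF * (kap + / Rabs w1) <= C.
      have q1 : 0 < kap * (Rabs w1 * kap + 1) by apply: Rmult_lt_0_compat => //; nra.
      by apply: Rmult_le_compat; lra.
    by have [Hrh0 _] := Hrh; nra.
  have CB2 : kap * (Rabs w1 * (rh * (kap * LF)) + rh * LF) <= / 4.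
    have -> : kap * (Rabs w1 * (rh * (kap * LF)) + rh * LF) = rh * (LF * (kap * (Rabs w1 * kap + 1))) by ring.
    have H : LF * (kap * (Rabs w1 * kap + 1)) <= C.
      have q1 : 0 < kap * (Rabs w1 * kap + 1) by apply: Rmult_lt_0_compat => //; nra.
      by apply: Rmult_le_compat; lra.
    by have [Hrh0 _] := Hrh; nra.
  have LO1 : kap * LO <= / 4 by nra.
  have LO2 : / Rabs w1 * LO <= / 4 by nra.
  split; rewrite /Phi /=.
    apply: (nrm_le A (kap * (Rabs w1 * (rh * (kap * (LF * d))) + (LO * d + rh * (LF * d))))).
      apply: nrm_ext (HK _ _ (nrm_add A (nrm_scal A w1 _ _ dG) dF)) => z Hz.
      have := lin_op_sub A K kap LK _ _ _ _ z (m3 u Hu) (m3 v Hv) Hz.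
      rewrite /Phia => E; transitivity (K (fun z => w1 * (eps z * K (sub Gt u) z) + (sO u z + eps z * sub Ft u z)) z
         - K (fun z => w1 * (eps z * K (sub Gt v) z) + (sO v z + eps z * sub Ft v z)) z); last by ring.
      rewrite -E; congr (K _ z); apply: functional_extensionality => y; ring.
    have -> : kap * (Rabs w1 * (rh * (kap * (LF * d))) + (LO * d + rh * (LF * d)))
       = (kap * (Rabs w1 * (rh * (kap * LF)) + rh * LF) + kap * LO) * d by ring.
    have -> : d / 2 = / 2 * d by field.
    by apply: Rmult_le_compat_r => //; lra.
  apply: (nrm_le A (rh * (kap * (LF * d)) + Rabs (/ w1) * (1 * (LO * d + rh * (LF * d))))).
    apply: nrm_ext (nrm_sub A _ _ _ _ dG (nrm_scal A (/ w1) _ _ (HP _ _ dF))) => z Hz.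
    rewrite (lin_op_sub A P 1 LP _ _ _ _ z (m1 u Hu) (m1 v Hv) Hz) /Phib.
    by ring.
  rewrite Rabs_inv.
  have -> : rh * (kap * (LF * d)) + / Rabs w1 * (1 * (LO * d + rh * (LF * d)))
     = (rh * (kap * LF) + / Rabs w1 * (rh * LF) + / Rabs w1 * LO) * d by ring.
  have -> : d / 2 = / 2 * d by field.
  by apply: Rmult_le_compat_r => //; lra.
have R0rr : R0 <= r by lra.
have [Hu1 Hu2] := Hu.
exists rho, rc, (fun z => u (z, true)), (fun z => u (z, false)); split.
- exact: nrm_le Hu1 R0rr.
- exact: nrm_le Hu2 R0rr.
(* The mean does not depend on time, so evaluating the time variable at [0] loses nothing and leaves
   a power series in [(eps, c)] with scalar coefficients. *)
- have HPG := HP _ _ (nsub Gt u HG Hu); rewrite Rmult_1_l in HPG.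
  have [_ Q] := pb_base _ _ rc _ (pb_base _ _ rho _ (pb_point (CT T) 0 I)).
  exact: Q _ _ HPG.
- move=> e c He Hc al be.
  have Dz t : dom A ((t, e), c) by [].
  have sl f N : nrm A f N -> nrm (CT T) (fun t => f ((t, e), c)) N.
    by move=> Hf; apply: (ps_slice (CT T) rho (fun z => f (z, c))) He; apply: (ps_slice (ps (CT T) rho) rc).
  pose g t := Gt ((t, be t), al t); pose f t := Ft ((t, be t), al t).
  pose o t := O2 (tt, be t).
  have Ng : nrm (CT T) g M := sl _ _ (nsub Gt u HG Hu).
  have Nf : nrm (CT T) f M := sl _ _ (nsub Ft u HF Hu).
  have No : nrm (CT T) o _ := sl _ _ (nO u Hu).
  have Npg : nrm (CT T) (prim0 T g) (kap * M) := sl _ _ (nk Gt u HG Hu).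
  pose h t := o t + e * f t.
  have Nh : nrm (CT T) h _ := nrm_add _ No (nrm_scal _ e _ _ Nf).
  pose ph t := w1 * (e * prim0 T g t) + h t.
  have Nph : nrm (CT T) ph _ := nrm_add _ (nrm_scal _ w1 _ _ (nrm_scal _ e _ _ Npg)) Nh.
  have Ebe t : be t = e * prim0 T g t - / w1 * mean T h t := esym (Eu (((t, e), c), false) (Dz t)).
  have Eal t : al t = c + prim0 T ph t := esym (Eu (((t, e), c), true) (Dz t)).
  have Mph t : mean T ph t = mean T h t.
    have -> : ph = (fun t => h t + (w1 * e) * prim0 T g t).
      by apply: functional_extensionality => s; rewrite /ph; ring.
    by rewrite (mean_lin T _ _ _ _ (w1 * e) t Nh Npg) (mean_prim0 T T0 g M t Ng); ring.
  split.
  + move=> t.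
    apply: (is_derive_ext (fun t => c + prim0 T ph t)); first by move=> s; rewrite Eal.
    have -> : w1 * be t + O2 (tt, be t) + e * Ft (t, be t, al t) = plus 0 (ph t - mean T ph t).
      have E : w1 * be t = w1 * (e * prim0 T g t) - mean T h t by rewrite Ebe; field.
      have E' : ph t = w1 * (e * prim0 T g t) + (o t + e * f t) by [].
      rewrite Mph E E' /plus /= -/(o t) -/(f t); ring.
    apply: is_derive_plus; first exact: is_derive_const.
    exact: prim0_derive Nph.
  + move=> t.
    apply: (is_derive_ext (fun t => e * prim0 T g t - / w1 * mean T h 0)).
      by move=> s; rewrite Ebe.
    have -> : e * (Gt (t, be t, al t) - mean T (fun t0 => Gt (t0, be t0, al t0)) t)
       = minus (e * (g t - mean T g t)) 0 by rewrite minus_zero_r.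
    apply: is_derive_minus; last exact: is_derive_const.
    by apply: is_derive_scal; apply: prim0_derive Ng.
  (* Now [b] is a constant solving [b = - O2 (b) / w1]; the Lipschitz bound gives
     [Rabs b <= Rabs b / 4], so [b = 0], and the source term of [a] vanishes. *)
  + move=> e0 t.
    have be_c s : be s = be 0.
      by rewrite !Ebe e0 /mean; ring.
    have E1 : be 0 = - / w1 * O2 (tt, be 0).
      have Eh : h = (fun=> O2 (tt, be 0)).
        by apply: functional_extensionality => s; rewrite /h /o be_c e0; ring.
      by rewrite {1}Ebe e0 Eh mean_const //; ring.
    have x0 : Rabs (be 0) <= U / 2 := nrm_bound A Hu2 (Dz 0).
    have N1 : nrm U0 (fun=> 0) (U / 2) by rewrite /= Rabs_R0; exact: Rlt_le R00.
    have N2 : nrm U0 (fun=> be 0 - 0) (Rabs (be 0)) by rewrite /= Rminus_0_r; apply: Rle_refl.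
    have [_ _ _ q] := lip_ps U0 U0 U (fun=> tt) (fun=> tt) (fun=> be 0) (fun=> 0) 0 (Rabs (be 0))
      (lip_refl _ _ _ (pb_const U0)) x0 N1 N2.
    have := q _ _ HO2; rewrite /= O20 Rminus_0_r => H.
    have {}H : Rabs (O2 (tt, be 0)) <= LO * Rabs (be 0).
      apply: Rle_trans H _; apply: Req_le; rewrite /LO; field; lra.
    have LO2 : / Rabs w1 * LO <= / 4 by nra.
    have b0 : be 0 = 0.
      apply: Rabs_eq_0.
      have E2 : Rabs (be 0) = / Rabs w1 * Rabs (O2 (tt, be 0)) by rewrite {1}E1 Rabs_mult Rabs_Ropp Rabs_inv.
      have := Rabs_pos (be 0); move: H E2; set x := Rabs (be 0); set y := Rabs _ => H E2 Hx.
      have : x <= / Rabs w1 * (LO * x) by rewrite {1}E2; apply: Rmult_le_compat_l => //; lra.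
      rewrite -Rmult_assoc; nra.
    split; last by rewrite be_c.
    rewrite Eal.
    have -> : ph = (fun=> 0).
      by apply: functional_extensionality => s; rewrite /ph /h /o be_c b0 O20 e0; ring.
    by rewrite (lin_op_0 _ _ _ (prim0_op T T0) t I); ring.
Qed.
End LyapunovSchmidt.

(** * Subharmonic solutions *)

Lemma ps2_shrink {X} (A : falg X) (r r' : posreal) F M : r' <= r ->
  nrm (ps (ps A r) r) F M -> nrm (ps (ps A r') r') F M.
Proof.
move=> Hr; have [_ H] : pb (ps (ps A r) r) (ps (ps A r') r') (fun z => ((z.1.1, z.1.2), z.2)).
  apply: pb_ps; last by apply: nrm_le (ps_var _ r') Hr.
  apply: pb_ps.
    exact: pb_comp (pb_fst A r') (pb_fst (ps A r') r').
  by apply: nrm_le Hr; apply: (ps_base (ps A r') r' (fun z => z.2)); apply: ps_var.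
by move=> /H; apply: nrm_ext => -[[]].
Qed.

Lemma ps_rep_shrink {X} (A : falg X) (r r' : posreal) F M c m : r' <= r ->
  ps_rep A r F M c m -> ps_rep A r' F M c m.
Proof.
move=> Hr [H1 H2 H3]; split => //.
  move=> n; apply: Rle_trans (H2 n); apply: sum_n_mono => k.
  apply: Rmult_le_compat_l; first exact: nrm_ge0 (H1 k).
  by apply: pow_incr; move: (cond_pos r'); lra.
by move=> z [Hz1 Hz2]; apply: H3; split => //; lra.
Qed.

Lemma vanish_bound {X} (A : falg X) (tau : posreal) U M x s :
  nrm (ps A tau) U M -> (forall x, dom A x -> U (x, 0) = 0) -> dom A x -> 0 < s <= tau ->
  Rabs (U (x, s)) <= s / tau * M.
Proof.
move=> [c [m Hc]] U0' Hx [s0 Hs]; have t0 := cond_pos tau.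
have Hl : 0 <= s / tau <= 1.
  by split; [apply: Rdiv_le_0_compat; lra | apply/Rle_div_l; lra].
have E : (mkposreal s s0 : R) = s / tau * tau by rewrite /=; field; lra.
have V k y : (k < 1)%nat -> dom A y -> c k y = 0.
  move=> Hk Hy; have -> : k = O by lia.
  by rewrite (ps_rep_0 _ _ _ _ _ _ _ Hc) // U0'.
have H := ps_shrink_order A tau (mkposreal s s0) U M c m (s / tau) 1 Hc V Hl E.
rewrite pow_1 in H; apply: (nrm_bound _ H (conj Hx _ : dom (ps A (mkposreal s s0)) (x, s))).
by rewrite /= Rabs_pos_eq; lra.
Qed.

Lemma frac_pow_root (N : nat) (x : R) : (1 <= N)%nat -> 0 < x -> Rpower x (/ INR N) ^ N = x.
Proof.
move=> HN x0; rewrite -Rpower_pow; last exact: exp_pos.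
rewrite Rpower_mult Rinv_l ?Rpower_1 //.
by apply: not_0_INR; lia.
Qed.

Lemma lt_of_pow_lt (x y : R) N : 0 <= x -> 0 <= y -> x ^ N < y ^ N -> x < y.
Proof.
move=> x0 y0 H; apply: Rnot_le_lt => Hle.
by have := pow_incr y x N (conj y0 Hle); lra.
Qed.

(** During one period [2 PI q] the unperturbed angle advances by [2 PI p], a whole number of
    turns. *)
Lemma flow_periodic (W : R -> Prop) (f : R -> R -> R -> R) w (p q : Z) :
  periodic_angle_time W f -> (1 <= q)%Z -> w = IZR p / IZR q ->
  forall x y z, W y -> f (x + w * period q) y (z + period q) = f x y z.
Proof.
move=> H Hq Hw x y z Hy.
have q0 : IZR q <> 0 by apply: not_0_IZR; lia.
have -> : x + w * period q = x + IZR p * (2 * PI) by rewrite Hw /period; field.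
have -> : z + period q = z + IZR q * (2 * PI) by rewrite /period; ring.
rewrite (periodic_IZR (2 * PI) (fun x => f x y (z + IZR q * (2 * PI)))); last first.
  by move=> t; have [-> _] := H t y (z + IZR q * (2 * PI)) Hy.
by rewrite (periodic_IZR (2 * PI) (fun z => f x y z)) // => t; have [_ ->] := H x y t Hy.
Qed.

(* Time translation by [h] trades a shift of the phase [t0] for a shift of the angle. *)
Lemma melnikov_shift omega G A0 q t0 (r : posreal) M h : 0 < period q ->
  nrm (ps (ps (CT (period q)) r) r)
    (fun z => G (omega A0 * z.1.1 + z.2) (A0 + z.1.2) (z.1.1 + t0)) M ->
  Rabs (- omega A0 * h) <= r ->
  melnikov omega G A0 q (t0 + h)
  = mean (period q) (fun t => G (omega A0 * t + - omega A0 * h) (A0 + 0) (t + t0)) 0.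
Proof.
move=> T0 HG Hh; rewrite /melnikov /mean; congr (_ * _).
have z0 : Rabs 0 <= r by rewrite Rabs_R0; move: (cond_pos r); lra.
have [Hc Hp _] := ps_slice _ _ _ _ 0 (ps_slice _ _ _ _ (- omega A0 * h) HG Hh) z0.
set phi := (fun x => _) in Hc Hp.
have exI a b : ex_RInt phi a b by apply: ex_RInt_continuous => *; apply: Hc.
have -> : RInt (fun t => G (alpha0 omega A0 t) A0 (t + (t0 + h))) 0 (period q) = RInt phi h (h + period q) :> R.
  have := RInt_comp_lin phi 1 h 0 (period q) (exI _ _).
  rewrite !Rmult_1_l Rplus_0_l [period q + h]Rplus_comm => <-.
  apply: RInt_ext => x _; rewrite /scal /= /mult /= !Rmult_1_l /phi /= /alpha0 Rplus_0_r.
  by congr (G _ _ _); ring.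
by rewrite (RInt_periodic (period q) phi h Hc Hp).
Qed.

Theorem theorem1 (W : R -> Prop) (omega : R -> R) (F G : R -> R -> R -> R)
    (A0 : R) (p q : Z) (n : nat) (t0 : R)
    (hW : open W)
    (homega : analytic1_on W omega)
    (hF : analytic3_on W F) (hFper : periodic_angle_time W F)
    (hG : analytic3_on W G) (hGper : periodic_angle_time W G)
    (hA0 : W A0)
    (hq : (1 <= q)%Z) (hp : p <> 0%Z) (hpq : Z.gcd p q = 1%Z)
    (hres : omega A0 = IZR p / IZR q)
    (htwist : Derive omega A0 <> 0)
    (hn : Nat.Odd n)
    (ht0 : 0 <= t0 < 2 * PI)
    (hM : zero_of_order n (melnikov omega G A0 q) t0) :
  exists (epsbar : R) (al A : R -> R -> R),
    0 < epsbar /\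
    subharmonic_solution W omega F G A0 q t0 epsbar al A /\
    (fractional_series (fact n) (period q) (alpha_dev omega A0 al) /\
     fractional_series (fact n) (period q) (A_dev A0 A)) /\
    (puiseux_series (period q) (alpha_dev omega A0 al) /\
     puiseux_series (period q) (A_dev A0 A)).
Proof.
pose T := period q; pose w := omega A0; pose w1 := Derive omega A0; pose N := fact n.
have qp : 0 < IZR q by apply: (IZR_lt 0); lia.
have T0 : 0 < T by rewrite /T /period; move: PI_RGT_0; nra.
have w0 : w <> 0.
  rewrite /w hres; apply: Rmult_integral_contrapositive_currified.
    exact: not_0_IZR.
  by apply: Rinv_neq_0_compat; lra.
have N1 : (1 <= N)%nat := fact_ge1 n.
have [rF [MF HF]] := flow_expansion W F w A0 t0 T hW hF hA0 T0 (flow_periodic W F w p q hFper hq hres).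
have [rG [MG HG]] := flow_expansion W G w A0 t0 T hW hG hA0 T0 (flow_periodic W G w p q hGper hq hres).
have [rO [M2 [oc [om [HO HO0]]]]] := omega_expansion W omega A0 homega hA0.
have [dW HW] := W_radius W A0 hW hA0.
have [|r Hr] := exists_radius (cons (rF : R) (cons (rG : R) (cons (rO : R) (cons (dW / 2) nil)))).
  move=> x /= [<-|[<-|[<-|[<-|//]]]]; try exact: cond_pos; move: (cond_pos dW); lra.
have r0 := cond_pos r.
have {}HF := ps2_shrink _ _ r _ _ (Hr _ (or_introl erefl)) HF.
have {}HG := ps2_shrink _ _ r _ _ (Hr _ (or_intror (or_introl erefl))) HG.
have {}HO := ps_rep_shrink _ _ r _ _ _ _ (Hr _ (or_intror (or_intror (or_introl erefl)))) HO.
have rW : r < dW.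
  have := Hr (dW / 2) (or_intror (or_intror (or_intror (or_introl erefl)))).
  by move: (cond_pos dW); lra.
pose Ft (z : (R * R) * R) := F (w * z.1.1 + z.2) (A0 + z.1.2) (z.1.1 + t0).
pose Gt (z : (R * R) * R) := G (w * z.1.1 + z.2) (A0 + z.1.2) (z.1.1 + t0).
pose O2 (z : unit * R) := omega (A0 + z.2) - omega A0 - w1 * z.2.
pose M := Rmax MF MG.
have {}HF : nrm (ps (ps (CT T) r) r) Ft M := nrm_le _ _ HF (Rmax_l _ _).
have {}HG : nrm (ps (ps (CT T) r) r) Gt M := nrm_le _ _ HG (Rmax_r _ _).
have [rho [rc [a [b [Ha Hb HB Hsol]]]]] :=
  lyapunov_schmidt T w1 M M2 r Ft Gt O2 oc om T0 htwist HF HG HO HO0.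
set B := (fun z => _) in HB.
have rho0 := cond_pos rho; have rc0 := cond_pos rc.
have z0 (x : posreal) : Rabs 0 <= x by rewrite Rabs_R0; move: (cond_pos x); lra.
(* Read off at [eps = 0], where [a] equals [c] while its norm is at most [r]. *)
have rcr : rc <= r.
  have Hrc : Rabs rc <= rc by rewrite Rabs_pos_eq; lra.
  have [_ _ /(_ erefl 0) [E _]] := Hsol 0 rc (z0 rho) Hrc.
  have := nrm_bound _ Ha (conj (conj I (z0 rho)) Hrc : dom (ps (ps (CT T) rho) rc) ((0, 0), rc : R)).
  by move: E => /= ->; rewrite Rabs_pos_eq; lra.
have Hord : order_at_0 n (fun x => B ((tt, 0), x)).
  have [c [m Hc]] := HB.
  have st := ps_rep_slice _ _ _ _ _ _ (tt, 0) Hc (conj I (z0 rho)).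
  have wa : 0 < Rabs w by apply: Rabs_pos_lt.
  have dp : 0 < rc / Rabs w by apply: Rdiv_lt_0_compat.
  (* The variables are related by [c = - w * h]; [w <> 0], which comes from [p <> 0], makes the
     order in [c] equal to the order in [h]. *)
  have Hmel : sums_to (fun k => c k (tt, 0) * (- w) ^ k) (rc / Rabs w) (fun h => melnikov omega G A0 q (t0 + h)).
    move=> h Hh.
    have Hwh : Rabs (- w * h) < rc.
      rewrite Rabs_mult Rabs_Ropp Rmult_comm; exact/Rlt_div_r.
    have Hwr : Rabs (- w * h) <= r by lra.
    rewrite (melnikov_shift omega G A0 q t0 r M h T0 HG Hwr).
    have := st (- w * h) Hwh.
    have [_ _ Eab] := Hsol 0 (- w * h) (z0 rho) (Rlt_le _ _ Hwh).
    have -> : B ((tt, 0), - w * h) = mean (period q) (fun t => G (omega A0 * t + - omega A0 * h) (A0 + 0) (t + t0)) 0.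
      rewrite /B /=; congr (mean T _ 0); apply: functional_extensionality => t.
      have [E1 E2] := Eab erefl t; simpl in E1, E2; rewrite /Gt /= E1 E2.
      by [].
    have E k : c k (tt, 0) * (- w * h) ^ k = c k (tt, 0) * (- w) ^ k * h ^ k.
      by rewrite Rpow_mult_distr; ring.
    exact: (is_series_ext _ _ _ E).
  have Dn k : Derive_n (melnikov omega G A0 q) k t0 = c k (tt, 0) * (- w) ^ k * INR (fact k).
    rewrite -(sums_to_Derive_n _ _ _ k dp Hmel).
    rewrite -[t0 in LHS]Rplus_0_l -Derive_n_comp_trans; apply: Derive_n_ext => x.
    by rewrite Rplus_comm.
  have [hM1 hM2] := hM.
  exists rc, (fun k => c k (tt, 0)); split => //.
    move=> k /hM1; rewrite Dn => /Rmult_integral [/Rmult_integral [//|]|].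
      by move=> H; case: (pow_nonzero (- w) k _ H); lra.
    by move=> H; have := INR_fact_lt_0 k; lra.
  by move=> H; apply: hM2; rewrite Dn H; ring.
pose sg (s : bool) : R := if s then 1 else -1.
have sg1 s : Rabs (sg s) = 1 by case: s; rewrite /sg ?Rabs_Ropp Rabs_R1.
(* [puiseux_root] has parameter [x ^ N], which need not take both signs; applying it to [B (eps, c)]
   and [B (- eps, c)] covers both sides of [0]. *)
have branch (s : bool) : exists U : posreal * ((R * R -> R) * (R * R -> R)),
   [/\ nrm (ps (CT T) U.1) U.2.1 r, nrm (ps (CT T) U.1) U.2.2 r,
       forall t, U.2.1 (t, 0) = 0 /\ U.2.2 (t, 0) = 0
     & forall x, Rabs x <= U.1 -> forall t,
       is_derive (fun t => U.2.1 (t, x)) t (w1 * U.2.2 (t, x) + O2 (tt, U.2.2 (t, x)) + (sg s * x ^ N) * Ft ((t, U.2.2 (t, x)), U.2.1 (t, x)))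
       /\ is_derive (fun t => U.2.2 (t, x)) t ((sg s * x ^ N) * Gt ((t, U.2.2 (t, x)), U.2.1 (t, x)))].
  have Hs : nrm (ps (ps U0 rho) rc) (fun z => B ((tt, sg s * z.1.2), z.2)) M.
    have [_ H] : pb (ps (ps U0 rho) rc) (ps (ps U0 rho) rc) (fun z => ((tt, sg s * z.1.2), z.2)).
      apply: (pb_base _ _ _ (fun y => (tt, sg s * y.2))); apply: pb_ps; first exact: pb_const.
      have := nrm_scal _ (sg s) _ _ (ps_var U0 rho); rewrite sg1 Rmult_1_l; exact.
    exact: H.
  have Hso : order_at_0 n (fun x => B ((tt, sg s * 0), x)) by rewrite Rmult_0_r.
  have [tau [x [Hx x0 Ex]]] := puiseux_root n hn rho rc _ M Hs Hso.
  have tp := cond_pos tau.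
  have Htau : tau ^ N <= rho.
    have [|H _] := Ex tau; first by rewrite Rabs_pos_eq; lra.
    by apply: Rle_trans H; apply: Rle_abs.
  (* Substituting the branch for [eps] and [c] turns [a] and [b] into series in one variable with
     periodic coefficients, on a disc independent of time. *)
  have [_ Q] : pb (ps (ps (CT T) rho) rc) (ps (CT T) tau) (fun z => ((z.1, sg s * z.2 ^ N), x (tt, z.2))).
    apply: pb_ps.
      apply: pb_ps; first exact: pb_fst.
      have := nrm_scal _ (sg s) _ _ (nrm_pow _ _ _ N (ps_var (CT T) tau)); rewrite sg1 Rmult_1_l => H.
      exact: nrm_le H Htau.
    have [_ H] := pb_base U0 (CT T) tau _ (pb_const (CT T)).
    exact: H _ _ Hx.
  have sN y : Rabs y <= tau -> Rabs (sg s * y ^ N) <= rho.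
    by move=> /Ex [H _]; rewrite Rabs_mult sg1 Rmult_1_l.
  have xb y : Rabs y <= tau -> Rabs (x (tt, y)) <= rc.
    by move=> Hy; apply: (nrm_bound _ Hx (conj I Hy : dom (ps U0 tau) (tt, y))).
  exists (tau, ((fun z => a ((z.1, sg s * z.2 ^ N), x (tt, z.2))), (fun z => b ((z.1, sg s * z.2 ^ N), x (tt, z.2))))).
  split; rewrite /=; [exact: Q | exact: Q | |].
  - move=> t; have E : sg s * 0 ^ N = 0 by rewrite pow_i //; ring.
    have [_ _ /(_ E t)] := Hsol _ _ (sN 0 (z0 tau)) (xb 0 (z0 tau)).
    by rewrite x0.
  - move=> y Hy t; have [D1 D2 _] := Hsol _ _ (sN y Hy) (xb y Hy).
    split; first exact: D1.
    have := D2 t; have [_ EB] := Ex y Hy.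
    by move: EB; rewrite /B /mean /= => ->; rewrite Rminus_0_r.
have [U HU] := choice _ branch.
have Npos : 0 < INR N by apply: lt_0_INR; lia.
(* [Rpower 0 y = exp (y * ln 0) = 1], hence the case distinction. *)
pose root x := if Req_dec_T x 0 then 0 else Rpower (Rabs x) (/ INR N).
(* [sb 0] is [false], but the branches agree at [0], where all four functions vanish. *)
pose sb x : bool := if Rlt_dec 0 x then true else false.
have root0 x : 0 <= root x.
  by rewrite /root; case: Req_dec_T => _ /=; [lra | apply: Rlt_le; apply: exp_pos].
have rootN x : root x ^ N = Rabs x.
  rewrite /root; case: Req_dec_T => Hx /=; first by rewrite pow_i // Hx Rabs_R0.
  by apply: frac_pow_root => //; apply: Rabs_pos_lt.
have rootS x : sg (sb x) * root x ^ N = x.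
  rewrite rootN /sb /sg; case: Rlt_dec => Hx /=; [rewrite Rabs_pos_eq | rewrite Rabs_left1]; lra.
pose eb := Rmin ((U true).1 ^ N) ((U false).1 ^ N).
have eb0 : 0 < eb by apply: Rmin_pos; apply: pow_lt; apply: cond_pos.
have ebs s : eb <= (U s).1 ^ N by case: s; [apply: Rmin_l | apply: Rmin_r].
have rootb s x : Rabs x < eb -> Rabs (root x) <= (U s).1.
  move=> Hx; rewrite Rabs_pos_eq //; apply: Rlt_le; apply: (lt_of_pow_lt _ _ N) => //.
    by apply: Rlt_le; apply: cond_pos.
  by rewrite rootN; move: (ebs s); lra.
pose al x t := alpha0 omega A0 t + (U (sb x)).2.1 (t, root x).
pose AA x t := A0 + (U (sb x)).2.2 (t, root x).
have dal x t : alpha_dev omega A0 al x t = (U (sb x)).2.1 (t, root x) by rewrite /alpha_dev /al; ring.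
have dA x t : A_dev A0 AA x t = (U (sb x)).2.2 (t, root x) by rewrite /A_dev /AA; ring.
have tends (V : bool -> R * R -> R) : (forall s, nrm (ps (CT T) (U s).1) (V s) r) -> (forall s t, V s (t, 0) = 0) ->
   tends_to_0_uniformly (fun x t => V (sb x) (t, root x)).
  move=> HV V0 eta eta0.
  (* By [vanish_bound] a deviation is at most [root x / (U s).1 * r], so the second bound on
     [root x] makes it at most [eta / 2]. *)
  have kp s : 0 < Rmin (U s).1 (eta * (U s).1 / (2 * r)).
    have us := cond_pos (U s).1; apply: Rmin_pos => //.
    by apply: Rdiv_lt_0_compat; [apply: Rmult_lt_0_compat | lra].
  pose k s := Rmin (U s).1 (eta * (U s).1 / (2 * r)).
  have dp : 0 < Rmin (k true ^ N) (k false ^ N) by apply: Rmin_pos; apply: pow_lt; apply: kp.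
  have dps s : Rmin (k true ^ N) (k false ^ N) <= k s ^ N by case: s; [apply: Rmin_l | apply: Rmin_r].
  exists (mkposreal _ dp) => x Hx xn0 t.
  have {}Hx : Rabs x < Rmin (k true ^ N) (k false ^ N).
    by move: Hx; rewrite /ball /= /AbsRing_ball /abs /minus /plus /opp /= Ropp_0 Rplus_0_r.
  set s := sb x.
  have rk : root x < k s.
    apply: (lt_of_pow_lt _ _ N) => //; first by apply: Rlt_le; apply: kp.
    by rewrite rootN; move: (dps s); lra.
  have rp : 0 < root x by rewrite /root; case: Req_dec_T => [//|?] /=; apply: exp_pos.
  have us := cond_pos (U s).1.
  have k1 : k s <= (U s).1 by apply: Rmin_l.
  have k2 : k s <= eta * (U s).1 / (2 * r) by apply: Rmin_r.
  have Hrx : 0 < root x <= (U s).1 by lra.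
  apply: Rle_lt_trans (vanish_bound _ _ _ _ t _ (HV s) (fun t _ => V0 s t) I Hrx) _.
  apply: Rle_lt_trans (_ : _ <= k s / (U s).1 * r) _.
    apply: Rmult_le_compat_r; first lra.
    by apply: Rmult_le_compat_r; [apply: Rlt_le; apply: Rinv_0_lt_compat | lra].
  apply: Rle_lt_trans (_ : _ <= eta * (U s).1 / (2 * r) / (U s).1 * r) _.
    apply: Rmult_le_compat_r; first lra.
    by apply: Rmult_le_compat_r; [apply: Rlt_le; apply: Rinv_0_lt_compat | lra].
  have -> : eta * (U s).1 / (2 * r) / (U s).1 * r = eta / 2 by field; lra.
  lra.
have frac (V : bool -> R * R -> R) : (forall s, nrm (ps (CT T) (U s).1) (V s) r) ->
   fractional_series N T (fun x t => V (sb x) (t, root x)).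
  move=> HV s Hs.
  pose s' : bool := if Rlt_dec 0 s then true else false.
  have [c [m [C1 C2 C3]]] := HV s'.
  exists c, ((U s').1 ^ N); split; first by apply: pow_lt; apply: cond_pos.
  split; first by move=> k t; have [_ H _] := C1 k; apply: H.
  move=> x t [Hx1 Hx2]; apply/is_pseries_R.
  have Ex : sb x = s' /\ Rabs x = s * x.
    rewrite /s' /sb; case: Hs Hx1 => -> Hx1.
      by case: (Rlt_dec 0 x) => Hx; case: (Rlt_dec 0 1) => H01 /=; try lra; split => //; rewrite Rabs_pos_eq; lra.
    by case: (Rlt_dec 0 x) => Hx; case: (Rlt_dec 0 (-1)) => H01 /=; try lra; split => //; rewrite Rabs_left; lra.
  have [-> Eax] := Ex.
  have Er : root x = Rpower (Rabs x) (/ INR N).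
    by rewrite /root; case: Req_dec_T => [x00|//]; exfalso; move: Hx1; rewrite x00; lra.
  rewrite -Er; apply: (C3 (t, root x)); split => //=.
  rewrite Rabs_pos_eq //; apply: Rlt_le; apply: (lt_of_pow_lt _ _ N) => //.
    by apply: Rlt_le; apply: cond_pos.
  by rewrite rootN Eax.
have EV1 : alpha_dev omega A0 al = (fun x t => (U (sb x)).2.1 (t, root x)).
  by do 2 (apply: functional_extensionality => ?); rewrite dal.
have EV2 : A_dev A0 AA = (fun x t => (U (sb x)).2.2 (t, root x)).
  by do 2 (apply: functional_extensionality => ?); rewrite dA.
have H1 s : nrm (ps (CT T) (U s).1) (U s).2.1 r by have [] := HU s.
have H2 s : nrm (ps (CT T) (U s).1) (U s).2.2 r by have [] := HU s.
have FR1 := frac (fun s => (U s).2.1) H1; have FR2 := frac (fun s => (U s).2.2) H2.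
exists eb, al, AA; rewrite EV1 EV2; split => //; split; last first.
  by split => //; split; exists N; split.
rewrite /subharmonic_solution EV1 EV2; split; last first.
  split; first by apply: (tends (fun s => (U s).2.1)) => // s t; have [_ _ /(_ t) []] := HU s.
  by apply: (tends (fun s => (U s).2.2)) => // s t; have [_ _ /(_ t) []] := HU s.
move=> x Hx; have rb := rootb (sb x) x Hx; split; last first.
  split.
    by move=> t; have [_ H _] := ps_slice _ _ _ _ _ (H1 (sb x)) rb; apply: H.
  by move=> t; have [_ H _] := ps_slice _ _ _ _ _ (H2 (sb x)) rb; apply: H.
move=> t; have [_ _ _ /(_ _ rb t) [D1 D2]] := HU (sb x).
rewrite rootS in D1 D2; split; last split.
- apply: HW; apply: Rle_lt_trans rW.
  exact: (nrm_bound _ (H2 (sb x)) (conj I rb : dom (ps (CT T) (U (sb x)).1) (t, root x))).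
- rewrite /al /AA.
  set u := (U (sb x)).2.1 in D1 *; set v := (U (sb x)).2.2 in D1 *.
  have -> : omega (A0 + v (t, root x)) + x * F (alpha0 omega A0 t + u (t, root x)) (A0 + v (t, root x)) (t + t0)
     = plus w (w1 * v (t, root x) + O2 (tt, v (t, root x)) + x * Ft (t, v (t, root x), u (t, root x))).
    by rewrite /plus /= /O2 /Ft /= /w /alpha0; ring.
  apply: is_derive_plus => //.
  by rewrite /alpha0 -/w; auto_derive => //; ring.
- rewrite /al /AA.
  set u := (U (sb x)).2.1 in D2 *; set v := (U (sb x)).2.2 in D2 *.
  have -> : x * G (alpha0 omega A0 t + u (t, root x)) (A0 + v (t, root x)) (t + t0)
     = plus 0 (x * Gt (t, v (t, root x), u (t, root x))) by rewrite /plus /= Rplus_0_l.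
  by apply: is_derive_plus => //; apply: is_derive_const.
Qed.
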